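(* For all $m>0$ and all $\lambda>0$ the minimization problems $$\min\left\{\overline{P^r_C}(E)+\lambda\int_E\int_E\log\left(\frac1{|x-y|}\right)\,\mathrm dx\,\mathrm dy\ \Big|\ E\subset\mathbb R^2\text{ measurable},\ |E|=m\right\}$$ and $$\min\left\{\overline{P^r_S}(E)+\lambda\int_E\int_E\log\left(\frac1{|x-y|}\right)\,\mathrm dx\,\mathrm dy\ \Big|\ E\subset\mathbb R^2\text{ measurable},\ |E|=m\right\}$$ admit solutions. Furthermore, there exists a constant $C>0$, depending only on $m$ and $\lambda$, such that any solution $E$ of either minimization problem satisfies $\operatorname{diam}(E)<C$.
   Context: $|E|$ denotes Lebesgue measure on $\mathbb R^2$ and $P$ the usual (De Giorgi) perimeter. For measurable $E\subset\mathbb R^2$ the connected perimeter is $$\overline{P^r_C}(E)=\inf\{\liminf_{n\to\infty}P(E_n)\mid E_n\to E\text{ in }L^1,\ E_n\text{ connected and }C^\infty\text{-smooth}\},$$ and the simply connected perimeter is $$\overline{P^r_S}(E)=\inf\{\liminf_{n\to\infty}P(E_n)\mid E_n\to E\text{ in }L^1,\ E_n\text{ simply connected and }C^\infty\text{-smooth}\}.$$ Here $E_n\to E$ in $L^1$ means $\chi_{E_n}\to\chi_E$ in $L^1(\mathbb R^2)$. The functional to be minimized is understood to be $+\infty$ when the relaxed perimeter ($\overline{P^r_C}(E)$, respectively $\overline{P^r_S}(E)$) is $+\infty$. The diameter of a measurable set is the essential diameter $$\operatorname{diam}(E)=\sup\{|x-y|\ :\ |E\cap B_r(x)|>0\text{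 and }|E\cap B_r(y)|>0\ \ \forall r>0\},$$ where $B_r(x)$ is the ball of radius $r$ around $x$ in $\mathbb R^2$. *)

(* Defs.v *)
From HB Require Import structures.
From mathcomp Require Import all_boot all_order all_algebra.
From mathcomp Require Import all_classical all_reals all_analysis.

Set Implicit Arguments.
Unset Strict Implicit.
Unset Printing Implicit Defensive.

Import Order.TTheory GRing.Theory Num.Theory.
Import numFieldNormedType.Exports.

Local Open Scope classical_set_scope.
Local Open Scope ring_scope.

(* The norm that the library puts on [R * R] is the sup norm, hence the explicit
   Euclidean structure. *)
Definition dotp {R : realType} (x y : R * R) : R := x.1 * y.1 + x.2 * y.2.
Definition enorm {R : realType} (x : R * R) : R := Num.sqrt (dotp x x).
Definition eball {R : realType} (x : R * R) (r : R) : set (R * R) :=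
  [set y | enorm (y - x) < r].

Definition borel_leb2 {R : realType} :
    {measure set (measurableTypeR R * measurableTypeR R) -> \bar R} :=
  (@lebesgue_measure R \x @lebesgue_measure R)%E.

(* [leb2_type R] is [R * R] with the Lebesgue sigma-algebra, i.e. the completion
   of the Borel sets (as Caratheodory-measurable sets), [leb2] the Lebesgue
   measure on it. *)
Definition leb2_type (R : realType) : Type :=
  caratheodory_type (mu_ext (@borel_leb2 R)).
HB.instance Definition _ (R : realType) := Measurable.on (leb2_type R).

Definition leb2 {R : realType} : set (leb2_type R) -> \bar R :=
  @completed_measure_extension _ _ _ (@borel_leb2 R).
HB.instance Definition _ (R : realType) := Measure.on (@leb2 R).

Definition leb2_measurable {R : realType} (E : set (R * R)) : Prop :=
  measurable (E : set (leb2_type R)).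

Definition e1 {R : realType} : R * R := (1, 0).
Definition e2 {R : realType} : R * R := (0, 1).

Definition C1_fun {R : realType} (f : R * R -> R) : Prop :=
  [/\ forall x, derivable f x e1 /\ derivable f x e2,
      continuous ('D_e1 f) & continuous ('D_e2 f)].

Definition perimeter_test {R : realType} (phi : R * R -> R * R) : Prop :=
  [/\ C1_fun (fst \o phi) /\ C1_fun (snd \o phi),
      compact (closure [set x | phi x != 0]) &
      forall x, enorm (phi x) <= 1].

Definition divergence {R : realType} (phi : R * R -> R * R) (x : R * R) : R :=
  'D_e1 (fst \o phi) x + 'D_e2 (snd \o phi) x.

Definition perimeter {R : realType} (E : set (R * R)) : \bar R :=
  ereal_sup [set (\int[@leb2 R]_(x in E) (divergence phi x)%:E)%E
            | phi in @perimeter_test R].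

Definition smooth_fun {R : realType} (g : R -> R) : Prop :=
  forall n x, derivable (derive1n n g) x 1.

(* Open sets lying locally on one side of a smooth boundary: near each boundary
   point [E] is the strict epigraph of a smooth function in the orthonormal frame
   [((nu.2, - nu.1), nu)]. *)
Definition smooth_set {R : realType} (E : set (R * R)) : Prop :=
  open E /\
  forall p, (closure E `\` E°) p ->
    exists (r : R) (nu : R * R) (g : R -> R),
      [/\ 0 < r, enorm nu = 1, smooth_fun g &
          forall x, eball p r x ->
            (E x <-> g (dotp x (nu.2, - nu.1)) < dotp x nu)].

Definition unit_itv {R : realType} : set R := `[0, 1]%classic.

Definition is_path_in {R : realType} {T : topologicalType} (A : set T)
    (gam : R -> T) : Prop :=
  {within unit_itv, continuous gam} /\ gam @` unit_itv `<=` A.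

Definition path_connected (R : realType) {T : topologicalType}
    (A : set T) : Prop :=
  forall x y, A x -> A y ->
    exists gam : R -> T, [/\ is_path_in A gam, gam 0 = x & gam 1 = y].

Definition null_homotopic_in {R : realType} {T : topologicalType} (A : set T)
    (gam : R -> T) : Prop :=
  exists H : R * R -> T,
    [/\ {within unit_itv `*` unit_itv, continuous H},
        H @` (unit_itv `*` unit_itv) `<=` A,
        forall t, unit_itv t -> H (0, t) = gam t,
        forall t, unit_itv t -> H (1, t) = gam 0 &
        forall s, unit_itv s -> H (s, 0) = gam 0 /\ H (s, 1) = gam 0].

Definition simply_connected (R : realType) {T : topologicalType}
    (A : set T) : Prop :=
  path_connected R A /\
  forall gam : R -> T, is_path_in A gam -> gam 0 = gam 1 ->
    null_homotopic_in A gam.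

Definition L1_cvg {R : realType} (En : nat -> set (R * R)) (E : set (R * R)) :
    Prop :=
  (fun n => \int[@leb2 R]_x (`|\1_(En n) x - \1_E x|)%:E)%E @ \oo --> 0%E.

Definition relaxed_perimeter {R : realType} (Q : set (R * R) -> Prop)
    (E : set (R * R)) : \bar R :=
  ereal_inf [set limn_einf (fun n => perimeter (En n)) | En in
    [set En : nat -> set (R * R) |
      L1_cvg En E /\ forall n, Q (En n) /\ smooth_set (En n)]].

Definition connected_perimeter {R : realType} : set (R * R) -> \bar R :=
  relaxed_perimeter (@connected _).

Definition simply_connected_perimeter {R : realType} : set (R * R) -> \bar R :=
  relaxed_perimeter (@simply_connected R _).

(* On the diagonal [ln] takes its junk value [ln 0 = 0], on a null set. *)
Definition log_energy {R : realType} (E : set (R * R)) : \bar R :=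
  (\int[@leb2 R]_(x in E) \int[@leb2 R]_(y in E) (ln (1 / enorm (x - y)))%:E)%E.

(* The case split is needed because [+oo + -oo = -oo] in [\bar R]. *)
Definition energy {R : realType} (Per : set (R * R) -> \bar R) (lambda : R)
    (E : set (R * R)) : \bar R :=
  if Per E == +oo%E then +oo%E else (Per E + lambda%:E * log_energy E)%E.

Definition is_minimizer {R : realType} (Per : set (R * R) -> \bar R)
    (m lambda : R) (E : set (R * R)) : Prop :=
  [/\ leb2_measurable E, @leb2 R E = m%:E &
      forall F : set (R * R), leb2_measurable F -> @leb2 R F = m%:E ->
        (energy Per lambda E <= energy Per lambda F)%E].

Definition ess_point {R : realType} (E : set (R * R)) (x : R * R) : Prop :=
  forall r : R, 0 < r -> (0 < @leb2 R (E `&` eball x r))%E.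

Definition ess_diam {R : realType} (E : set (R * R)) : \bar R :=
  ereal_sup [set d | exists x y : R * R,
    [/\ ess_point E x, ess_point E y & d = (enorm (x - y))%:E]].

(* Main.v *)
(* A connected smooth open set of perimeter p has width at most 6p in both coordinate
   directions: otherwise one could glue, along the chain of columns it crosses, vector
   fields whose flux through the boundary exceeds p.  Hence the approximating sets in
   the relaxation of a set E of mass m and finite relaxed perimeter p all lie in one
   cube of side of order p, and so does E up to a null set.  On such a set the
   logarithmic energy is at least -m^2 ln(const (p + 1)), so that bounded energy bounds
   p; this confines minimizing sequences (after translation) and minimizers to a fixed
   cube.  There sets of bounded perimeter are precompact in L^1: their translates by h
   differ from them by at most |h| p in area, so each is close to a union of cells of a
   fine grid.  The interaction is continuous along L^1 convergence inside the cube, since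
   the potential of a set of small area is uniformly small, and the approximating smooth
   sets of the minimizing sequence converge to the limit themselves, which makes them
   admissible in the relaxation.  The disk of area m shows that the infimum is finite. *)

From HB Require Import structures.
Require Import Defs.
From mathcomp Require Import all_boot all_order all_algebra.
From mathcomp Require Import all_classical all_reals all_analysis.
From mathcomp Require Import measurable_realfun lra ring.

Set Implicit Arguments.
Unset Strict Implicit.
Unset Printing Implicit Defensive.

Import Order.TTheory GRing.Theory Num.Theory.
Import numFieldNormedType.Exports.

Local Open Scope classical_set_scope.
Local Open Scope ring_scope.

(** * Planar Lebesgue measure *)

(** The perimeter is a supremum over test fields and is used only in that form: a lower bound means
    exhibiting a C^1 field of bounded support and length at most 1, and the one genuine upper bound,
    for the disk, means integrating derivatives along chords. Two obstacles shape the rest. The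
    fields of the translation estimate are difference quotients, so the indicator of a set must be
    approximated by functions whose primitive in one variable is C^1 in both; hence the sums of
    products of one-variable functions. Moreover the sets to be minimized over are only Lebesgue
    measurable, whereas invariance, Tonelli and the potential are developed for Borel sets and the
    product measure; each such set is therefore replaced by the upper limit of its own smooth
    approximants, which is Borel and differs from it by a null set. Both relaxations are treated at
    once through a class [Q] of connected sets that is stable under translation. Disks belong to
    both classes, so one competitor yields a diameter bound common to the two problems. *)

Section BorelPlane.
Context {R : realType}.
Notation lam := (@lebesgue_measure R).
Notation T1 := (measurableTypeR R).
Notation T2 := (T1 * T1)%type.
Notation mu2 := (lam \x lam)%E.

Lemma leb2_borel (A : set T2) : measurable A ->
  leb2_measurable A /\ @leb2 R A = mu2 A.
Proof.
move=> mA; split; first exact: caratheodory_measurable_mu_ext.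
by rewrite /leb2 /completed_measure_extension measurable_mu_extE.
Qed.

Let idL (x : leb2_type R) : T2 := x.

Let measurable_idL : measurable_fun setT idL.
Proof. by move=> _ A mA; rewrite setTI; exact: (leb2_borel mA).1. Qed.

Lemma ge0_integral_leb2 (D : set T2) (f : T2 -> \bar R) :
  measurable D -> measurable_fun D f -> (forall x, D x -> (0 <= f x)%E) ->
  (\int[@leb2 R]_(x in D) f x = \int[mu2]_(x in D) f x)%E.
Proof.
move=> mD mf f0.
(* The identity is measurable from the completed sigma-algebra to the Borel one, and the image of
   [leb2] under it is the product measure. *)
transitivity (\int[pushforward (@leb2 R) idL]_(x in D) f x)%E.
  rewrite ge0_integral_pushforward//.
  by move=> x /set_mem; exact: f0.
apply: eq_measure_integral => A mA _.
by rewrite /pushforward /= -(leb2_borel mA).2.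
Qed.

Lemma integral_leb2 (D : set T2) (f : T2 -> \bar R) :
  measurable D -> measurable_fun D f ->
  (\int[@leb2 R]_(x in D) f x = \int[mu2]_(x in D) f x)%E.
Proof.
move=> mD mf; rewrite integralE [RHS]integralE.
by rewrite !ge0_integral_leb2//; [exact: measurable_funeneg|exact: measurable_funepos].
Qed.

(** A product measure is determined by its values on rectangles, so invariance is checked there
    only. *)
Lemma mu2_invariant (phi : T2 -> T2) : measurable_fun setT phi ->
  (forall A B : set T1, measurable A -> measurable B ->
     mu2 (phi @^-1` (A `*` B)) = (lam A * lam B)%E) ->
  forall A : set T2, measurable A -> mu2 (phi @^-1` A) = mu2 A.
Proof.
move=> mphi phiE A mA; apply/esym.
exact: (product_measure_unique (m1 := lam) (m2 := lam)
         (m' := pushforward mu2 phi)).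
Qed.

Lemma measurable_addr (a : R) : measurable_fun [set: T1] (fun x : T1 => x + a : T1).
Proof. exact: measurable_funD. Qed.

Lemma measurable_scaler (c : R) : measurable_fun [set: T1] (fun x : T1 => c * x : T1).
Proof. exact: measurable_funM. Qed.

Lemma lam_translate (a : R) (A : set T1) : measurable A ->
  lam ((fun x => x + a) @^-1` A) = lam A.
Proof.
move=> mA; apply/esym.
pose nu : {measure set T1 -> \bar R} := pushforward lam (fun x : T1 => x + a : T1).
apply: (lebesgue_measure_unique (mu := nu (measurable_addr a))) => //.
move=> X /ocitvP[->|[[u v] /= uv ->]]; first by rewrite !measure0.
rewrite /pushforward /=.
rewrite (_ : _ @^-1` _ = `]u - a, v - a]%classic); last first.
  by apply/seteqP; split => x /=; rewrite !in_itv/= ltrBlDr lerBrDr.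
rewrite !lebesgue_measure_itv/= !lte_fin ltrD2r uv.
by rewrite -!EFinB; congr EFin; ring.
Qed.

Lemma lam_scale (c : R) (A : set T1) : 0 < c -> measurable A ->
  (lam ((fun x : T1 => (c * x)%R : T1) @^-1` A) = c^-1%:E * lam A)%E.
Proof.
move=> c0 mA.
have c0' : 0 <= c by exact: ltW.
pose nu : {measure set T1 -> \bar R} := pushforward lam (fun x : T1 => c * x : T1).
pose cnu : {measure set T1 -> \bar R} := mscale (NngNum c0') (nu (measurable_scaler c)).
have H X : ocitv X -> lam X = cnu X.
  move=>  /ocitvP[->|[[u v] /= uv ->]]; first by rewrite !measure0.
  change (lam `]u, v] = (c%:E * lam ((fun x => (c * x)%R) @^-1` `]u, v]))%E).
  rewrite (_ : _ @^-1` _ = `]c^-1 * u, c^-1 * v]%classic); last first.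
    apply/seteqP; split => x /=; rewrite !in_itv/=.
      by rewrite -[in X in _ -> X](mulKf (lt0r_neq0 c0) x) ltr_pM2l ?invr_gt0// ler_pM2l ?invr_gt0.
    by rewrite -[in X in X -> _](mulKf (lt0r_neq0 c0) x) ltr_pM2l ?invr_gt0// ler_pM2l ?invr_gt0.
  rewrite !lebesgue_measure_itv/= !lte_fin ltr_pM2l ?invr_gt0// uv.
  by rewrite -!EFinB -EFinM; congr EFin; field; exact: lt0r_neq0.
rewrite (lebesgue_measure_unique H mA).
change ((lam ((fun x => (c * x)%R) @^-1` A) =
  c^-1%:E * (c%:E * lam ((fun x => (c * x)%R) @^-1` A)))%E).
by rewrite muleA -EFinM mulVf ?mul1e// lt0r_neq0.
Qed.

Lemma mu2_rect (A B : set T1) : measurable A -> measurable B ->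
  mu2 (A `*` B) = (lam A * lam B)%E.
Proof. by move=> mA mB; rewrite product_measure1E. Qed.

Definition translate (v x : R * R) : R * R := x + v.

Lemma measurable_translate (v : R * R) : measurable_fun [set: T2] (translate v : T2 -> T2).
Proof.
apply: measurable_fun_pair => /=.
  by apply: measurable_funD => //; exact: measurable_fst.
by apply: measurable_funD => //; exact: measurable_snd.
Qed.

Lemma mu2_translate (v : R * R) (A : set T2) : measurable A ->
  mu2 (translate v @^-1` A) = mu2 A.
Proof.
apply: mu2_invariant; first exact: measurable_translate.
move=> B C mB mC.
rewrite (_ : _ @^-1` _ = ((fun x => x + v.1) @^-1` B) `*` ((fun x => x + v.2) @^-1` C)).
  have mt a X : measurable X -> measurable ((fun x : T1 => x + a : T1) @^-1` X).
    by move=> mX; rewrite -[X in measurable X]setTI; exact: measurable_addr.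
  rewrite mu2_rect; try exact: mt.
  by rewrite !lam_translate.
by [].
Qed.

(** This exchange preserves area, perimeter and connectedness, so that directional estimates are
    proved for one axis and transferred to the other. *)
Definition diagswap (x : R * R) : R * R := (x.2, x.1).

Lemma measurable_diagswap : measurable_fun [set: T2] (diagswap : T2 -> T2).
Proof.
by apply: measurable_fun_pair => /=; [exact: measurable_snd|exact: measurable_fst].
Qed.

Lemma mu2_swap (A : set T2) : measurable A -> mu2 (diagswap @^-1` A) = mu2 A.
Proof.
apply: mu2_invariant; first exact: measurable_diagswap.
move=> B C mB mC.
rewrite (_ : _ @^-1` _ = C `*` B); first by rewrite mu2_rect// muleC.
by apply/seteqP; split => x /= [].
Qed.

Lemma measurable_scale2 (c : R) : measurable_fun [set: T2] (fun x : T2 => c *: (x : R * R) : T2).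
Proof.
apply: measurable_fun_pair => /=.
  by apply: (measurableT_comp (measurable_scaler c)); exact: measurable_fst.
by apply: (measurableT_comp (measurable_scaler c)); exact: measurable_snd.
Qed.

Lemma mu2_scale (c : R) (A : set T2) : 0 < c -> measurable A ->
  (mu2 ((fun x : R * R => (c *: x)%R) @^-1` A) = (c^-1 ^+ 2)%:E * mu2 A)%E.
Proof.
move=> c0 mA.
have c0' : 0 <= c ^+ 2 by rewrite exprn_ge0// ltW.
pose nu : {measure set T2 -> \bar R} := pushforward mu2 (fun x : T2 => c *: (x : R * R) : T2).
pose cnu : {measure set T2 -> \bar R} := mscale (NngNum c0') (nu (measurable_scale2 c)).
have H (B C : set T1) : measurable B -> measurable C ->
    cnu (B `*` C) = (lam B * lam C)%E.
  move=> mB mC.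
  change (((c ^+ 2)%R%:E * mu2 ((fun x : R * R => (c *: x)%R) @^-1` (B `*` C)))%E =
    (lam B * lam C)%E).
  rewrite (_ : _ @^-1` _ = ((fun x => c * x) @^-1` B) `*` ((fun x => c * x) @^-1` C)); last first.
    by [].
  have mt X : measurable X -> measurable ((fun x : T1 => c * x : T1) @^-1` X).
    by move=> mX; rewrite -[X in measurable X]setTI; exact: measurable_scaler.
  rewrite mu2_rect; try exact: mt.
  rewrite !lam_scale// muleACA -EFinM [LHS]muleA -EFinM.
  rewrite (_ : c ^+ 2 * _ = 1) ?mul1e// -invfM -expr2 mulfV//.
  by rewrite expf_neq0// lt0r_neq0.
rewrite (product_measure_unique H mA).
change ((mu2 ((fun x : R * R => (c *: x)%R) @^-1` A) = (c^-1 ^+ 2)%:E *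
  ((c ^+ 2)%R%:E * mu2 ((fun x : R * R => (c *: x)%R) @^-1` A)))%E).
rewrite muleA -EFinM -exprMn mulVf ?expr1n ?mul1e// lt0r_neq0//.
Qed.

End BorelPlane.

(** * Open sets, Borel sets and bounded sets of the plane *)

Section OpenPlane.
Context {R : realType}.
Notation lam := (@lebesgue_measure R).
Notation T1 := (measurableTypeR R).
Notation T2 := (T1 * T1)%type.
Notation mu2 := (lam \x lam)%E.

(** A countable base of the topology. It makes open sets Borel, and later its enumeration lists the
    bumps that approximate the indicator of an open set. *)
Definition rbox (q : rat * rat * rat * rat) : set (R * R) :=
  `]ratr q.1.1.1, ratr q.1.1.2[%classic `*` `]ratr q.1.2, ratr q.2[%classic.

Lemma open_boxP (E : set (R * R)) x : open E -> E x ->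
  exists2 e : R, 0 < e & forall y, `|y.1 - x.1| < e -> `|y.2 - x.2| < e -> E y.
Proof.
move=> oE Ex; have /nbhs_ballP[e /= e0 eE] : nbhs x E by exact: open_nbhs_nbhs.
exists e => // y y1 y2; apply: eE; split; rewrite /ball /= distrC; [exact: y1|exact: y2].
Qed.

Lemma open_rbox (E : set (R * R)) x : open E -> E x ->
  exists q, rbox q x /\ rbox q `<=` E.
Proof.
move=> oE Ex; have [e e0 eE] := open_boxP oE Ex.
have aux (z : R) : exists a b : rat, [/\ z - e < ratr a, ratr a < z, z < ratr b & ratr b < z + e].
  have /rat_in_itvoo[a] : z - e < z by rewrite ltrBlDr ltrDl.
  have /rat_in_itvoo[b] : z < z + e by rewrite ltrDl.
  by rewrite !in_itv/= => /andP[? ?] /andP[? ?]; exists a, b.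
have [a [b [a1 a2 b1 b2]]] := aux x.1.
have [c [d [c1 c2 d1 d2]]] := aux x.2.
exists (a, b, c, d); rewrite /rbox/=; split.
  by split; rewrite /= in_itv/= ?a2 ?b1 ?c2 ?d1.
move=> y [/=]; rewrite !in_itv/= => /andP[y1 y2] /andP[y3 y4].
by apply: eE; rewrite ltr_norml; apply/andP; split; lra.
Qed.

Lemma measurable_rbox q : measurable (rbox q : set T2).
Proof. by apply: measurableX; exact: measurable_itv. Qed.

Lemma open_measurable2 (E : set (R * R)) : open E -> measurable (E : set T2).
Proof.
move=> oE.
rewrite (_ : E = \bigcup_q (if `[< rbox q `<=` E >] then rbox q else set0)).
  apply: countable_bigcupT_measurable => [|q]; first exact: countableP.
  by case: ifP => // _; exact: measurable_rbox.
apply/seteqP; split => [x Ex|x [q _]].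
  have [q [qx qE]] := open_rbox oE Ex.
  by exists q => //; case: asboolP.
by case: asboolP => // qE /qE.
Qed.

Lemma continuous_measurable2 (f : R * R -> R) : continuous f ->
  measurable_fun [set: T2] f.
Proof.
move=> /continuousP cf; apply: (measurability _ (RGenOpens.measurableE R)).
move=> _ [_ [a [b ->] <-]]; rewrite setTI; apply: open_measurable2.
exact/cf/interval_open.
Qed.

Lemma integral_mu2_invariant (phi : T2 -> T2) (D : set T2) (g : T2 -> \bar R) :
  measurable_fun setT phi ->
  (forall A : set T2, measurable A -> mu2 (phi @^-1` A) = mu2 A) ->
  measurable D -> measurable_fun D g ->
  (\int[mu2]_(x in phi @^-1` D) g (phi x) = \int[mu2]_(x in D) g x)%E.
Proof.
move=> mphi phiE mD mg.
have H (h : T2 -> \bar R) : (forall x, (0 <= h x)%E) -> measurable_fun D h ->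
    (\int[mu2]_(x in phi @^-1` D) h (phi x) = \int[mu2]_(x in D) h x)%E.
  move=> h0 mh.
  transitivity (\int[pushforward mu2 phi]_(x in D) h x)%E; last first.
    by apply: eq_measure_integral => A mA _; exact: phiE.
  by rewrite (ge0_integral_pushforward mphi).
rewrite -[fun x => g (phi x)]/(g \o phi).
rewrite integralE [RHS]integralE funepos_comp funeneg_comp; congr (_ - _)%E.
  rewrite -(H g^\+)%E//; exact: measurable_funepos.
rewrite -(H g^\-)%E//; exact: measurable_funeneg.
Qed.

Lemma compact_closureP (S : set (R * R)) :
  compact (closure S) <-> exists N : R, forall x, S x -> `|x.1| <= N /\ `|x.2| <= N.
Proof.
split => [/compact_bounded[M [_ /(_ (M + 1))]]|[N SN]].
  rewrite ltrDl ltr01 => /(_ isT) MS; exists (M + 1) => x Sx.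
  have : `|x| <= M + 1 by apply: MS; exact: subset_closure.
  by rewrite prod_normE ge_max => /andP.
have cB : compact (`[- N, N]%classic `*` `[- N, N]%classic : set (R * R)).
  by apply: compact_setX; exact: segment_compact.
apply: (subclosed_compact _ cB); first exact: closed_closure.
have clB : closed (`[- N, N]%classic `*` `[- N, N]%classic : set (R * R)).
  by apply: compact_closed => //; exact: norm_hausdorff.
move/closure_id : clB => ->; apply: closure_subset => x /SN[].
by rewrite !ler_norml /= !in_itv.
Qed.

End OpenPlane.

(** * Partial derivatives under the symmetries of the plane *)

Section Partials.
Context {R : realType}.

(** The two difference quotients are the same function of the increment, so derivability and the
    value of the derivative transfer together. *)
Lemma derive_e1E (f : R * R -> R) (x : R * R) :
  (derivable f x e1 <-> derivable (fun s => f (s, x.2)) x.1 1) /\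
  'D_e1 f x = 'D_1 (fun s => f (s, x.2)) x.1.
Proof.
have E : (fun h : R => h^-1 *: (f (h *: e1 + x) - f x)) =
    (fun h : R => h^-1 *: (f (h *: (1 : R) + x.1, x.2) - f (x.1, x.2))).
  apply/funext => h; case: x => x1 x2 /=; congr (_ *: (f _ - _)).
  by rewrite /e1; congr pair; rewrite /= /GRing.scale/= mulr0 add0r.
by rewrite /derivable /derive /= E.
Qed.

Lemma derive_e2E (f : R * R -> R) (x : R * R) :
  (derivable f x e2 <-> derivable (fun s => f (x.1, s)) x.2 1) /\
  'D_e2 f x = 'D_1 (fun s => f (x.1, s)) x.2.
Proof.
have E : (fun h : R => h^-1 *: (f (h *: e2 + x) - f x)) =
    (fun h : R => h^-1 *: (f (x.1, h *: (1 : R) + x.2) - f (x.1, x.2))).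
  apply/funext => h; case: x => x1 x2 /=; congr (_ *: (f _ - _)).
  by rewrite /e2; congr pair; rewrite /= /GRing.scale/= mulr0 add0r.
by rewrite /derivable /derive /= E.
Qed.

Lemma derive_translate (f : R * R -> R) (v w x : R * R) :
  (derivable (f \o translate v) x w <-> derivable f (translate v x) w) /\
  'D_w (f \o translate v) x = 'D_w f (translate v x).
Proof.
have E : (fun h : R => h^-1 *: ((f \o translate v) (h *: w + x) - (f \o translate v) x)) =
    (fun h : R => h^-1 *: (f (h *: w + translate v x) - f (translate v x))).
  by apply/funext => h; rewrite /translate /= addrA.
by rewrite /derivable /derive /= E.
Qed.

Lemma derive_swap1 (f : R * R -> R) (x : R * R) :
  (derivable (f \o diagswap) x e1 <-> derivable f (diagswap x) e2) /\
  'D_e1 (f \o diagswap) x = 'D_e2 f (diagswap x).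
Proof.
have E : (fun h : R => h^-1 *: ((f \o diagswap) (h *: e1 + x) - (f \o diagswap) x)) =
    (fun h : R => h^-1 *: (f (h *: e2 + diagswap x) - f (diagswap x))) by [].
by rewrite /derivable /derive /= E.
Qed.

Lemma derive_swap2 (f : R * R -> R) (x : R * R) :
  (derivable (f \o diagswap) x e2 <-> derivable f (diagswap x) e1) /\
  'D_e2 (f \o diagswap) x = 'D_e1 f (diagswap x).
Proof.
have E : (fun h : R => h^-1 *: ((f \o diagswap) (h *: e2 + x) - (f \o diagswap) x)) =
    (fun h : R => h^-1 *: (f (h *: e1 + diagswap x) - f (diagswap x))) by [].
by rewrite /derivable /derive /= E.
Qed.

Lemma continuous_translate (v : R * R) : continuous (@translate R v).
Proof. by move=> x; apply: cvgD; [exact: cvg_id|exact: cvg_cst]. Qed.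

Lemma continuous_swap : continuous (@diagswap R).
Proof.
move=> x; apply: (cvg_pair (F := nbhs x) (G := nbhs x.2) (H := nbhs x.1)).
  exact: cvg_snd.
exact: cvg_fst.
Qed.

Lemma C1_fun_translate (f : R * R -> R) v : C1_fun f -> C1_fun (f \o translate v).
Proof.
move=> [df c1 c2]; split.
- move=> x; have [d1 d2] := df (translate v x).
  have [[_ t1] _] := derive_translate f v e1 x.
  have [[_ t2] _] := derive_translate f v e2 x.
  by split; [apply t1|apply t2].
- rewrite (_ : 'D_e1 _ = ('D_e1 f) \o translate v); last first.
    by apply/funext => x; rewrite (derive_translate _ _ _ _).2.
  by move=> x; apply: continuous_comp; [exact: continuous_translate|exact: c1].
- rewrite (_ : 'D_e2 _ = ('D_e2 f) \o translate v); last first.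
    by apply/funext => x; rewrite (derive_translate _ _ _ _).2.
  by move=> x; apply: continuous_comp; [exact: continuous_translate|exact: c2].
Qed.

Lemma C1_fun_swap (f : R * R -> R) : C1_fun f -> C1_fun (f \o diagswap).
Proof.
move=> [df c1 c2]; split.
- move=> x; have [] := df (diagswap x) => d1 d2.
  by split; [exact: (derive_swap1 f x).1.2|exact: (derive_swap2 f x).1.2].
- rewrite (_ : 'D_e1 _ = ('D_e2 f) \o diagswap); last first.
    by apply/funext => x; rewrite (derive_swap1 _ _).2.
  by move=> x; apply: continuous_comp; [exact: continuous_swap|exact: c2].
- rewrite (_ : 'D_e2 _ = ('D_e1 f) \o diagswap); last first.
    by apply/funext => x; rewrite (derive_swap2 _ _).2.
  by move=> x; apply: continuous_comp; [exact: continuous_swap|exact: c1].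
Qed.

Lemma C1_funD (f g : R * R -> R) : C1_fun f -> C1_fun g ->
  C1_fun (fun x => f x + g x) /\
  forall x, 'D_e1 (fun x => f x + g x) x = 'D_e1 f x + 'D_e1 g x /\
            'D_e2 (fun x => f x + g x) x = 'D_e2 f x + 'D_e2 g x.
Proof.
move=> [df f1 f2] [dg g1 g2].
have E1 x : 'D_e1 (fun x => f x + g x) x = 'D_e1 f x + 'D_e1 g x.
  by rewrite -[fun x => _]/(f + g) deriveD//; [exact: (df x).1|exact: (dg x).1].
have E2 x : 'D_e2 (fun x => f x + g x) x = 'D_e2 f x + 'D_e2 g x.
  by rewrite -[fun x => _]/(f + g) deriveD//; [exact: (df x).2|exact: (dg x).2].
split; last by move=> x; split.
split.
- move=> x; have [? ?] := df x; have [? ?] := dg x.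
  by split; apply: (@derivableD _ _ _ f g).
- by rewrite (funext E1) => x; apply: cvgD; [exact: f1|exact: g1].
- by rewrite (funext E2) => x; apply: cvgD; [exact: f2|exact: g2].
Qed.

Lemma C1_fun0 : C1_fun (fun _ : R * R => 0 : R).
Proof.
split.
- by move=> x; split; exact: derivable_cst.
- by rewrite (_ : 'D_e1 _ = cst 0); [move=> x; exact: cvg_cst|apply/funext => x; exact: derive_cst].
- by rewrite (_ : 'D_e2 _ = cst 0); [move=> x; exact: cvg_cst|apply/funext => x; exact: derive_cst].
Qed.

End Partials.

(** * Perimeter *)

Section Perimeter.
Context {R : realType}.
Notation lam := (@lebesgue_measure R).
Notation T1 := (measurableTypeR R).
Notation T2 := (T1 * T1)%type.
Notation mu2 := (lam \x lam)%E.
Implicit Types (E : set (R * R)) (phi : R * R -> R * R) (f : R * R -> R).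

Lemma continuous_divergence phi : perimeter_test phi -> continuous (divergence phi).
Proof.
move=> [[[_ c1 _] [_ _ c2]] _ _] x.
by apply: cvgD; [exact: c1|exact: c2].
Qed.

Lemma measurable_divergence (D : set T2) phi : measurable D -> perimeter_test phi ->
  measurable_fun D (fun x : T2 => (divergence phi x)%:E).
Proof.
move=> mD tphi; apply/measurable_EFinP; apply: measurable_funTS.
by apply: continuous_measurable2; exact: continuous_divergence.
Qed.

Lemma perimeter_ge E phi : measurable (E : set T2) -> perimeter_test phi ->
  (\int[mu2]_(x in E) (divergence phi x)%:E <= perimeter E)%E.
Proof.
move=> mE tphi; apply: ereal_sup_ubound; exists phi => //.
by apply: integral_leb2 => //; exact: measurable_divergence.
Qed.

Lemma perimeter_le E (K : \bar R) : measurable (E : set T2) ->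
  (forall phi, perimeter_test phi ->
    (\int[mu2]_(x in E) (divergence phi x)%:E <= K)%E) -> (perimeter E <= K)%E.
Proof.
move=> mE H; apply: ge_ereal_sup => _ [phi tphi <-].
rewrite integral_leb2//; first exact: H.
exact: measurable_divergence.
Qed.

Lemma perimeter_test0 : perimeter_test (fun _ : R * R => (0, 0) : R * R).
Proof.
split; first by split; exact: C1_fun0.
- by apply/compact_closureP; exists 0 => x /=; rewrite eqxx.
- by move=> x; rewrite /enorm /dotp /= !mulr0 addr0 sqrtr0 ler01.
Qed.

Lemma perimeter_ge0 E : measurable (E : set T2) -> (0 <= perimeter E)%E.
Proof.
move=> mE; apply: le_trans (perimeter_ge mE perimeter_test0).
rewrite (eq_integral (cst 0%E)) ?integral_cst//= ?mul0e// => x _.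
by rewrite /divergence !derive_cst addr0.
Qed.

Lemma perimeter_test_translate phi v : perimeter_test phi ->
  perimeter_test (phi \o translate v).
Proof.
move=> [[c1 c2] /compact_closureP[N HN] n1]; split.
- by split; [exact: (C1_fun_translate v c1)|exact: (C1_fun_translate v c2)].
- apply/compact_closureP; exists (N + `|v.1| + `|v.2|) => x /= /HN[h1 h2].
  have -> : x.1 = (translate v x).1 - v.1 by rewrite /= addrK.
  have -> : x.2 = (translate v x).2 - v.2 by rewrite /= addrK.
  have := ler_normB (translate v x).1 v.1; have := ler_normB (translate v x).2 v.2.
  have := normr_ge0 v.1; have := normr_ge0 v.2; split; lra.
- by move=> x; exact: n1.
Qed.

Lemma divergence_translate phi v x :
  divergence (phi \o translate v) x = divergence phi (translate v x).
Proof.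
rewrite /divergence.
by rewrite -(derive_translate (fst \o phi) v e1 x).2 -(derive_translate (snd \o phi) v e2 x).2.
Qed.

Lemma measurable_preimage_translate E v : measurable (E : set T2) ->
  measurable (translate v @^-1` E : set T2).
Proof. by move=> mE; rewrite -[X in measurable X]setTI; exact: measurable_translate. Qed.

Lemma measurable_preimage_swap E : measurable (E : set T2) ->
  measurable (@diagswap R @^-1` E : set T2).
Proof. by move=> mE; rewrite -[X in measurable X]setTI; exact: measurable_diagswap. Qed.

(** Composition with a translation maps test fields to test fields and keeps the flux. This gives
    one inequality for every translation; the converse is the same inequality for the inverse. *)
Lemma perimeter_translate E v : measurable (E : set T2) ->
  perimeter (translate v @^-1` E) = perimeter E.
Proof.
have H F w : measurable (F : set T2) ->
    (perimeter F <= perimeter (translate w @^-1` F))%E.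
  move=> mF; apply: perimeter_le => // phi tphi.
  rewrite -(integral_mu2_invariant (measurable_translate w))//; last 2 first.
  - by move=> A mA; exact: mu2_translate.
  - exact: measurable_divergence.
  under eq_integral do rewrite -divergence_translate.
  apply: perimeter_ge; first exact: measurable_preimage_translate.
  exact: perimeter_test_translate.
move=> mE; apply/eqP; rewrite eq_le H// andbT.
have {2}-> : E = translate (- v) @^-1` (translate v @^-1` E).
  by apply/seteqP; split => x; rewrite /translate /= subrK.
by apply: H; exact: measurable_preimage_translate.
Qed.

Lemma enorm_swap (x : R * R) : enorm (diagswap x) = enorm x.
Proof. by rewrite /enorm /dotp /= addrC. Qed.

Lemma perimeter_test_swap phi : perimeter_test phi ->
  perimeter_test (@diagswap R \o phi \o @diagswap R).
Proof.
move=> [[c1 c2] /compact_closureP[N HN] n1]; split.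
- by split; [exact: (C1_fun_swap c2)|exact: (C1_fun_swap c1)].
- apply/compact_closureP; exists N => x /= h.
  have /HN[] // : phi (diagswap x) != 0.
  by apply: contra_neq h => /= ->.
- by move=> x /=; rewrite enorm_swap.
Qed.

Lemma divergence_swap phi x :
  divergence (@diagswap R \o phi \o @diagswap R) x = divergence phi (diagswap x).
Proof.
rewrite /divergence addrC.
by rewrite -(derive_swap1 (snd \o phi) x).2 -(derive_swap2 (fst \o phi) x).2.
Qed.

Lemma perimeter_swap E : measurable (E : set T2) ->
  perimeter (@diagswap R @^-1` E) = perimeter E.
Proof.
have H F : measurable (F : set T2) ->
    (perimeter F <= perimeter (@diagswap R @^-1` F))%E.
  move=> mF; apply: perimeter_le => // phi tphi.
  rewrite -(integral_mu2_invariant measurable_diagswap)//; last 2 first.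
  - by move=> A mA; exact: mu2_swap.
  - exact: measurable_divergence.
  under eq_integral do rewrite -divergence_swap.
  apply: perimeter_ge; first exact: measurable_preimage_swap.
  exact: perimeter_test_swap.
move=> mE; apply/eqP; rewrite eq_le H// andbT.
have {2}-> : E = @diagswap R @^-1` (@diagswap R @^-1` E).
  by apply/seteqP; split => -[x y].
by apply: H; exact: measurable_preimage_swap.
Qed.

Lemma perimeter_ge1 E f : measurable (E : set T2) -> C1_fun f ->
  (exists N, forall x, f x != 0 -> `|x.1| <= N /\ `|x.2| <= N) ->
  (forall x, `|f x| <= 1) ->
  (\int[mu2]_(x in E) ('D_e1 f x)%:E <= perimeter E)%E.
Proof.
move=> mE cf [N HN] f1.
have t : perimeter_test (fun x => (f x, 0) : R * R).
  split.
  - by split; [exact: cf|exact: C1_fun0].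
  - apply/compact_closureP; exists N => x /= h; apply: HN.
    by apply: contra_neq h => ->.
  - move=> x; rewrite /enorm /dotp /= mulr0 addr0 -expr2 sqrtr_sqr.
    exact: f1.
apply: le_trans (perimeter_ge mE t).
rewrite (eq_integral (fun x : T2 => (divergence (fun x => (f x, 0)) x)%:E))// => x _.
congr EFin; rewrite /divergence.
by rewrite (_ : snd \o _ = cst 0)// derive_cst addr0.
Qed.

Lemma perimeter_ge2 E f : measurable (E : set T2) -> C1_fun f ->
  (exists N, forall x, f x != 0 -> `|x.1| <= N /\ `|x.2| <= N) ->
  (forall x, `|f x| <= 1) ->
  (\int[mu2]_(x in E) ('D_e2 f x)%:E <= perimeter E)%E.
Proof.
move=> mE cf [N HN] f1; rewrite -perimeter_swap//.
have cf' := C1_fun_swap cf.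
have bf' : exists N, forall x, (f \o @diagswap R) x != 0 -> `|x.1| <= N /\ `|x.2| <= N.
  by exists N => x /= /HN[].
apply: le_trans (perimeter_ge1 (measurable_preimage_swap mE) cf' bf' _); last first.
  by move=> x; exact: f1.
rewrite -(integral_mu2_invariant measurable_diagswap)//; last 2 first.
- by move=> A mA; exact: mu2_swap.
- apply/measurable_EFinP; apply: measurable_funTS.
  by apply: continuous_measurable2; case: cf.
Qed.

Lemma bounded_integrable (D : set T2) f (M : R) : measurable D -> (mu2 D < +oo)%E ->
  measurable_fun D f -> (forall x, D x -> `|f x| <= M) -> mu2.-integrable D (EFin \o f).
Proof.
move=> mD finD mf fM; apply: (@le_integrable _ _ _ mu2 D mD _ (cst M%:E)).
- exact/measurable_EFinP.
- by move=> x Dx /=; rewrite lee_fin (le_trans (fM x Dx))// ler_norm.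
- by apply/integrableP; split => //; rewrite integral_cst// lte_mul_pinfty// ?lee_fin.
Qed.

End Perimeter.

Section C1line.
Context {R : realType}.

Definition C1_line (a : R -> R) : Prop := (forall x, derivable a x 1) /\ continuous ('D_1 a).

Lemma C1_line_continuous a : C1_line a -> continuous a.
Proof. by move=> [da _] x; apply/differentiable_continuous/derivable1_diffP. Qed.

Lemma C1_lineM a b : C1_line a -> C1_line b -> C1_line (a * b) /\
  forall x, 'D_1 (a * b) x = 'D_1 a x * b x + a x * 'D_1 b x.
Proof.
move=> Ca Cb; have [da ca] := Ca; have [db cb] := Cb.
have E x : 'D_1 (a * b) x = 'D_1 a x * b x + a x * 'D_1 b x.
  rewrite (deriveM (da x) (db x)) /GRing.scale/= addrC; congr (_ + _).
  by rewrite mulrC.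
split; last exact: E.
split; first by move=> x; exact: (derivableM (da x) (db x)).
rewrite (funext E) => x; apply: cvgD; apply: cvgM.
- exact: ca.
- exact: C1_line_continuous.
- exact: C1_line_continuous.
- exact: cb.
Qed.

Lemma C1_fun_tensor a b : C1_line a -> C1_line b ->
  C1_fun (fun x : R * R => a x.1 * b x.2) /\ forall x : R * R,
   'D_e1 (fun x : R * R => a x.1 * b x.2) x = 'D_1 a x.1 * b x.2 /\
   'D_e2 (fun x : R * R => a x.1 * b x.2) x = a x.1 * 'D_1 b x.2.
Proof.
move=> Ca Cb; have [da ca] := Ca; have [db cb] := Cb.
have E1 (x : R * R) : 'D_e1 (fun x : R * R => a x.1 * b x.2) x = 'D_1 a x.1 * b x.2.
  rewrite (derive_e1E _ x).2 /=.
  rewrite (_ : (fun s => _) = b x.2 \*: a); last by apply/funext => s; rewrite mulrC.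
  by rewrite deriveZ// mulrC.
have E2 (x : R * R) : 'D_e2 (fun x : R * R => a x.1 * b x.2) x = a x.1 * 'D_1 b x.2.
  rewrite (derive_e2E _ x).2 /=.
  by rewrite -[fun s => _]/(a x.1 \*: b) deriveZ.
have c1 (g : R -> R) : continuous g -> continuous (fun x : R * R => g x.1).
  by move=> cg x; apply: (@cvg_comp _ _ _ fst g _ (nbhs x.1)); [exact: cvg_fst|exact: cg].
have c2 (g : R -> R) : continuous g -> continuous (fun x : R * R => g x.2).
  by move=> cg x; apply: (@cvg_comp _ _ _ snd g _ (nbhs x.2)); [exact: cvg_snd|exact: cg].
split; last by move=> x; split.
split.
- move=> x; split.
    apply: (derive_e1E _ x).1.2 => /=.
    rewrite (_ : (fun s => _) = b x.2 \*: a); last by apply/funext => s; rewrite mulrC.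
    exact: derivableZ.
  apply: (derive_e2E _ x).1.2 => /=.
  by rewrite -[fun s => _]/(a x.1 \*: b); exact: derivableZ.
- rewrite (funext E1) => x; apply: cvgM; first exact: (c1 _ ca).
  exact: (c2 _ (C1_line_continuous Cb)).
- rewrite (funext E2) => x; apply: cvgM; last exact: (c2 _ cb).
  exact: (c1 _ (C1_line_continuous Ca)).
Qed.

Lemma C1_line_affine (a b : R) (f : R -> R) : C1_line f ->
  C1_line (fun x => f (a * x + b)) /\
  forall x, 'D_1 (fun x => f (a * x + b)) x = a * 'D_1 f (a * x + b).
Proof.
move=> [df cf].
have H (x : R) : is_derive x 1 (fun x => f (a * x + b)) (a * 'D_1 f (a * x + b)).
  have h1 : is_derive (a * x + b) 1 f ('D_1 f (a * x + b)) by apply: DeriveDef.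
  have h2 : is_derive x 1 (fun x => a * x + b) a.
    by apply: is_derive_eq; rewrite /GRing.scale/= ?mulr1 ?mulr0 ?mul0r ?addr0 ?add0r.
  have := @is_derive1_comp _ f (fun x => a * x + b) x _ _ h1 h2.
  by rewrite mulrC.
have E x : 'D_1 (fun x => f (a * x + b)) x = a * 'D_1 f (a * x + b) by have [] := H x.
split; last exact: E.
split; first by move=> x; have [] := H x.
rewrite (funext E) => x; apply: cvgM; first exact: cvg_cst.
apply: (@continuous_comp _ _ _ (fun x => a * x + b) ('D_1 f)); last exact: cf.
by apply: cvgD; [apply: cvgM; [exact: cvg_cst|exact: cvg_id]|exact: cvg_cst].
Qed.

End C1line.

(** * Width of connected sets *)

Section Step.
Context {R : realType}.

(** A quadratic error term settles derivability at the junctions of piecewise definitions, where no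
    differentiation rule applies. *)
Lemma is_derive_quadratic (f : R -> R) (x d C : R) :
  (forall h, `|f (h + x) - f x - d * h| <= C * h ^+ 2) -> is_derive x 1 f d.
Proof.
move=> H.
have C0 : 0 <= C by have := H 1; rewrite expr1n !mulr1 => h; exact: le_trans (normr_ge0 _) h.
have cv : h^-1 *: (f (h *: 1 + x) - f x) @[h --> 0^'] --> d.
  apply/cvgrPdist_le => e e0; near=> h.
  have h0 : h != 0 by near: h; exact: nbhs_dnbhs_neq.
  rewrite /GRing.scale /= mulr1.
  rewrite (_ : d - _ = - (h^-1 * (f (h + x) - f x - d * h))); last by field.
  rewrite normrN normrM normfV.
  apply: (@le_trans _ _ (C * `|h|)).
    rewrite ler_pdivrMl ?normr_gt0//; apply: le_trans (H h) _.
    by rewrite -real_normK ?num_real// expr2 mulrCA.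
  have : `|h| <= e / (C + 1).
    near: h; apply: dnbhs0_le; rewrite divr_gt0//; lra.
  rewrite ler_pdivlMr; last lra.
  move=> h1; apply: le_trans h1; rewrite mulrC ler_wpM2l//; lra.
apply: DeriveDef; first by apply/cvg_ex; exists d.
exact/cvg_lim.
Unshelve. all: by end_near. Qed.

(** The positive part, written through the absolute value so that its continuity is immediate;
    [rampP] recovers the two cases. *)
Definition ramp (z : R) : R := (`|z| + z) / 2.

Lemma rampP z : z <= 0 /\ ramp z = 0 \/ 0 <= z /\ ramp z = z.
Proof.
rewrite /ramp; have [z0|z0] := leP z 0; [left|right]; split => //.
- by rewrite ler0_norm// addNr mul0r.
- exact: ltW.
- by rewrite gtr0_norm//; field.
Qed.

Lemma continuous_ramp : continuous ramp.
Proof.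
move=> x; apply: cvgM; last exact: cvg_cst.
by apply: cvgD; [exact: (cvg_norm cvg_id)|exact: cvg_id].
Qed.

Lemma ramp_quadratic h z : `|ramp (h + z) ^+ 2 - ramp z ^+ 2 - 2 * ramp z * h| <= h ^+ 2.
Proof.
rewrite ler_norml.
have [[a ->]|[a ->]] := rampP (h + z); have [[b ->]|[b ->]] := rampP z;
  apply/andP; split; nra.
Qed.

(** A quadratic spline with knots 0, 1/2 and 1 that climbs from 0 to 1 over the unit interval. Its
    derivative [dstep] is the tent of height 2 over that interval, at least 1 on the middle half. *)
Definition step (z : R) : R :=
  2 * ramp z ^+ 2 - 4 * ramp (z - 2^-1) ^+ 2 + 2 * ramp (z - 1) ^+ 2.

Definition dstep (z : R) : R := 4 * ramp z - 8 * ramp (z - 2^-1) + 4 * ramp (z - 1).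

Lemma is_derive_step (z : R) : is_derive z 1 step (dstep z).
Proof.
(* The constant is 2 + 4 + 2, the sum of the absolute coefficients of the three squared ramps. *)
apply: (@is_derive_quadratic _ _ _ 8) => h; rewrite /step /dstep -!addrA.
have := ramp_quadratic h z; have := ramp_quadratic h (z - 2^-1).
have := ramp_quadratic h (z - 1); rewrite !ler_norml.
move=> /andP[a1 a2] /andP[b1 b2] /andP[c1 c2].
have := sqr_ge0 h => h0; apply/andP; split; lra.
Qed.

Lemma C1_step : C1_line step.
Proof.
split; first by move=> z; have [] := is_derive_step z.
rewrite (_ : 'D_1 step = dstep); last by apply/funext => z; have [_ <-] := is_derive_step z.
have cr (c a : R) : continuous (fun z => c * ramp (z - a)).
  move=> z; apply: cvgM; first exact: cvg_cst.
  apply: (@continuous_comp _ _ _ (fun z => z - a) ramp); last exact: continuous_ramp.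
  by apply: cvgB; [exact: cvg_id|exact: cvg_cst].
move=> z; rewrite /dstep; apply: cvgD; last exact: (cr 4 1).
apply: cvgB; last exact: (cr 8 2^-1).
by apply: cvgM; [exact: cvg_cst|exact: continuous_ramp].
Qed.

Lemma derive_step (z : R) : 'D_1 step z = dstep z.
Proof. by have [_ <-] := is_derive_step z. Qed.

Lemma step_itv z : 0 <= step z <= 1.
Proof.
rewrite /step; have [[a ->]|[a ->]] := rampP z;
  have [[b ->]|[b ->]] := rampP (z - 2^-1);
  have [[c ->]|[c ->]] := rampP (z - 1); apply/andP; split; nra.
Qed.

Lemma dstep_itv z : 0 <= dstep z <= 2.
Proof.
rewrite /dstep; have [[a ->]|[a ->]] := rampP z;
  have [[b ->]|[b ->]] := rampP (z - 2^-1);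
  have [[c ->]|[c ->]] := rampP (z - 1); apply/andP; split; lra.
Qed.

Lemma dstep_ge1 z : 1 / 4 <= z -> z <= 3 / 4 -> 1 <= dstep z.
Proof.
rewrite /dstep; have [[a ->]|[a ->]] := rampP z;
  have [[b ->]|[b ->]] := rampP (z - 2^-1);
  have [[c ->]|[c ->]] := rampP (z - 1); lra.
Qed.

Lemma step1 z : 1 <= z -> step z = 1.
Proof.
rewrite /step; have [[a ->]|[a ->]] := rampP z;
  have [[b ->]|[b ->]] := rampP (z - 2^-1);
  have [[c ->]|[c ->]] := rampP (z - 1) => h; nra.
Qed.

Lemma step0 z : z <= 0 -> step z = 0.
Proof.
rewrite /step; have [[a ->]|[a ->]] := rampP z;
  have [[b ->]|[b ->]] := rampP (z - 2^-1);
  have [[c ->]|[c ->]] := rampP (z - 1) => h; nra.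
Qed.

Lemma step_gt0 z : 0 < z -> 0 < step z.
Proof.
rewrite /step; have [[a ->]|[a ->]] := rampP z;
  have [[b ->]|[b ->]] := rampP (z - 2^-1);
  have [[c ->]|[c ->]] := rampP (z - 1) => h; nra.
Qed.

End Step.

Section RealInduction.
Context {R : realType}.

(** Real induction: the local property at the supremum of the points reachable from [a] shows that
    it is reached and, unless it is [b], that a larger point is reachable too. *)
Lemma real_chain (P : R -> R -> Prop) (a b : R) : a <= b ->
  (forall s, P s s) ->
  (forall s t u, s <= t -> t <= u -> P s t -> P t u -> P s u) ->
  (forall t, a <= t <= b -> exists2 d, 0 < d &
     forall s u, t - d < s -> s <= u -> u < t + d -> P s u) ->
  P a b.
Proof.
move=> ab Prefl Ptr Ploc.
pose S := [set t | a <= t <= b /\ P a t].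
have Sa : S a by split; [rewrite lexx|].
have ubS : ubound S b by move=> t [/andP[]].
have hS : has_sup S by split; [exists a|exists b].
have aS : a <= sup S by exact: (ub_le_sup hS.2).
have Sb : sup S <= b by apply: ge_sup => //; exists a.
have [|d d0 Hd] := Ploc (sup S); first by rewrite aS.
have [t [/andP[at_ tb] Pt] tS] := sup_adherent d0 hS.
have tS' : t <= sup S by apply: (ub_le_sup hS.2); split => //; apply/andP.
pose u := Num.min b (sup S + d / 2).
have Su : sup S <= u by rewrite /u le_min Sb/= lerDl divr_ge0// ltW.
have Ptu : P t u.
  apply: Hd => //; first exact: le_trans tS' Su.
  by rewrite /u gt_min; apply/orP; right; rewrite ltrD2l; lra.
have Pau : P a u by apply: (Ptr _ t) => //; exact: le_trans tS' Su.
have : u <= sup S.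
  apply: (ub_le_sup hS.2); split => //; rewrite (le_trans aS Su)/=.
  by rewrite /u ge_min lexx.
rewrite {1}/u ge_min => /orP[bS|]; last by move=> ?; lra.
suff <- : u = b by [].
by apply/eqP; rewrite eq_le (le_trans bS Su) andbT /u ge_min lexx.
Qed.

End RealInduction.

Section Width.
Context {R : realType}.
Notation lam := (@lebesgue_measure R).
Notation T1 := (measurableTypeR R).
Notation T2 := (T1 * T1)%type.
Notation mu2 := (lam \x lam)%E.
Variable E : set (R * R).
Hypotheses (oE : open E) (fE : (mu2 E < +oo)%E).
Let mE : measurable (E : set T2) := open_measurable2 oE.

(** The strict inequalities on the support keep fields over adjacent columns from overlapping, so
    that their sum still has values between 0 and 1. The bound [M] makes the fluxes integrable,
    hence additive, and [e] pays for the descent of the field beyond the place where it climbs. *)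
Definition column_test (s t : R) := forall e, 0 < e ->
  exists f : R * R -> R, [/\ C1_fun f,
    exists N : R, forall x, f x != 0 -> `|x.1| <= N /\ `|x.2| <= N,
    exists M : R, forall x, `|'D_e2 f x| <= M,
    forall x, 0 <= f x <= 1 /\ (f x != 0 -> s < x.1 < t) &
    (((t - s) / 6 - e)%:E <= \int[mu2]_(x in E) ('D_e2 f x)%:E)%E].

Lemma integrable_D2 f M : C1_fun f -> (forall x, `|'D_e2 f x| <= M) ->
  mu2.-integrable E (EFin \o 'D_e2 f).
Proof.
move=> [_ _ c2] fM; apply: (bounded_integrable (M := M)) => //.
by apply: measurable_funTS; exact: continuous_measurable2.
Qed.

Lemma column_test_refl s : column_test s s.
Proof.
move=> e e0; exists (fun=> 0); split.
- exact: C1_fun0.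
- by exists 0 => x; rewrite eqxx.
- by exists 0 => x; rewrite derive_cst normr0.
- by move=> x; rewrite lexx ler01 eqxx.
- rewrite (eq_integral (cst 0%E)) ?integral_cst//= ?mul0e//; last first.
    by move=> x _; rewrite derive_cst.
  by rewrite lee_fin; lra.
Qed.

Lemma column_test_trans s t u : s <= t -> t <= u ->
  column_test s t -> column_test t u -> column_test s u.
Proof.
move=> st tu Hs Ht e e0.
have e20 : 0 < e / 2 by rewrite divr_gt0.
have [f [Cf [N fN] [M fM] f1 fE']] := Hs _ e20.
have [g [Cg [N' gN] [M' gM] g1 gE]] := Ht _ e20.
have [Cfg Dfg] := C1_funD Cf Cg.
have fg x : f x != 0 -> g x = 0.
  move=> /(f1 x).2 /andP[_ xt]; apply/eqP; apply/negPn/negP => /(g1 x).2 /andP[tx _].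
  lra.
exists (fun x => f x + g x); split; first exact: Cfg.
- exists (Num.max N N') => x; rewrite !le_max.
  have [->|/fN[-> ->]] := eqVneq (f x) 0; last by [].
  by rewrite add0r => /gN[-> ->]; rewrite !orbT.
- exists (M + M') => x; rewrite (Dfg x).2.
  by rewrite (le_trans (ler_normD _ _))// lerD.
- move=> x; have [fx0|fx0] := eqVneq (f x) 0.
    rewrite fx0 add0r; split; first exact: (g1 x).1.
    by move=> /(g1 x).2 /andP[h1 ->]; rewrite (le_lt_trans st).
  rewrite (fg _ fx0) addr0; split; first exact: (f1 x).1.
  by move=> _; have /andP[-> h] := (f1 x).2 fx0; rewrite (lt_le_trans h).
- rewrite (eq_integral (fun x : T2 => ('D_e2 f x)%:E + ('D_e2 g x)%:E)%E); last first.
    by move=> x _; rewrite (Dfg x).2 EFinD.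
  rewrite integralD//; [|exact: integrable_D2 fM|exact: integrable_D2 gM].
  apply: le_trans (leeD fE' gE); rewrite -EFinD lee_fin; lra.
Qed.

(* Over a narrow column through a point of E, the test function climbs from 0 to 1
   inside a small square of E and then descends so slowly that this costs at most e. *)
Lemma column_test_local t y : E (t, y) -> exists2 d, 0 < d &
  forall s u, t - d < s -> s <= u -> u < t + d -> column_test s u.
Proof.
move=> Ety; have [e e0 eE] := open_boxP oE Ety; exists e => // s u ts su ut.
move: su; rewrite le_eqVlt => /predU1P[<-|su]; first exact: column_test_refl.
move=> eps eps0.
pose m := fine (mu2 E).
have mE' : mu2 E = m%:E by rewrite fineK// ge0_fin_numE.
have m0 : 0 <= m by exact: fine_ge0.
pose d := e / 2; have d0 : 0 < d by rewrite divr_gt0.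
(* The descent takes place between heights [y + d] and [N], with slope at most [2 / L]; over [E], of
   area [m], it costs at most [2 * m / L], and this choice makes that at most [eps]. *)
pose L := 2 * m / eps + 1.
have L0 : 0 < L by rewrite ltr_wpDl// divr_ge0// ?mulr_ge0// ltW.
pose N := y + d + L.
pose k := 3 / (u - s).
have us0 : 0 < u - s by lra.
have k0 : 0 < k by rewrite divr_gt0.
pose r1 x := step (k * x + - k * s); pose r2 x := step (- k * x + k * u).
pose p1 x := step (d^-1 * x + - d^-1 * y); pose p2 x := step (- L^-1 * x + L^-1 * N).
have [Cr1 _] := C1_line_affine k (- k * s) (@C1_step R).
have [Cr2 _] := C1_line_affine (- k) (k * u) (@C1_step R).
have [Cp1 Dp1] := C1_line_affine d^-1 (- d^-1 * y) (@C1_step R).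
have [Cp2 Dp2] := C1_line_affine (- L^-1) (L^-1 * N) (@C1_step R).
have [Cr _] := C1_lineM Cr1 Cr2.
have [Cp Dp] := C1_lineM Cp1 Cp2.
have [Cf Df] := C1_fun_tensor Cr Cp.
pose r x := r1 x * r2 x.
pose dp x := d^-1 * dstep (d^-1 * x + - d^-1 * y) * p2 x -
   L^-1 * (p1 x * dstep (- L^-1 * x + L^-1 * N)).
have D2 x : 'D_e2 (fun x : R * R => r x.1 * (p1 x.2 * p2 x.2)) x = r x.1 * dp x.2.
  rewrite (Df x).2 Dp Dp1 Dp2 !derive_step; congr (_ * _).
  by rewrite /dp /p1 /p2; ring.
have kinv : k^-1 = (u - s) / 3 by rewrite invf_div.
have aux1 x : k * x + - k * s = (x - s) / ((u - s) / 3) by rewrite -kinv invrK; ring.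
have aux2 x : - k * x + k * u = (u - x) / ((u - s) / 3) by rewrite -kinv invrK; ring.
have aux3 x : d^-1 * x + - d^-1 * y = (x - y) / d by ring.
have aux4 x : - L^-1 * x + L^-1 * N = (N - x) / L by ring.
have r01 x : 0 <= r x <= 1.
  have /andP[a1 a2] := step_itv (k * x + - k * s).
  have /andP[b1 b2] := step_itv (- k * x + k * u).
  by rewrite /r mulr_ge0//= mulr_ile1.
have p01 x : 0 <= p1 x * p2 x <= 1.
  have /andP[a1 a2] := step_itv (d^-1 * x + - d^-1 * y).
  have /andP[b1 b2] := step_itv (- L^-1 * x + L^-1 * N).
  by rewrite mulr_ge0//= mulr_ile1.
have Li0 : 0 < L^-1 by rewrite invr_gt0.
have di0 : 0 < d^-1 by rewrite invr_gt0.
have dpM x : - (2 * L^-1) <= dp x <= 2 * d^-1.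
  have /andP[a1 a2] := step_itv (d^-1 * x + - d^-1 * y).
  have /andP[b1 b2] := step_itv (- L^-1 * x + L^-1 * N).
  have /andP[a3 a4] := dstep_itv (d^-1 * x + - d^-1 * y).
  have /andP[b3 b4] := dstep_itv (- L^-1 * x + L^-1 * N).
  have h1 : 0 <= d^-1 * dstep (d^-1 * x + - d^-1 * y) * p2 x <= 2 * d^-1.
    rewrite !mulr_ge0//; [|exact: ltW]; rewrite -mulrA [leRHS]mulrC ler_pM2l//=.
    by rewrite -[leRHS]mulr1 ler_pM.
  have h2 : 0 <= L^-1 * (p1 x * dstep (- L^-1 * x + L^-1 * N)) <= 2 * L^-1.
    rewrite !mulr_ge0//; [|exact: ltW]; rewrite [leRHS]mulrC ler_pM2l//=.
    by rewrite -[leRHS]mul1r ler_pM.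
  by move: h1 h2; rewrite /dp; clear => /andP[h1 h2] /andP[h3 h4]; apply/andP; split; lra.
(* Middle third of the column times middle half of the climb: here the horizontal profile equals 1
   and the vertical slope is at least [1 / d]. The area divided by [d] is [(u - s) / 6], the origin
   of the factor 1/6. *)
pose rect : set T2 := `[s + (u - s) / 3, s + 2 * ((u - s) / 3)]%classic `*`
                      `[y + d / 4, y + 3 * (d / 4)]%classic.
have mrect : measurable rect by apply: measurableX; exact: measurable_itv.
have rectE : rect `<=` E.
  move=> x [/=]; rewrite !in_itv/= => /andP[h1 h2] /andP[h3 h4].
  by apply: eE => /=; rewrite ltr_norml; apply/andP; split; rewrite /d in h3 h4;
    clear -h1 h2 h3 h4 ts su ut e0; lra.
have lamrect : mu2 rect = ((u - s) / 6 * d)%:E.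
  rewrite mu2_rect; try exact: measurable_itv.
  rewrite !lebesgue_measure_itv/= !lte_fin.
  rewrite !ifT; [|lra|lra].
  by rewrite -!EFinB -EFinM; congr EFin; field.
(* Minorant of the divergence: the climb is counted on [rect] only, where it is certainly inside
   [E], and the worst case of the descent is charged everywhere. *)
pose low (x : T2) : R := d^-1 * \1_rect x - 2 * L^-1.
have lowE x : low x <= r x.1 * dp x.2.
  rewrite /low indicE; have [xr|xr] := boolP (x \in rect); last first.
    rewrite mulr0 add0r.
    have /andP[a1 a2] := r01 x.1; have /andP[b1 b2] := dpM x.2.
    have [h|h] := leP 0 (dp x.2).
      by apply: (@le_trans _ _ 0); [lra|exact: mulr_ge0].
    by apply: (le_trans b1); rewrite -[leLHS]mul1r ler_wnM2r// ltW.
  rewrite mulr1; move/set_mem : xr => [/=]; rewrite !in_itv/= => /andP[h1 h2] /andP[h3 h4].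
  have -> : r x.1 = 1.
    rewrite /r /r1 /r2 aux1 aux2 !step1 ?mulr1//; rewrite ler_pdivlMr ?divr_gt0//; lra.
  have p2E : p2 x.2 = 1.
    by rewrite /p2 aux4 step1//; rewrite ler_pdivlMr// /N; lra.
  have q1 : 1 <= dstep (d^-1 * x.2 + - d^-1 * y).
    apply: dstep_ge1; rewrite aux3.
      by rewrite ler_pdivlMr//; lra.
    by rewrite ler_pdivrMr//; lra.
  have /andP[a1 a2] := step_itv (d^-1 * x.2 + - d^-1 * y).
  have /andP[b3 b4] := dstep_itv (- L^-1 * x.2 + L^-1 * N).
  rewrite mul1r /dp p2E mulr1; apply: lerB.
    by rewrite -[leLHS]mulr1 ler_pM2l.
  rewrite [leRHS]mulrC ler_pM2l//.
  by rewrite -[leRHS]mul1r ler_pM.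
have D2M x : `|'D_e2 (fun x : R * R => r x.1 * (p1 x.2 * p2 x.2)) x| <= 2 * d^-1 + 2 * L^-1.
  rewrite D2 normrM.
  have /andP[a1 a2] := r01 x.1; have /andP[b1 b2] := dpM x.2.
  rewrite -[leRHS]mul1r; apply: ler_pM => //; first by rewrite ger0_norm.
  by rewrite ler_norml; apply/andP; split; lra.
exists (fun x : R * R => r x.1 * (p1 x.2 * p2 x.2)); split.
- exact: Cf.
- exists (`|s| + `|u| + `|y| + `|N|) => x; rewrite !mulf_eq0 !negb_or.
  move=> /andP[/andP[h1 h2] /andP[h3 h4]].
  have g (z : R) : step z != 0 -> 0 < z.
    by move=> h; rewrite ltNge; apply/negP => /step0 /eqP; rewrite (negbTE h).
  move: (g _ h1) (g _ h2) (g _ h3) (g _ h4); rewrite aux1 aux2 aux3 aux4.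
  rewrite !pmulr_lgt0 ?invr_gt0 ?divr_gt0// => {}h1 {}h2 {}h3 {}h4.
  have := ler_norm s; have := ler_norm u; have := ler_norm y; have := ler_norm N.
  have := ler_normr (- s) s; have := ler_norm (- s); have := ler_norm (- y).
  rewrite !normrN => n1 n2 _ n3 n4 n5 n6; clear -h1 h2 h3 h4 n1 n2 n3 n4 n5 n6.
  have := normr_ge0 s; have := normr_ge0 u; have := normr_ge0 y; have := normr_ge0 N.
  by move=> *; rewrite !ler_norml; split; apply/andP; split; lra.
- by exists (2 * d^-1 + 2 * L^-1).
- move=> x; split.
    have /andP[a1 a2] := r01 x.1; have /andP[b1 b2] := p01 x.2.
    by rewrite mulr_ge0//= mulr_ile1.
  rewrite mulf_eq0 negb_or /r mulf_eq0 negb_or => /andP[/andP[h1 h2] _].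
  have g (z : R) : step z != 0 -> 0 < z.
    by move=> h; rewrite ltNge; apply/negP => /step0 /eqP; rewrite (negbTE h).
  move: (g _ h1) (g _ h2); rewrite aux1 aux2 !pmulr_lgt0 ?invr_gt0 ?divr_gt0//; lra.
- have ilow : mu2.-integrable E (EFin \o low).
    apply: (bounded_integrable (M := d^-1 + 2 * L^-1)) => //.
      apply: measurable_funB => //; apply: measurable_funM => //.
    move=> x _; rewrite /low indicE; case: (x \in rect) => /=; rewrite ?mulr1 ?mulr0 ler_norml;
      clear -di0 Li0; apply/andP; split; lra.
  apply: (@le_trans _ _ (\int[mu2]_(x in E) (low x)%:E)%E); last first.
    apply: le_integral => //; first exact: integrable_D2 D2M.
    by move=> x _; rewrite lee_fin D2.
  have i1 : mu2.-integrable E (EFin \o (fun x : T2 => d^-1 * \1_rect x)).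
    apply: (bounded_integrable (M := d^-1)) => //; first exact: measurable_funM.
    by move=> x _; rewrite indicE; case: (x \in rect) => /=; rewrite ?mulr1 ?mulr0 ?normr0 ?gtr0_norm// ltW.
  have i2 : mu2.-integrable E (EFin \o (fun x : T2 => 2 * L^-1)).
    by apply: (bounded_integrable (M := `|2 * L^-1|)).
  rewrite /low.
  under eq_integral do rewrite EFinB.
  rewrite integralB//.
  rewrite [X in (_ - X)%E]integral_cst// [X in (_ - _ * X)%E]mE'.
  under eq_integral do rewrite EFinM.
  rewrite [X in (X - _)%E]integralZl//; last first.
    apply: (bounded_integrable (M := 1)) => //.
    by move=> x _; rewrite indicE; case: (x \in rect) => /=; rewrite ?normr0 ?normr1.
  rewrite [X in (_ * X - _)%E]integral_indic// setIidl//.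
  rewrite [X in (_ * X - _)%E]lamrect -!EFinM -EFinB lee_fin.
  rewrite (_ : d^-1 * _ = (u - s) / 6); last by field; exact: lt0r_neq0.
  rewrite lerB// (_ : 2 * L^-1 * m = (2 * m) / L); last by rewrite mulrAC.
  rewrite ler_pdivrMr// (_ : eps * L = 2 * m + eps); first by rewrite lerDl ltW.
  by rewrite /L; field; exact: lt0r_neq0.
Qed.

(** The first projection of a connected set is an interval, so every vertical line between the two
    points meets [E] and has a local field around it. Real induction glues these fields over the
    whole range. *)
Lemma connected_width (x y : R * R) : connected E -> E x -> E y ->
  ((`|x.1 - y.1| / 6)%:E <= perimeter E)%E.
Proof.
move=> cE; wlog : x y / x.1 <= y.1 => [H|xy] Ex Ey.
  have [xy|/ltW yx] := leP x.1 y.1; first exact: H.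
  by rewrite distrC; exact: H.
have itvE : is_interval (fst @` E).
  apply/connected_intervalP; apply: connected_continuous_connected => //.
  by apply: continuous_subspaceT => z; exact: cvg_fst.
have H : column_test x.1 y.1.
  apply: real_chain => //; first exact: column_test_refl.
    by move=> s t u; exact: column_test_trans.
  move=> t /andP[xt ty].
  have Ax : (fst @` E) x.1 by exists x.
  have Ay : (fst @` E) y.1 by exists y.
  have [|[t' u] Etu /= <-] := itvE _ _ Ax Ay t; first by rewrite xt.
  exact: column_test_local Etu.
apply/lee_addgt0Pr => e e0.
have [f [Cf bf _ f1 fE']] := H _ e0.
have := perimeter_ge2 mE Cf bf _.
have f1' z : `|f z| <= 1 by have /andP[a b] := (f1 z).1; rewrite ger0_norm.
move=> /(_ f1') /(le_trans fE') h.
rewrite distrC ger0_norm ?subr_ge0//.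
by rewrite -leeBlDr// -EFinB.
Qed.

End Width.

(** * Compactness *)

Section Tensor.
Context {R : realType}.
Notation lam := (@lebesgue_measure R).
Notation T1 := (measurableTypeR R).
Notation T2 := (T1 * T1)%type.
Notation mu2 := (lam \x lam)%E.
Variable N : R.

(* Sums of products of one-variable functions: such a function has an explicit
   primitive in the first variable, which is again of class C^1. *)
Inductive tensor_fun : (R * R -> R) -> Prop :=
| tensor_prod (a b : R -> R) : continuous a -> (forall x, x <= - N -> a x = 0) -> C1_line b ->
    tensor_fun (fun x => a x.1 * b x.2)
| tensor_add f g : tensor_fun f -> tensor_fun g -> tensor_fun (fun x => f x + g x).

Lemma tensor_mul f g : tensor_fun f -> tensor_fun g -> tensor_fun (fun x => f x * g x).
Proof.
move=> tf; elim: tf g => [a b ca a0 Cb|f1 f2 tf1 H1 tf2 H2] g tg; last first.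
  rewrite (_ : (fun x => _) = (fun x => f1 x * g x + f2 x * g x)).
    by apply: tensor_add; [exact: H1|exact: H2].
  by apply/funext => x; rewrite mulrDl.
elim: tg => [a' b' ca' a0' Cb'|g1 g2 tg1 H1 tg2 H2]; last first.
  rewrite (_ : (fun x => _) =
      (fun x => a x.1 * b x.2 * g1 x + a x.1 * b x.2 * g2 x)).
    by apply: tensor_add; [exact: H1|exact: H2].
  by apply/funext => x; rewrite mulrDr.
rewrite (_ : (fun x => _) = (fun x => (fun s => a s * a' s) x.1 * (b * b') x.2)).
  apply: (@tensor_prod (fun s => a s * a' s) (b * b')).
  - by move=> x; apply: cvgM; [exact: ca|exact: ca'].
  - by move=> x xN; rewrite a0// mul0r.
  - by have [] := C1_lineM Cb Cb'.
by apply/funext => x; exact: mulrACA.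
Qed.

Lemma tensor_opp f : tensor_fun f -> tensor_fun (fun x => - f x).
Proof.
elim=> [a b ca a0 Cb|f1 f2 tf1 H1 tf2 H2]; last first.
  rewrite (_ : (fun x => _) = (fun x => - f1 x + - f2 x)); first exact: tensor_add.
  by apply/funext => x; rewrite opprD.
rewrite (_ : (fun x => _) = (fun x => (fun s => - a s) x.1 * b x.2)).
  apply: (@tensor_prod (fun s => - a s) b) => //; first by move=> x; apply: cvgN; exact: ca.
  by move=> x xN; rewrite a0// oppr0.
by apply/funext => x; rewrite mulNr.
Qed.

Lemma tensor_continuous f : tensor_fun f -> continuous f.
Proof.
elim=> [a b ca a0 Cb|f1 f2 tf1 H1 tf2 H2] x; last first.
  by apply: cvgD; [exact: H1|exact: H2].
apply: cvgM.
  by apply: (@continuous_comp _ _ _ (fun x : R * R => x.1) a); [exact: cvg_fst|exact: ca].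
apply: (@continuous_comp _ _ _ (fun x : R * R => x.2) b); first exact: cvg_snd.
exact: C1_line_continuous.
Qed.

(** Vanishing to the left of [- N] makes the integral from minus infinity an integral over a bounded
    interval, and the fundamental theorem applies at every point of the line. *)
Lemma C1_line_primitive (a : R -> R) : continuous a -> (forall x, x <= - N -> a x = 0) ->
  exists2 A, C1_line A & forall x, 'D_1 A x = a x.
Proof.
move=> ca a0.
pose A x := (\int[lam]_(t in [set` `]-oo, x]]) a t)%R.
have ia u : lam.-integrable [set` `]-oo, u]] (EFin \o a).
  apply/integrable_mkcond => //.
  have H : lam.-integrable `[- N, u]%classic (EFin \o a).
    apply: continuous_compact_integrable; first exact: segment_compact.
    by apply: continuous_subspaceT; exact: ca.
  have [K _] := @integrable_mkcond _ T1 R lam (`[- N, u]%classic : set T1)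
    (EFin \o a : T1 -> \bar R) (measurable_itv _).
  have H' := K H.
  apply: eq_integrable H' => // x _.
  rewrite /patch !mem_setE/= !in_itv/=.
  have [xN|xN] := leP (- N) x; first by [].
  by case: ifP => // _; rewrite a0// ltW.
have dA x : derivable A x 1 /\ 'D_1 A x = a x.
  rewrite -derive1E.
  have xx1 : x < x + 1 by rewrite ltrDl.
  by apply: (continuous_FTC1 xx1 (ia _) _ (ca x)); rewrite ltNyr.
have DA : 'D_1 A = a by apply/funext => x; exact: (dA x).2.
exists A; last by move=> x; exact: (dA x).2.
split; last by rewrite DA.
by move=> x; exact: (dA x).1.
Qed.

Lemma tensor_primitive f : tensor_fun f ->
  exists2 F, C1_fun F & forall x, 'D_e1 F x = f x.
Proof.
elim=> [a b ca a0 Cb|f1 f2 tf1 [F1 C1 D1] tf2 [F2 C2 D2]].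
  have [A CA DA] := C1_line_primitive ca a0.
  have [C D] := C1_fun_tensor CA Cb.
  by exists (fun x => A x.1 * b x.2) => [|x]; [exact: C|rewrite (D x).1 DA].
have [C D] := C1_funD C1 C2.
by exists (fun x => F1 x + F2 x) => [|x]; [exact: C|rewrite (D x).1 D1 D2].
Qed.

(** The factor in [x.1 + N] enforces the vanishing to the left of [- N] that [tensor_prod] demands;
    it is positive on the sets in view, which satisfy [- N < x.1]. The other four factors are all
    positive exactly on the open box. *)
Definition box_bump (q : rat * rat * rat * rat) (x : R * R) : R :=
  (step (1 * x.1 + N) * (step (1 * x.1 + - ratr q.1.1.1) * step (-1 * x.1 + ratr q.1.1.2))) *
  (step (1 * x.2 + - ratr q.1.2) * step (-1 * x.2 + ratr q.2)).

Lemma tensor_box_bump q : tensor_fun (box_bump q).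
Proof.
have C c d := (C1_line_affine c d (@C1_step R)).1.
have CM a b (Ca : C1_line a) (Cb : C1_line b) := (@C1_lineM R a b Ca Cb).1.
apply: (@tensor_prod (fun s => step (1 * s + N) *
   (step (1 * s + - ratr q.1.1.1) * step (-1 * s + ratr q.1.1.2)))
   (fun s => step (1 * s + - ratr q.1.2) * step (-1 * s + ratr q.2))).
- apply: C1_line_continuous.
  exact: (CM _ _ (C 1 N) (CM _ _ (C 1 (- ratr q.1.1.1)) (C (-1) (ratr q.1.1.2)))).
- by move=> x xN; rewrite step0 ?mul0r//; lra.
- exact: (CM _ _ (C 1 (- ratr q.1.2)) (C (-1) (ratr q.2))).
Qed.

Lemma box_bump_itv q x : 0 <= box_bump q x <= 1.
Proof.
have H (a b : R) : 0 <= a <= 1 -> 0 <= b <= 1 -> 0 <= a * b <= 1.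
  by move=> /andP[a0 a1] /andP[b0 b1]; rewrite mulr_ge0//= mulr_ile1.
by apply: (H); [apply: (H); [|apply: (H)]|apply: (H)]; exact: step_itv.
Qed.

Lemma box_bump_gt0 q x : - N < x.1 -> rbox q x -> 0 < box_bump q x.
Proof.
move=> xN [/=]; rewrite !in_itv/= => /andP[h1 h2] /andP[h3 h4].
by rewrite /box_bump !mulr_gt0// step_gt0//; lra.
Qed.

Lemma box_bump_neq0 q x : box_bump q x != 0 -> rbox q x.
Proof.
rewrite /box_bump !mulf_eq0 !negb_or => /andP[/andP[_ /andP[h1 h2]] /andP[h3 h4]].
have g (z : R) : step z != 0 -> 0 < z.
  by move=> h; rewrite ltNge; apply/negP => /step0 /eqP; rewrite (negbTE h).
move: (g _ h1) (g _ h2) (g _ h3) (g _ h4) => {}h1 {}h2 {}h3 {}h4.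
by split; rewrite /= in_itv/=; apply/andP; split; lra.
Qed.

Variable E : set (R * R).
Hypotheses (oE : open E) (EN : forall x, E x -> - N < x.1).

(** Boxes that stick out of [E] are discarded, so that every approximant vanishes off [E]. *)
Let bump (k : nat) : R * R -> R :=
  if unpickle k is Some q then
    (if `[< rbox q `<=` E >] then box_bump q else fun=> 0)
  else fun=> 0.

Let tensor0 : tensor_fun (fun=> 0).
Proof.
rewrite (_ : (fun=> 0) = (fun x : R * R => (fun=> 0) x.1 * (fun=> 0) x.2)).
  apply: (@tensor_prod (fun=> 0) (fun=> 0)) => //; first by move=> x; exact: cvg_cst.
  have D0 : 'D_1 (fun _ : R => 0 : R) = (fun _ : R => 0) by apply/funext => x; exact: derive_cst.
  split; first by move=> x; exact: derivable_cst.
  by rewrite D0 => x; exact: cvg_cst.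
by apply/funext => x; rewrite mulr0.
Qed.

Let tensor_bump k : tensor_fun (bump k).
Proof.
rewrite /bump; case: unpickle => [q|]; last exact: tensor0.
by case: ifP => _; [exact: tensor_box_bump|exact: tensor0].
Qed.

Let bump_itv k x : 0 <= bump k x <= 1.
Proof.
rewrite /bump; case: unpickle => [q|]; last by rewrite lexx ler01.
by case: ifP => // _; [exact: box_bump_itv|rewrite lexx ler01].
Qed.

Let tensor_or f g : tensor_fun f -> tensor_fun g ->
  tensor_fun (fun x => 1 - (1 - f x) * (1 - g x)).
Proof.
move=> tf tg.
rewrite (_ : (fun x => _) = (fun x => (f x + g x) + - (f x * g x))).
  apply: tensor_add; first exact: tensor_add.
  by apply: tensor_opp; exact: tensor_mul.
by apply/funext => x; ring.
Qed.

(** At a point of [E] some bump is positive, so from some index on the product stays below a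
    constant smaller than 1, and the growing power drives it to 0. The expression is a polynomial in
    the bumps, hence still a tensor function. *)
Let psi n (x : R * R) := 1 - (\prod_(i < n) (1 - bump i x)) ^+ n.

Let tensor_psi n : tensor_fun (psi n).
Proof.
have T k : tensor_fun (fun x => 1 - \prod_(i < k) (1 - bump i x)).
  elim: k => [|k IH].
    rewrite (_ : (fun x => _) = (fun=> 0)); first exact: tensor0.
    by apply/funext => x; rewrite big_ord0 subrr.
  rewrite (_ : (fun x => _) =
    (fun x => 1 - (1 - (1 - \prod_(i < k) (1 - bump i x))) * (1 - bump k x))).
    exact: (tensor_or IH (tensor_bump k)).
  by apply/funext => x; rewrite big_ord_recr /=; ring.
have P k : tensor_fun (fun x => 1 - (\prod_(i < n) (1 - bump i x)) ^+ k).
  elim: k => [|k IH].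
    rewrite (_ : (fun x => _) = (fun=> 0)); first exact: tensor0.
    by apply/funext => x; rewrite expr0 subrr.
  rewrite (_ : (fun x => _) =
    (fun x => 1 - (1 - (1 - \prod_(i < n) (1 - bump i x))) *
                  (1 - (1 - (\prod_(i < n) (1 - bump i x)) ^+ k)))).
    exact: (tensor_or (T n) IH).
  by apply/funext => x; rewrite exprS; ring.
exact: P.
Qed.

Lemma tensor_approx : exists psi : nat -> R * R -> R,
  [/\ forall n, tensor_fun (psi n),
      forall n x, 0 <= psi n x <= 1,
      forall n x, ~ E x -> psi n x = 0 &
      forall x, E x -> psi n x @[n --> \oo] --> (1 : R)].
Proof.
exists psi.
have b01 k x : 0 <= 1 - bump k x <= 1.
  by have /andP[] := bump_itv k x; move=> *; apply/andP; split; lra.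
have q01 k (P : pred 'I_k) x : 0 <= \prod_(i < k | P i) (1 - bump i x) <= 1.
  apply: (big_ind (fun z => 0 <= z <= 1)); first by rewrite ler01 lexx.
    by move=> a c /andP[a0 a1] /andP[c0 c1]; rewrite mulr_ge0//= mulr_ile1.
  by move=> i _; exact: b01.
have p01 k x : 0 <= \prod_(i < k) (1 - bump i x) <= 1 by exact: q01.
have pn01 k n x : 0 <= (\prod_(i < k) (1 - bump i x)) ^+ n <= 1.
  have /andP[h1 h2] := p01 k x; rewrite exprn_ge0//=; exact: exprn_ile1.
split => //.
- by move=> n x; have /andP[h1 h2] := pn01 n n x; rewrite /psi; apply/andP; split; lra.
- move=> n x nEx; rewrite /psi big1 ?expr1n ?subrr// => i _.
  rewrite (_ : bump i x = 0) ?subr0// /bump; case: unpickle => // q.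
  case: asboolP => // qE; apply/eqP/negPn/negP => /box_bump_neq0 /qE; exact: nEx.
move=> x Ex.
have [q [qx qE]] := open_rbox oE Ex.
pose k := pickle q.
pose b := bump k x.
have b0 : 0 < b.
  rewrite /b /bump /k pickleK; case: asboolP => // _.
  exact: box_bump_gt0 (EN Ex) qx.
have /andP[_ b1] := bump_itv k x.
have cv : 1 - (1 - b) ^+ n @[n --> \oo] --> (1 - 0 : R).
  apply: cvgB; first exact: cvg_cst.
  by apply: cvg_expr; rewrite ger0_norm; rewrite /b in b0 b1 *; lra.
rewrite subr0 in cv.
apply: (squeeze_cvgr _ cv (cvg_cst _)).
near=> n.
have /andP[p0 _] := pn01 n n x.
suff le_n : (\prod_(i < n) (1 - bump i x)) ^+ n <= (1 - b) ^+ n.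
  by rewrite /psi lerB//= lerBlDr lerDl.
have kn : (k < n)%N by near: n; exact: nbhs_infty_gt.
apply: lerXn2r; rewrite ?nnegrE.
- by have /andP[] := p01 n x.
- by have /andP[] := b01 k x.
rewrite (bigD1 (Ordinal kn))//= -/b -[leRHS]mulr1 ler_wpM2l//.
  by have /andP[] := b01 k x.
by have /andP[] := q01 n (fun i => i != Ordinal kn) x.
Unshelve. all: by end_near. Qed.

End Tensor.

(** * Translations of a set and its perimeter *)

Section TranslationEstimate.
Context {R : realType}.
Notation lam := (@lebesgue_measure R).
Notation T1 := (measurableTypeR R).
Notation T2 := (T1 * T1)%type.
Notation mu2 := (lam \x lam)%E.

Lemma C1_funZ (c : R) (f : R * R -> R) : C1_fun f -> C1_fun (fun x => c * f x) /\
  forall x, 'D_e1 (fun x => c * f x) x = c * 'D_e1 f x.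
Proof.
move=> [df f1 f2].
have E1 (x : R * R) : 'D_e1 (fun x => c * f x) x = c * 'D_e1 f x.
  exact: (deriveZ c (df x).1).
have E2 (x : R * R) : 'D_e2 (fun x => c * f x) x = c * 'D_e2 f x.
  exact: (deriveZ c (df x).2).
split; last exact: E1.
split.
- by move=> x; have [d1 d2] := df x; split; [exact: (@derivableZ _ _ _ f c x e1 d1)|exact: (@derivableZ _ _ _ f c x e2 d2)].
- by rewrite (funext E1) => x; apply: cvgM; [exact: cvg_cst|exact: f1].
- by rewrite (funext E2) => x; apply: cvgM; [exact: cvg_cst|exact: f2].
Qed.

(* The field is the difference quotient of a primitive F of an approximation psi of
   the indicator of E: the mean value theorem bounds it by 1, and its divergence tends
   to the difference of the indicators divided by h. *)
Lemma mu2_translate_diff (E : set (R * R)) (h N : R) : open E ->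
  (forall x, E x -> `|x.1| < N /\ `|x.2| < N) -> 0 < h -> (mu2 E < +oo)%E ->
  (mu2 (E `\` translate (- h, 0)%R @^-1` E) <= h%:E * perimeter E)%E.
Proof.
move=> oE EN h0 fE.
have mE := open_measurable2 oE.
have EN1 x : E x -> - N < x.1 by move=> /EN[]; rewrite ltr_norml => /andP[].
have [psi [tpsi psi01 psi0 psi1]] := tensor_approx oE EN1.
pose v : R * R := (- h, 0).
have mpsi n : measurable_fun [set: T2] (psi n).
  by apply: continuous_measurable2; exact: tensor_continuous.
have key n : (\int[mu2]_(x in E) (h^-1 * psi n x + (- h^-1) * psi n (translate v x))%:E
    <= perimeter E)%E.
  have [F CF DF] := tensor_primitive (tpsi n).
  have [C1 D1] := C1_funZ h^-1 CF.
  have [C2 D2] := C1_funZ (- h^-1) (C1_fun_translate v CF).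
  have [C3 D3] := C1_funD C1 C2.
  have mvt (x : R * R) : exists2 c, x.1 - h < c < x.1 &
      h^-1 * F x + - h^-1 * F (translate v x) = psi n (c, x.2).
    have xh : x.1 - h < x.1 by rewrite ltrBlDr ltrDl.
    have dF (s : R) : is_derive s 1 (fun s => F (s, x.2)) (psi n (s, x.2)).
      have [df _ _] := CF; have [/= d E1] := derive_e1E F (s, x.2).
      have d1 := d.1 (df (s, x.2)).1.
      by apply: DeriveDef; [exact: d1|rewrite -E1 DF].
    have cF : {within `[x.1 - h, x.1], continuous (fun s => F (s, x.2))}.
      by apply: derivable_within_continuous => s _; case: (dF s).
    have [c] := @MVT R (fun s => F (s, x.2)) (fun s => psi n (s, x.2)) _ _ xh (fun s _ => dF s) cF.
    rewrite in_itv/= => cx Fc; exists c => //.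
    rewrite mulNr -mulrBr (_ : F (translate v x) = F (x.1 - h, x.2)).
      case: x Fc {cF cx xh dF} => x1 x2 /= ->.
      by rewrite opprB addrC subrK mulrC mulfK ?gt_eqF.
    by congr F; rewrite /translate /v; case: x {cF Fc cx xh dF} => x1 x2; congr pair; rewrite /= addr0.
  apply: le_trans (perimeter_ge1 mE C3 _ _).
  - rewrite le_eqVlt; apply/orP; left; apply/eqP; apply: eq_integral => x _.
    rewrite (D3 x).1 D1 D2 DF.
    by rewrite (derive_translate F v e1 x).2 DF.
  (* The primitive [F] need not have bounded support, but its difference quotient is a value of
     [psi n] at an intermediate point, which lies in [E] whenever that value is nonzero. *)
  - exists (N + h : R) => x /=; have [c /andP[c1 c2] ->] := mvt x => pc.
    have /EN[] : E (c, x.2) by apply: contrapT => /(psi0 n) /eqP; rewrite (negbTE pc).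
    rewrite /= !ltr_norml !ler_norml => /andP[? ?] /andP[? ?].
    by split; apply/andP; split; lra.
  - move=> x /=; have [c _ ->] := mvt x.
    by have /andP[p0 p1] := psi01 n (c, x.2); rewrite ger0_norm.
pose g (x : T2) : \bar R := (h^-1 * \1_(E `\` translate v @^-1` E) x)%:E.
have mD : measurable (E `\` translate v @^-1` E : set T2).
  by apply: measurableD => //; exact: measurable_preimage_translate.
have cv : (\int[mu2]_(x in E) (h^-1 * psi n x + (- h^-1) * psi n (translate v x))%:E
    @[n --> \oo] --> \int[mu2]_(x in E) g x)%E.
  have := @dominated_convergence _ _ _ mu2 E mE
    (fun n x => (h^-1 * psi n x + (- h^-1) * psi n (translate v x))%:E) g
    (fun=> (h^-1 + h^-1)%:E).
  case.
  - move=> n; apply/measurable_EFinP; apply: measurable_funTS.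
    apply: measurable_funD; apply: measurable_funM => //.
    by apply: (measurableT_comp (mpsi n)); exact: measurable_translate.
  - apply/measurable_EFinP; apply: measurable_funTS; apply: measurable_funM => //.
  - apply: aeW => x Ex; apply: cvg_EFin; first by near=> n.
    rewrite /g indicE.
    have c1 : psi n (translate v x) @[n --> \oo] --> (\1_E (translate v x) : R).
      rewrite indicE; have [/set_mem|/negP] := boolP (translate v x \in E).
        exact: psi1.
      move=> nE; rewrite (_ : (fun n => _) = (fun=> 0)); first exact: cvg_cst.
      by apply/funext => n; apply: psi0 => /mem_set.
    rewrite (_ : h^-1 * _ = h^-1 * 1 + (- h^-1) * \1_E (translate v x)).
      apply: cvgD; apply: cvgM; [exact: cvg_cst|exact: psi1|exact: cvg_cst|exact: c1].
    rewrite indicE in_setD (mem_set Ex)/=.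
    rewrite (_ : (x \in translate v @^-1` E) = (translate v x \in E)).
      by case: (translate v x \in E) => /=; rewrite ?mulr1 ?mulr0; ring.
    by apply/idP/idP => /set_mem H; exact: mem_set.
  - by apply: (bounded_integrable (M := `|h^-1 + h^-1|)).
  - apply: aeW => x n Ex; rewrite lee_fin.
    have /andP[p0 p1] := psi01 n x; have /andP[q0 q1] := psi01 n (translate v x).
    have hi : 0 < h^-1 by rewrite invr_gt0.
    by rewrite ler_norml; apply/andP; split; nra.
  by move=> _ _.
have le1 : (\int[mu2]_(x in E) g x <= perimeter E)%E.
  rewrite -(cvg_lim _ cv)//; apply: lime_le; first by apply/cvg_ex; eexists; exact: cv.
  by apply: nearW => n; exact: key.
have gE : (\int[mu2]_(x in E) g x = h^-1%:E * mu2 (E `\` translate v @^-1` E))%E.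
  rewrite /g; under eq_integral do rewrite EFinM.
  rewrite integralZl//; last first.
    apply: (bounded_integrable (M := 1)) => //.
    by move=> x _; rewrite indicE; case: (x \in _) => /=; rewrite ?normr0 ?normr1.
  rewrite [X in (_ * X)%E]integral_indic//.
  by rewrite (_ : _ `&` E = E `\` translate v @^-1` E)// setIidl//; exact: subDsetl.
have : (h%:E * (h^-1%:E * mu2 (E `\` translate v @^-1` E)) <= h%:E * perimeter E)%E.
  by rewrite lee_pmul2l// -gE.
by rewrite muleA -EFinM mulfV ?gt_eqF// mul1e.
Unshelve. all: by end_near. Qed.

End TranslationEstimate.

Section SymmetricDifference.
Context {R : realType}.
Notation lam := (@lebesgue_measure R).
Notation T1 := (measurableTypeR R).
Notation T2 := (T1 * T1)%type.
Notation mu2 := (lam \x lam)%E.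
Implicit Types A B C : set (R * R).

Definition symd {T : Type} (A B : set T) : set T := (A `\` B) `|` (B `\` A).

Lemma symdC {T : Type} (A B : set T) : symd A B = symd B A.
Proof. by rewrite /symd setUC. Qed.

Lemma symd_trans {T : Type} (A B C : set T) : symd A C `<=` symd A B `|` symd B C.
Proof.
move=> x; rewrite /symd /=.
by have [a|a] := pselect (A x); have [b|b] := pselect (B x); have [c|c] := pselect (C x); tauto.
Qed.

Lemma measurable_symd A B : measurable (A : set T2) -> measurable (B : set T2) ->
  measurable (symd A B : set T2).
Proof. by move=> mA mB; apply: measurableU; exact: measurableD. Qed.

Lemma mu2_symd_trans A B C : measurable (A : set T2) -> measurable (B : set T2) ->
  measurable (C : set T2) -> (mu2 (symd A C) <= mu2 (symd A B) + mu2 (symd B C))%E.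
Proof.
move=> mA mB mC.
have mAB := measurable_symd mA mB; have mBC := measurable_symd mB mC.
apply: (@le_trans _ _ (mu2 (symd A B `|` symd B C))); last exact: measureU2.
apply: le_measure; rewrite ?inE; first exact: measurable_symd.
  exact: measurableU.
exact: symd_trans.
Qed.

Lemma mu2_setD_sym A B : measurable (A : set T2) -> measurable (B : set T2) ->
  (mu2 A < +oo)%E -> mu2 A = mu2 B -> mu2 (A `\` B) = mu2 (B `\` A).
Proof.
move=> mA mB fA AB.
have fB : (mu2 B < +oo)%E by rewrite -AB.
have h1 := measureD mA mB fA; have h2 := measureD mB mA fB.
transitivity (mu2 A - mu2 (A `&` B))%E; first exact: h1.
rewrite AB setIC; exact/esym/h2.
Qed.

Lemma le_mu2 A B : measurable (A : set T2) -> measurable (B : set T2) ->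
  A `<=` B -> (mu2 A <= mu2 B)%E.
Proof. by move=> mA mB AB; apply: le_measure => //; exact: mem_set. Qed.

Lemma sigma_finite_mu2 : sigma_finite [set: T2] mu2.
Proof.
exists (fun k : nat => `[- k%:R, k%:R]%classic `*` `[- k%:R, k%:R]%classic : set T2).
  apply/esym/seteqP; split => // x _.
  have M0 : 0 <= Num.max `|x.1| `|x.2| by rewrite le_max normr_ge0.
  have /andP[_ /ltW] := truncn_itv M0.
  rewrite ge_max !ler_norml => /andP[h1 h2].
  by exists (Num.truncn (Num.max `|x.1| `|x.2|)).+1 => //; split; rewrite /= in_itv.
move=> k; split; first by apply: measurableX; exact: measurable_itv.
rewrite mu2_rect; try exact: measurable_itv.
by rewrite !lebesgue_measure_itv/=; case: ifP => _; rewrite ?mule0 ?ltry// -EFinB -EFinM ltry.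
Qed.

(** A name for the product measure that carries the sigma-finite structure, so that Tonelli applies
    to pairs of points of the plane. *)
Definition mu2_measure : set T2 -> \bar R := mu2.
HB.instance Definition _ := Measure.on mu2_measure.
HB.instance Definition _ :=
  Measure_isSigmaFinite.Build _ _ _ mu2_measure sigma_finite_mu2.
Definition mu2_sfinite : {sigma_finite_measure set T2 -> \bar R} := mu2_measure.

End SymmetricDifference.

Section ShiftEstimate.
Context {R : realType}.
Notation lam := (@lebesgue_measure R).
Notation T1 := (measurableTypeR R).
Notation T2 := (T1 * T1)%type.
Notation mu2 := (lam \x lam)%E.
Variable E : set (R * R).
Hypotheses (oE : open E) (fE : (mu2 E < +oo)%E).
Variable N : R.
Hypothesis EN : forall x, E x -> `|x.1| < N /\ `|x.2| < N.
Variable K : R.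
Hypotheses (K0 : 0 <= K) (EK : (perimeter E <= K%:E)%E).
Let mE : measurable (E : set T2) := open_measurable2 oE.

Definition shift_diff (A : set (R * R)) (w : R * R) : set (R * R) :=
  A `\` translate w @^-1` A.

Let mS w : measurable (shift_diff E w : set T2).
Proof. by apply: measurableD => //; exact: measurable_preimage_translate. Qed.

(** Translating by [w] turns the left side into the opposite difference of two sets of equal finite
    area. It supplies the second sign of the shift, as the field construction yields only one. *)
Lemma shift_diff_opp w : mu2 (shift_diff E (- w)) = mu2 (shift_diff E w).
Proof.
rewrite -(mu2_translate w (mS (- w))).
have -> : translate w @^-1` shift_diff E (- w) = translate w @^-1` E `\` E.
  apply/seteqP; split => x [a b]; split => //; rewrite /translate /= addrK in b *; exact: b.
rewrite mu2_setD_sym//.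
- exact: measurable_preimage_translate.
- by rewrite mu2_translate.
- by rewrite mu2_translate.
Qed.

(** A point that leaves [E] under the combined shift leaves it under the first shift or, from the
    shifted position, under the second. *)
Lemma shift_diffD u v : (mu2 (shift_diff E (u + v)%R) <=
  mu2 (shift_diff E u) + mu2 (shift_diff E v))%E.
Proof.
rewrite -(mu2_translate u (mS v)).
have m := measurable_preimage_translate u (mS v).
apply: (@le_trans _ _ (mu2 (shift_diff E u `|` translate u @^-1` shift_diff E v))); last exact: measureU2.
apply: le_mu2 => //; first exact: measurableU.
move=> x [Ex nE]; have [a|a] := pselect (E (translate u x)); [right|left] => //.
by split => // b; apply: nE; move: b; rewrite /translate /= addrA.
Qed.

Lemma shift_diff1 (a : R) : (mu2 (shift_diff E (a, 0)%R) <= (`|a| * K)%:E)%E.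
Proof.
have H (h : R) : 0 < h -> (mu2 (shift_diff E (- h, 0)%R) <= (h * K)%:E)%E.
  move=> h0; apply: le_trans (mu2_translate_diff oE EN h0 fE) _.
  by rewrite EFinM lee_pmul2l.
case: (ltgtP a 0) => [a0|a0|->]; last first.
- rewrite normr0 mul0r (_ : shift_diff _ _ = set0) ?measure0//.
  apply/seteqP; split => // x [Ex]; apply; rewrite /translate /=.
  by rewrite (_ : (0, 0) = 0 :> R * R)// addr0.
- rewrite gtr0_norm// -shift_diff_opp (_ : - (a, 0) = (- a, 0) :> R * R); first exact: H.
  by congr pair; rewrite /= oppr0.
- by rewrite ltr0_norm// -{1}(opprK a); apply: H; rewrite oppr_gt0.
Qed.

End ShiftEstimate.

Section ShiftEstimate2.
Context {R : realType}.
Notation lam := (@lebesgue_measure R).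
Notation T1 := (measurableTypeR R).
Notation T2 := (T1 * T1)%type.
Notation mu2 := (lam \x lam)%E.

(** The shift is split into a horizontal and a vertical one; the vertical one becomes horizontal
    after exchanging the coordinates. *)
Lemma mu2_shift_diff (E : set (R * R)) (N K : R) (w : R * R) : open E -> (mu2 E < +oo)%E ->
  (forall x, E x -> `|x.1| < N /\ `|x.2| < N) -> 0 <= K ->
  (perimeter E <= K%:E)%E -> (mu2 (shift_diff E w) <= ((`|w.1| + `|w.2|) * K)%:E)%E.
Proof.
move=> oE fE EN K0 EK.
have mE := open_measurable2 oE.
have wE : w = (w.1, 0) + (0, w.2).
  by case: w => a b; congr pair; rewrite /= ?addr0 ?add0r.
rewrite {1}wE; apply: le_trans (shift_diffD oE _ _) _.
rewrite mulrDl EFinD; apply: leeD; first exact: (shift_diff1 oE fE EN).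
have oS : open (@diagswap R @^-1` E).
  by apply: open_comp => // x _; exact: continuous_swap.
have fS : (mu2 (@diagswap R @^-1` E) < +oo)%E by rewrite (mu2_swap mE).
have NS x : (@diagswap R @^-1` E) x -> `|x.1| < N /\ `|x.2| < N by move=> /EN[].
have KS : (perimeter (@diagswap R @^-1` E) <= K%:E)%E by rewrite (perimeter_swap mE).
apply: le_trans (shift_diff1 oS fS NS KS w.2).
rewrite -(mu2_swap (A := shift_diff E _)); last first.
  by apply: measurableD => //; exact: measurable_preimage_translate.
rewrite le_eqVlt; apply/orP; left; apply/eqP; congr (mu2 _).
Qed.

End ShiftEstimate2.

(** * Approximation by unions of grid cells *)

Section Grid.
Context {R : realType}.
Notation lam := (@lebesgue_measure R).
Notation T1 := (measurableTypeR R).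
Notation T2 := (T1 * T1)%type.
Notation mu2 := (lam \x lam)%E.
Variables (L : R) (n : nat).
Hypotheses (L0 : 0 < L) (n0 : (0 < n)%N).

Let l : R := L / n%:R.

Let nR0 : 0 < n%:R :> R. Proof. by rewrite ltr0n. Qed.
Let l0 : 0 < l. Proof. by rewrite divr_gt0. Qed.

Definition cell (k : 'I_n * 'I_n) : set (R * R) :=
  [set` `[k.1%:R * l, k.1%:R * l + l[] `*` [set` `[k.2%:R * l, k.2%:R * l + l[].

Definition cells (c : {set 'I_n * 'I_n}) : set (R * R) :=
  \bigcup_(k in [set` c]) cell k.

Lemma measurable_cell k : measurable (cell k : set T2).
Proof. by apply: measurableX; exact: measurable_itv. Qed.

Lemma mu2_cell k : mu2 (cell k) = (l ^+ 2)%:E.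
Proof.
rewrite /cell mu2_rect; try exact: measurable_itv.
rewrite !lebesgue_measure_itv/= !lte_fin !ltrDl l0 -!EFinB -EFinM.
by congr EFin; ring.
Qed.

Lemma measurable_cells c : measurable (cells c : set T2).
Proof.
apply: fin_bigcup_measurable; first exact: finite_finset.
by move=> k _; exact: measurable_cell.
Qed.

Lemma cell_cover (x : R * R) : 0 <= x.1 < L -> 0 <= x.2 < L -> exists k, cell k x.
Proof.
have H (a : R) : 0 <= a < L -> exists i : 'I_n, i%:R * l <= a < i%:R * l + l.
  move=> /andP[a0 aL].
  have al0 : 0 <= a / l by rewrite divr_ge0// ltW.
  have /andP[h1 h2] := truncn_itv al0.
  have tn : (Num.truncn (a / l) < n)%N.
    rewrite -(ltr_nat R); apply: le_lt_trans h1 _.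
    by rewrite ltr_pdivrMr// /l mulrCA mulfV ?mulr1// gt_eqF.
  exists (Ordinal tn) => /=.
  rewrite -ler_pdivlMr// h1/=.
  rewrite (_ : _ + l = (Num.truncn (a / l)).+1%:R * l); last by rewrite -natr1; ring.
  by rewrite -ltr_pdivrMr.
move=> /H[i hi] /H[j hj]; exists (i, j).
by split; rewrite /= in_itv.
Qed.

Lemma cell_diff k (x y : R * R) : cell k x -> cell k y ->
  `|y.1 - x.1| < l /\ `|y.2 - x.2| < l.
Proof.
move=> [/=]; rewrite !in_itv/= => /andP[a1 a2] /andP[a3 a4] [/=].
rewrite !in_itv/= => /andP[b1 b2] /andP[b3 b4].
by split; rewrite ltr_norml; apply/andP; split; lra.
Qed.

Variable E : set (R * R).
Hypotheses (oE : open E) (EL : forall x, E x -> 0 <= x.1 < L /\ 0 <= x.2 < L).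
Variable K : R.
Hypotheses (K0 : 0 <= K) (EK : (perimeter E <= K%:E)%E).
Let mE : measurable (E : set T2) := open_measurable2 oE.

Let EN x : E x -> `|x.1| < L /\ `|x.2| < L.
Proof. by move=> /EL[/andP[a b] /andP[c d]]; rewrite !ger0_norm. Qed.

Let fE : (mu2 E < +oo)%E.
Proof.
have mr : measurable (`[0, L[%classic `*` `[0, L[%classic : set T2).
  by apply: measurableX; exact: measurable_itv.
have sub : E `<=` `[0, L[%classic `*` `[0, L[%classic.
  by move=> x /EL[h1 h2]; split; rewrite /= in_itv.
apply: (le_lt_trans (le_mu2 mE mr sub)).
rewrite mu2_rect; try exact: measurable_itv.
by rewrite !lebesgue_measure_itv/= lte_fin L0 -EFinB -EFinM ltry.
Qed.

(** The pairs of points of one cell that [E] separates. Their measure in the product of two planes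
    tells how far [E] is from being a union of cells. *)
Let Z : set (T2 * T2) := \bigcup_(k in [set: 'I_n * 'I_n]) ((cell k `&` E) `*` (cell k `\` E)).

Let mZ : measurable Z.
Proof.
apply: fin_bigcup_measurable; first exact: finite_finset.
move=> k _; apply: measurableX.
  by apply: measurableI => //; exact: measurable_cell.
by apply: measurableD => //; exact: measurable_cell.
Qed.

(** Coordinates of a pair by its first point and its difference [w]: for fixed [w] the separated
    pairs lie in [shift_diff E w]. *)
Let shear (p : T2 * T2) : T2 * T2 := (p.1, translate p.1 p.2).

Let measurable_shear : measurable_fun setT shear.
Proof.
apply: measurable_fun_pair; first exact: measurable_fst.
have m1 : measurable_fun setT (fun p : T2 * T2 => p.1) by exact: measurable_fst.
have m2 : measurable_fun setT (fun p : T2 * T2 => p.2) by exact: measurable_snd.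
apply: measurable_fun_pair => /=.
  apply: measurable_funD.
    by apply: (measurableT_comp _ m2); exact: measurable_fst.
  by apply: (measurableT_comp _ m1); exact: measurable_fst.
apply: measurable_funD.
  by apply: (measurableT_comp _ m2); exact: measurable_snd.
by apply: (measurableT_comp _ m1); exact: measurable_snd.
Qed.

Let mZ' : measurable (shear @^-1` Z).
Proof. by rewrite -[X in measurable X]setTI; exact: measurable_shear. Qed.

Let swap_sections (A : set (T2 * T2)) : measurable A ->
  (\int[mu2]_x mu2 (xsection A x) = \int[mu2]_y mu2 (ysection A y))%E.
Proof.
move=> mA; have := indic_fubini_tonelli mu2_sfinite mu2_sfinite mA.
rewrite (indic_fubini_tonelli_FE mu2_sfinite mA).
by rewrite (indic_fubini_tonelli_GE mu2_sfinite mA).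
Qed.

(* Averages the translation estimate over all shifts smaller than a cell. *)
Let ZK : (\int[mu2]_x mu2 (xsection Z x) <= (8 * l ^+ 3 * K)%:E)%E.
Proof.
have -> : (\int[mu2]_x mu2 (xsection Z x) =
    \int[mu2]_x mu2 (xsection (shear @^-1` Z) x))%E.
  apply: eq_integral => x _.
  rewrite -(mu2_translate x (A := xsection Z x)); last exact: measurable_xsection.
  by congr (mu2 _); apply/seteqP; split => y; rewrite /xsection /= => /set_mem h; apply/mem_set.
rewrite swap_sections//.
pose box : set T2 := `]- l, l[%classic `*` `]- l, l[%classic.
have mbox : measurable box by apply: measurableX; exact: measurable_itv.
have sub w : ysection (shear @^-1` Z) w `<=` shift_diff E w.
  move=> x; rewrite /ysection /= => /set_mem[k _ [[_ Ex] [_ nEx]]].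
  by split=> //; rewrite /translate /= addrC.
(* Two points of one cell differ by less than [l] in each coordinate, so only shifts in a square of
   area [(2 * l) ^+ 2] contribute, each at most [2 * l * K]; the product is [8 * l ^+ 3 * K]. *)
have sec w : (mu2 (ysection (shear @^-1` Z) w) <= (2 * l * K)%:E * (\1_box w)%:E)%E.
  rewrite indicE; have [/set_mem wb|/negP wb] := boolP (w \in box); last first.
    rewrite mule0 (_ : ysection _ _ = set0) ?measure0//.
    apply/seteqP; split => // x; rewrite /ysection /= => /set_mem[k _ [[/= kx _] [kxw _]]].
    apply: wb; apply/mem_set.
    have [h1 h2] := cell_diff kx kxw.
    split; rewrite /= in_itv/= -ltr_norml.
      by move: h1; rewrite /translate /= addrK.
    by move: h2; rewrite /translate /= addrK.
  rewrite mule1.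
  apply: (@le_trans _ _ (mu2 (shift_diff E w))).
    apply: le_mu2 (sub w); first exact: measurable_ysection.
    by apply: measurableD => //; exact: measurable_preimage_translate.
  apply: le_trans (mu2_shift_diff w oE fE EN K0 EK) _.
  move: wb => [/=]; rewrite !in_itv/= -!ltr_norml => h1 h2.
  rewrite lee_fin ler_wpM2r//; lra.
apply: (@le_trans _ _ (\int[mu2]_w ((2 * l * K)%:E * (\1_box w)%:E))%E).
  apply: ge0_le_integral => //.
  - exact: (measurable_fun_ysection mu2_sfinite mZ').
  - by apply: measurable_funeM; exact/measurable_EFinP.
rewrite ge0_integralZl//; last 2 first.
- exact/measurable_EFinP.
- by rewrite lee_fin !mulr_ge0// ltW.
rewrite [X in (_ * X)%E]integral_indic// setIT.
rewrite [X in (_ * X)%E]mu2_rect; try exact: measurable_itv.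
rewrite !lebesgue_measure_itv/= !lte_fin.
rewrite gtrN//.
by rewrite -!EFinB -!EFinM lee_fin le_eqVlt; apply/orP; left; apply/eqP; ring.
Qed.

Definition majority : {set 'I_n * 'I_n} :=
  [set k | ((l ^+ 2 / 2)%:E < mu2 (cell k `&` E))%E].

Let mU := measurable_cells majority.

Let markov (A : set T2) (f : T2 -> \bar R) : measurable A -> (forall x, (0 <= f x)%E) ->
  measurable_fun setT f -> (forall x, A x -> ((l ^+ 2 / 2)%:E <= f x)%E) ->
  (\int[mu2]_x f x <= (8 * l ^+ 3 * K)%:E)%E -> (mu2 A <= (16 * l * K)%:E)%E.
Proof.
move=> mA f0 mf fA fK.
have h : ((l ^+ 2 / 2)%:E * mu2 A <= (8 * l ^+ 3 * K)%:E)%E.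
  apply: le_trans fK.
  rewrite -[X in (_ * mu2 X)%E](setIT A) -integral_indic//.
  rewrite -ge0_integralZl//; last 2 first.
  - exact/measurable_EFinP.
  - by rewrite lee_fin divr_ge0// sqr_ge0.
  apply: ge0_le_integral => //.
  - by move=> x _; rewrite -EFinM lee_fin mulr_ge0// divr_ge0// sqr_ge0.
  - by apply: measurable_funeM; exact/measurable_EFinP.
  - move=> x _; rewrite indicE; have [/set_mem/fA|_] := boolP (x \in A).
      by rewrite mule1.
    by rewrite mule0.
have l2 : 0 < l ^+ 2 / 2 by rewrite divr_gt0// exprn_gt0.
move: h; rewrite -lee_pdivlMl// -EFinM => h; apply: le_trans h _.
rewrite lee_fin le_eqVlt; apply/orP; left; apply/eqP.
by field; exact: lt0r_neq0.
Qed.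

Let cellE k : (mu2 (cell k `&` E) + mu2 (cell k `\` E) = (l ^+ 2)%:E)%E.
Proof.
rewrite -(mu2_cell k) addeC -measureU//.
- by rewrite setUC setUIDK.
- by apply: measurableD => //; exact: measurable_cell.
- by apply: measurableI => //; exact: measurable_cell.
- by apply/seteqP; split => // x [[_ h] [_ h']].
Qed.

(** A point of [E] outside the majority cells is separated from at least half of its cell, and so is
    a point off [E] in a majority cell. Markov's inequality at level [l ^+ 2 / 2], once for each
    order of integration of [Z], gives [16 * l * K] for each of the two differences. *)
Lemma grid_approx : (mu2 (symd E (cells majority)) <= (32 * l * K)%:E)%E.
Proof.
have -> : 32 * l * K = 16 * l * K + 16 * l * K by ring.
have mEU : measurable (E `\` cells majority : set T2) by exact: measurableD.
have mUE : measurable (cells majority `\` E : set T2) by exact: measurableD.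
rewrite EFinD; apply: le_trans (measureU2 _ _ _) _ => //; apply: leeD.
  apply: (markov (f := fun x => mu2 (xsection Z x))) ZK => //.
    exact: (measurable_fun_xsection mu2_sfinite mZ).
  move=> x [Ex nU].
  have [k kx] := cell_cover (EL Ex).1 (EL Ex).2.
  have -> : (mu2 (xsection Z x) = mu2 (xsection Z x `|` (cell k `\` E)))%E.
    congr (mu2 _); apply/esym/setUidl => y [ky nEy].
    by rewrite /xsection /=; apply/mem_set; exists k.
  apply: (@le_trans _ _ (mu2 (cell k `\` E))); last first.
    have mc : measurable (cell k `\` E : set T2) by apply: measurableD => //; exact: measurable_cell.
    have mx := measurable_xsection x mZ.
    by apply: le_mu2 => //; exact: measurableU.
  have nk : k \notin majority by apply/negP => km; apply: nU; exists k.
  move: nk; rewrite inE -leNgt => h.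
  have := cellE k.
  case: (mu2 (cell k `&` E)) h => [a| |] //; case: (mu2 (cell k `\` E)) => [b| |] //.
  by rewrite !lee_fin => h [] ab; lra.
have zk : (\int[mu2]_y mu2 (ysection Z y) <= (8 * l ^+ 3 * K)%:E)%E.
  by rewrite -(swap_sections mZ).
apply: (markov mUE (fun x => measure_ge0 mu2 (ysection Z x))
  (measurable_fun_ysection mu2_sfinite mZ) _ zk).
move=> y [[k km ky] nEy].
apply: (@le_trans _ _ (mu2 (cell k `&` E))).
  by move: km => /=; rewrite inE => /ltW.
apply: le_mu2.
- by apply: measurableI => //; exact: measurable_cell.
- exact: measurable_ysection.
- by move=> x [kx Ex]; rewrite /ysection /=; apply/mem_set; exists k.
Qed.

End Grid.

Section Compactness.
Context {R : realType}.
Notation lam := (@lebesgue_measure R).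
Notation T1 := (measurableTypeR R).
Notation T2 := (T1 * T1)%type.
Notation mu2 := (lam \x lam)%E.

(** Otherwise the complements of all fibres belong to the ultrafilter, and their finite intersection
    is empty. *)
Lemma ultra_pigeonhole (T : finType) (F : set_system nat) (f : nat -> T) :
  UltraFilter F -> exists c, F (f @^-1` [set c]).
Proof.
move=> UF; apply: contrapT => /forallNP H.
have FC c : F (~` (f @^-1` [set c])).
  by have [/H|] := in_ultra_setVsetC (f @^-1` [set c]) UF.
have Fs (s : seq T) : F [set k | f k \notin s].
  elim: s => [|c s IH]; first by apply: filterS (filterT : F setT).
  apply: filterS (filterI (FC c) IH) => k [h1 h2] /=.
  by rewrite inE negb_or; apply/andP; split => //; apply/eqP.
have /filter_ex[k /=] := Fs (enum T).
by rewrite mem_enum.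
Qed.

(** A point outside all consecutive symmetric differences from index [n] on belongs to all later
    sets or to none, so the upper limit agrees with [G n] there. The error is the tail of a
    geometric series. Besides compactness, this produces the Borel representatives. *)
Lemma cauchy_symd_limit (G : nat -> set (R * R)) (M : R) : 0 <= M ->
  (forall i, measurable (G i : set T2)) ->
  (forall i, (mu2 (symd (G i) (G i.+1)) <= (M / 2 ^+ i)%:E)%E) ->
  let E := \bigcap_n \bigcup_(i in [set i | (n <= i)%N]) G i in
  measurable (E : set T2) /\
  forall n, (mu2 (symd (G n) E) <= (2 * M / 2 ^+ n)%:E)%E.
Proof.
move=> M0 mG GM E.
have mE : measurable (E : set T2).
  by apply: bigcapT_measurable => n; apply: bigcup_measurable.
split => // n.
have mS i : measurable (symd (G i) (G i.+1) : set T2) by exact: measurable_symd.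
have tele i j x : (i <= j)%N -> (forall k, (i <= k < j)%N -> ~ symd (G k) (G k.+1) x) ->
    (G i x <-> G j x).
  move=> /subnK <-; elim: (j - i)%N => [//|d IH] H.
  have Hd : forall k, (i <= k < d + i)%N -> ~ symd (G k) (G k.+1) x.
    by move=> k /andP[h1 h2]; apply: H; rewrite h1 addSn ltnS ltnW.
  rewrite (IH Hd) addSn.
  have := H (d + i)%N; rewrite leq_addl addSn ltnSn => /(_ isT).
  rewrite /symd /= => h; split => g; apply: contrapT => g'; apply: h; [left|right] => //.
have sub : symd (G n) E `<=` \bigcup_i symd (G (n + i)%N) (G (n + i).+1).
  move=> x xs; apply: contrapT => nx.
  have H k : (n <= k)%N -> ~ symd (G k) (G k.+1) x.
    by move=> nk hk; apply: nx; exists (k - n)%N => //; rewrite subnKC.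
  have Gn k : (n <= k)%N -> (G n x <-> G k x).
    by move=> nk; apply: tele => // j /andP[h _]; exact: H.
  case: xs => -[a b].
    apply: b => k _; exists (maxn n k); first by rewrite /= leq_maxr.
    by apply/(Gn (maxn n k)); rewrite ?leq_maxl.
  have [k /= nk Gk] := a n I.
  by apply: b; apply/(Gn k).
apply: (@le_trans _ _ (\sum_(0 <= i <oo) mu2 (symd (G (n + i)%N) (G (n + i).+1)))%E).
  by apply: measure_sigma_subadditive => //; exact: measurable_symd.
have cvg_half := @cvg_geometric_eseries_half R (2 * M) n.
rewrite -(cvg_lim _ cvg_half)//; apply: lee_nneseries => // i _.
apply: le_trans (GM _) _; rewrite lee_fin natrX exprD -exprD addnS exprS.
rewrite invfM mulrACA mulfV// mul1r ler_wpM2l// addnC//.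
Qed.

(** At each scale there are only finitely many unions of cells, which is total boundedness;
    agreement at all scales up to [i] then makes the selected sequence Cauchy at a geometric
    rate. *)
Lemma finite_perimeter_compact (L K : R) (E : nat -> set (R * R)) : 0 < L -> 0 <= K ->
  (forall k, open (E k)) ->
  (forall k x, E k x -> 0 <= x.1 < L /\ 0 <= x.2 < L) ->
  (forall k, (perimeter (E k) <= K%:E)%E) ->
  exists (F : set (R * R)) (s : nat -> nat),
    [/\ measurable (F : set T2),
        forall x, F x -> 0 <= x.1 < L /\ 0 <= x.2 < L,
        forall i, (i <= s i)%N &
        forall i, (mu2 (symd (E (s i)) F) <= (4 / 2 ^+ i)%:E)%E].
Proof.
move=> L0 K0 oE EL EK.
have mE k : measurable (E k : set T2) := open_measurable2 (oE k).
(* The number of cells per side is chosen to bring the grid error below [2 ^- i]. *)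
pose N i := (Num.truncn (32 * L * K * 2 ^+ i)).+1.
have N0 i : (0 < N i)%N by [].
have NK i : 32 * (L / (N i)%:R) * K <= (2 ^+ i)^-1.
  have h0 : 0 <= 32 * L * K * 2 ^+ i by rewrite !mulr_ge0// ?exprn_ge0// ltW.
  have /andP[_ /ltW h] := truncn_itv h0.
  rewrite (_ : 32 * (L / (N i)%:R) * K = (32 * L * K) / (N i)%:R); last by ring.
  by rewrite ler_pdivrMr ?ltr0n// ler_pdivlMl ?exprn_gt0// mulrC.
pose c i k := majority L (N i) (E k).
have Ec i k : (mu2 (symd (E k) (cells L (c i k))) <= ((2 ^+ i)^-1)%:E)%E.
  apply: le_trans (grid_approx L0 (N0 i) (oE k) (EL k) K0 (EK k)) _.
  by rewrite lee_fin.
(* An ultrafilter finer than the neighbourhoods of infinity takes the place of nested subsequences: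
   along it the grid approximation is constant at every scale simultaneously. *)
have [U [UU sU]] := @ultraFilterLemma nat \oo _.
have pig i : exists d, U (c i @^-1` [set d]) by exact: ultra_pigeonhole.
pose d i := projT1 (cid (pig i)).
have dU i : U (c i @^-1` [set d i]) := projT2 (cid (pig i)).
have AU i : U (\bigcap_(j in `I_i.+1) c j @^-1` [set d j]).
  elim: i => [|i IH].
    rewrite (_ : \bigcap_(j in _) _ = c 0%N @^-1` [set d 0%N]); first exact: dU.
    apply/seteqP; split => [k /(_ 0%N)|k h j /=]; first by apply.
    by rewrite ltnS leqn0 => /eqP ->.
  apply: filterS (filterI IH (dU i.+1)) => k [h1 h2] j /=.
  by rewrite ltnS leq_eqVlt => /predU1P[->|ji]; [exact: h2|exact: h1].
have /choice[s Hs] : forall i, exists k, (i <= k)%N /\ forall j, (j <= i)%N -> c j k = d j.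
  move=> i.
  have Uge : U [set k | (i <= k)%N] by apply: sU; exact: nbhs_infty_ge.
  have [k [h1 h2]] := filter_ex (filterI (AU i) Uge).
  by exists k; split => // j ji; exact: h1.
(* Both sets have the same grid approximation at scale [i], namely that of index [d i]. *)
have step i : (mu2 (symd (E (s i)) (E (s i.+1))) <= (2 / 2 ^+ i)%:E)%E.
  have h1 := Ec i (s i); have h2 := Ec i (s i.+1).
  rewrite ((Hs i).2 i) // in h1; rewrite ((Hs i.+1).2 i) // in h2.
  apply: le_trans (mu2_symd_trans _ (measurable_cells _ _) _) _ => //.
  rewrite mulr_natl mulr2n EFinD; apply: leeD; first exact: h1.
  by rewrite symdC.
have [mF HF] := @cauchy_symd_limit (fun i => E (s i)) 2 (ler0n R 2) (fun i => mE (s i)) step.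
exists (\bigcap_n \bigcup_(i in [set i | (n <= i)%N]) E (s i)), s; split => //.
- by move=> x /(_ 0%N I)[i _ /EL].
- by move=> i; exact: (Hs i).1.
- by move=> i; apply: le_trans (HF i) _; rewrite lee_fin -natrM.
Qed.

End Compactness.

(** * The shifted logarithmic kernel *)

Section Kernel.
Context {R : realType}.
Notation lam := (@lebesgue_measure R).
Notation T1 := (measurableTypeR R).
Notation T2 := (T1 * T1)%type.
Notation mu2 := (lam \x lam)%E.

Definition open_square (x : R * R) (r : R) : set (R * R) :=
  [set y | `|x.1 - y.1| < r /\ `|x.2 - y.2| < r].

Lemma enorm_ge (x : R * R) : `|x.1| <= enorm x /\ `|x.2| <= enorm x.
Proof.
rewrite /enorm /dotp -!expr2; split.
  by rewrite -(sqrtr_sqr x.1) ler_wsqrtr// lerDl sqr_ge0.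
by rewrite -(sqrtr_sqr x.2) ler_wsqrtr// lerDr sqr_ge0.
Qed.

Lemma enorm_le (x : R * R) : enorm x <= `|x.1| + `|x.2|.
Proof.
rewrite /enorm /dotp -!expr2 -[leRHS]ger0_norm ?addr_ge0// -sqrtr_sqr ler_wsqrtr//.
rewrite sqrrD !real_normK ?num_real// -addrA lerD2l lerDr.
by rewrite mulrn_wge0// mulr_ge0.
Qed.

Lemma enorm_ge0 (x : R * R) : 0 <= enorm x.
Proof. exact: sqrtr_ge0. Qed.

Lemma measurable_box (x : R * R) (r : R) : measurable (open_square x r : set T2).
Proof.
rewrite (_ : open_square x r = `]x.1 - r, x.1 + r[%classic `*` `]x.2 - r, x.2 + r[%classic).
  by apply: measurableX; exact: measurable_itv.
apply/seteqP; split => y; rewrite /open_square /= !in_itv/= !ltr_norml;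
  move=> [/andP[a b] /andP[c d]]; split; apply/andP; split; lra.
Qed.

Lemma mu2_box (x : R * R) (r : R) : 0 < r -> mu2 (open_square x r) = (4 * r ^+ 2)%:E.
Proof.
move=> r0.
rewrite (_ : open_square x r = `]x.1 - r, x.1 + r[%classic `*` `]x.2 - r, x.2 + r[%classic).
  rewrite mu2_rect; try exact: measurable_itv.
  have h1 : x.1 - r < x.1 + r by lra.
  have h2 : x.2 - r < x.2 + r by lra.
  rewrite !lebesgue_measure_itv/= !lte_fin h1 h2.
  by rewrite -!EFinB -EFinM; congr EFin; ring.
apply/seteqP; split => y; rewrite /open_square /= !in_itv/= !ltr_norml;
  move=> [/andP[a b] /andP[c d]]; split; apply/andP; split; lra.
Qed.

Lemma continuous_enorm : continuous (@enorm R).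
Proof.
move=> x; rewrite /enorm /dotp.
apply: (@continuous_comp _ _ _ (fun x : R * R => x.1 * x.1 + x.2 * x.2) Num.sqrt).
  apply: cvgD; apply: cvgM; try exact: cvg_fst; exact: cvg_snd.
exact: sqrt_continuous.
Qed.

Variable D : R.
Hypothesis D1 : 1 <= D.

(* The logarithmic kernel, shifted by [ln D] and truncated to be nonnegative: the
   truncation is inactive at distances at most [D]. *)
Definition logker (x y : R * R) : R := Num.max 0 (ln (1 / enorm (x - y)) + ln D).

Lemma logker_ge0 x y : 0 <= logker x y.
Proof. by rewrite /logker le_max lexx. Qed.

Lemma lnD0 : 0 <= ln D.
Proof. exact: ln_ge0. Qed.

Lemma logkerE x y : enorm (x - y) <= D -> logker x y = ln (1 / enorm (x - y)) + ln D.
Proof.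
move=> h; rewrite /logker max_r//.
case: (ltgtP 0 (enorm (x - y))) => [e0|e0|e0].
- by rewrite div1r lnV ?posrE// addrC subr_ge0 ler_ln// posrE; exact: lt_le_trans D1.
- by have := enorm_ge0 (x - y); rewrite leNgt e0.
(* On the diagonal [1 / 0 = 0] and [ln 0 = 0], so the value is [ln D], nonnegative because
   [1 <= D]. *)
- by rewrite -e0 div1r invr0 ln0// add0r lnD0.
Qed.

Lemma ln_inv_enorm (z : R * R) : ln (1 / enorm z) = - ln (enorm z).
Proof.
case: (ltgtP 0 (enorm z)) => [e0|e0|e0].
- by rewrite div1r lnV.
- by have := enorm_ge0 z; rewrite leNgt e0.
- by rewrite -e0 div1r invr0 ln0// oppr0.
Qed.

Lemma measurable_log_kernel :
  measurable_fun [set: T2 * T2] (fun p : T2 * T2 => ln (1 / enorm (p.1 - p.2))).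
Proof.
have mfst : measurable_fun setT (fun p : T2 * T2 => p.1) by exact: measurable_fst.
have msnd : measurable_fun setT (fun p : T2 * T2 => p.2) by exact: measurable_snd.
have mdiff : measurable_fun [set: T2 * T2] (fun p : T2 * T2 => (p.1 - p.2 : R * R) : T2).
  apply: measurable_fun_pair => /=; apply: measurable_funB.
  - by apply: (measurableT_comp _ mfst); exact: measurable_fst.
  - by apply: (measurableT_comp _ msnd); exact: measurable_fst.
  - by apply: (measurableT_comp _ mfst); exact: measurable_snd.
  - by apply: (measurableT_comp _ msnd); exact: measurable_snd.
have menorm : measurable_fun [set: T2 * T2] (fun p : T2 * T2 => enorm (p.1 - p.2)).
  exact: (measurableT_comp (continuous_measurable2 continuous_enorm) mdiff).
rewrite (_ : (fun p => _) = (fun p : T2 * T2 => - (ln (enorm (p.1 - p.2))))); last first.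
  by apply/funext => p; exact: ln_inv_enorm.
apply: measurableT_comp; first exact: oppr_measurable.
exact: (measurableT_comp (@measurable_ln R) menorm).
Qed.

Lemma measurable_logker2 : measurable_fun [set: T2 * T2] (fun p : T2 * T2 => logker p.1 p.2).
Proof.
apply: measurable_maxr => //; apply: measurable_funD => //.
exact: measurable_log_kernel.
Qed.

Lemma measurable_logker x : measurable_fun [set: T2] (logker x).
Proof.
have := measurableT_comp measurable_logker2 (pair1_measurable x).
exact.
Qed.

End Kernel.

(** * Logarithmic interaction *)

Section Potential.
Context {R : realType}.
Notation lam := (@lebesgue_measure R).
Notation T1 := (measurableTypeR R).
Notation T2 := (T1 * T1)%type.
Notation mu2 := (lam \x lam)%E.

Lemma measurable_section_integral (f : T2 * T2 -> \bar R) (A : set T2) :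
  measurable A -> measurable_fun setT f -> (forall p, (0 <= f p)%E) ->
  measurable_fun [set: T2] (fun x => \int[mu2]_(y in A) f (x, y))%E.
Proof.
move=> mA mf f0.
pose g (p : T2 * T2) := (f p * (\1_A p.2)%:E)%E.
have mg : measurable_fun setT g.
  apply: emeasurable_funM => //; apply/measurable_EFinP.
  apply: (measurableT_comp (f := \1_A : T2 -> R) (g := snd)) => //.
have := @measurable_fun_fubini_tonelli_F _ _ T2 T2 R (@mu2_sfinite R) g mg.
move=> /(_ _)/= H.
rewrite (_ : (fun x => _) = fubini_F (@mu2_sfinite R) g).
  by apply: H => p; rewrite /g mule_ge0// lee_fin.
apply/funext => x; rewrite /fubini_F /g.
rewrite [LHS]integral_mkcond; apply: eq_integral => y _.
rewrite /patch indicE; case: (y \in A) => /=; first by rewrite mule1.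
by rewrite mule0.
Qed.

Variable D : R.
Hypothesis D1 : 1 <= D.

Definition potential (A : set (R * R)) (x : R * R) : \bar R :=
  (\int[mu2]_(y in A) (logker D x y)%:E)%E.

Definition self_energy (A : set (R * R)) : \bar R :=
  (\int[mu2]_(x in A) potential A x)%E.

(** Bounds the potential of a set of area [a] at every point. It tends to 0 with [a], which is what
    makes the interaction continuous. *)
Definition potential_bound (a : R) : R := 4 * Num.sqrt a + a * ln D.

Lemma potential_ge0 A x : (0 <= potential A x)%E.
Proof. by apply: integral_ge0 => y _; rewrite lee_fin logker_ge0. Qed.

Lemma measurable_potential A : measurable (A : set T2) ->
  measurable_fun [set: T2] (potential A).
Proof.
move=> mA.
apply: (measurable_section_integral (f := fun p => (logker D p.1 p.2)%:E)) => //.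
  by apply/measurable_EFinP; exact: measurable_logker2.
by move=> p; rewrite lee_fin logker_ge0.
Qed.

(** If the distance lies between [2 ^- j.+1] and [2 ^- j], then [y] belongs to the first [j.+1]
    squares, while the logarithm is at most [j.+1 * ln 2], hence at most [j.+1]. Integrals of the
    kernel are thus controlled by areas of squares. *)
Lemma logker_le_shells x y : ((logker D x y)%:E <=
  (ln D)%:E + \sum_(0 <= j <oo) (\1_(open_square x (2 ^- j)) y)%:E)%E.
Proof.
have S0 : (0 <= \sum_(0 <= j <oo) (\1_(open_square x (2 ^- j)) y : R)%:E)%E.
  by apply: nneseries_ge0 => n _ _; rewrite lee_fin.
have lnD := lnD0 D1.
have low : logker D x y <= ln D -> ((logker D x y)%:E <=
  (ln D)%:E + \sum_(0 <= j <oo) (\1_(open_square x (2 ^- j)) y)%:E)%E.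
  by move=> h; apply: (@le_trans _ _ (ln D)%:E); [rewrite lee_fin|exact: leeDl].
pose e := enorm (x - y).
have e0 : 0 <= e := enorm_ge0 _.
have [e1|e1] := leP 1 e.
  apply: low; rewrite /logker ge_max lnD/= gerDr ln_inv_enorm oppr_le0.
  exact: ln_ge0.
move: e0; rewrite le_eqVlt => /predU1P[e0|e0].
  by apply: low; rewrite /logker -/e -e0 div1r invr0 ln0// add0r ge_max lnD lexx.
have ex : exists j : nat, 2 ^- j.+1 <= e.
  have ei0 : 0 <= e^-1 by rewrite invr_ge0 ltW.
  exists (Num.truncn e^-1); have /andP[_ h] := truncn_itv ei0.
  rewrite invf_ple ?posrE ?exprn_gt0//; apply: le_trans (ltW h) _.
  by rewrite -natrX ler_nat ltnW// ltn_expl.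
have [j je jmin] := ex_minnP ex.
have ej i : (i <= j)%N -> e < 2 ^- i.
  case: i => [_|i ij]; first by rewrite expr0 invr1.
  by rewrite ltNge; apply/negP => /jmin; rewrite leqNgt ij.
have in_shell i : (i <= j)%N -> \1_(open_square x (2 ^- i)) y = 1 :> R.
  move=> ij; rewrite indicE mem_set//.
  have [h1 h2] := enorm_ge (x - y).
  by split; [exact: le_lt_trans h1 (ej _ ij)|exact: le_lt_trans h2 (ej _ ij)].
apply: (@le_trans _ _ ((ln D)%:E + (j.+1%:R)%:E)%E).
  rewrite -EFinD lee_fin /logker ge_max addr_ge0//= addrC lerD2l ln_inv_enorm -/e.
  rewrite -lnV//.
  have le2 : e^-1 <= 2 ^+ j.+1 by rewrite invf_ple ?posrE ?exprn_gt0.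
  apply: (@le_trans _ _ (ln (2 ^+ j.+1))).
    by rewrite ler_ln ?posrE ?invr_gt0 ?exprn_gt0.
  have l2 : ln 2 <= 1 :> R.
    by have := @le_ln1Dx R 1; rewrite (_ : 1 + 1 = 2)//; apply; lra.
  have -> : ln (2 ^+ j.+1) = ln 2 * j.+1%:R :> R by rewrite lnXn// mulr_natr.
  by rewrite ler_piMl.
apply: leeD => //.
apply: le_trans (nneseries_lim_ge j.+1 _); last by move=> n _ _; rewrite lee_fin.
rewrite big_mkord (eq_bigr (fun=> 1%E)); last first.
  by move=> i _; rewrite in_shell// -ltnS.
by rewrite sumEFin lee_fin sumr_const card_ord.
Qed.

Lemma potential_le A x (a : R) : measurable (A : set T2) -> mu2 A = a%:E ->
  (potential A x <= (potential_bound a)%:E)%E.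
Proof.
move=> mA muA.
have a0 : 0 <= a by rewrite -lee_fin -muA.
pose s := Num.sqrt a.
have s0 : 0 <= s := sqrtr_ge0 a.
have sa : s ^+ 2 = a by exact: sqr_sqrtr.
have lnD := lnD0 D1.
have mbox j := measurable_box x (2 ^- j).
have minj j : measurable_fun A (fun y : T2 => (\1_(open_square x (2 ^- j)) y : R)%:E).
  by apply/measurable_EFinP; apply: measurable_funTS; exact: measurable_indic.
apply: (@le_trans _ _ (\int[mu2]_(y in A)
    ((ln D)%:E + \sum_(0 <= j <oo) (\1_(open_square x (2 ^- j)) y)%:E))%E).
  apply: ge0_le_integral => //.
  - by move=> y _; rewrite lee_fin logker_ge0.
  - by apply/measurable_EFinP; apply: measurable_funTS; exact: measurable_logker.
  - apply: emeasurable_funD => //.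
    by apply: ge0_emeasurable_sum => // j y _ _; rewrite lee_fin.
  - by move=> y _; exact: logker_le_shells.
rewrite ge0_integralD//; last 2 first.
- by move=> y _; apply: nneseries_ge0 => n _ _; rewrite lee_fin.
- by apply: ge0_emeasurable_sum => // j y _ _; rewrite lee_fin.
rewrite integral_cst// integral_nneseries//.
rewrite [X in (_ * X + _)%E]muA -EFinM /potential_bound addrC EFinD mulrC; apply: leeD => //.
have cvg_half := @cvg_geometric_eseries_half R (4 * s) 0.
rewrite expr0 divr1 in cvg_half.
rewrite -(cvg_lim _ cvg_half)//; apply: lee_nneseries.
  by move=> j _ _; apply: integral_ge0 => y _; rewrite lee_fin.
move=> j _; rewrite [X in (X <= _)%E]integral_indic//.
have p0 : 0 < 2 ^+ j :> R by rewrite exprn_gt0.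
have ip0 : 0 < 2 ^- j :> R by rewrite invr_gt0.
have -> : 4 * s / (2 ^ (j + 1))%:R = s * (2 * 2 ^- j).
  by rewrite natrX addn1 exprS; field; exact: lt0r_neq0.
(* The part of [A] in the square has area at most the smaller of [s ^+ 2] and [(2 * 2 ^- j) ^+ 2],
   hence at most the product [s * (2 * 2 ^- j)]; these sum to [4 * s]. *)
have [h|h] := leP s (2 * 2 ^- j).
  apply: (@le_trans _ _ (mu2 A)).
    by apply: le_mu2 => //; exact: measurableI.
  by rewrite muA lee_fin -sa expr2 ler_wpM2l.
apply: (@le_trans _ _ (mu2 (open_square x (2 ^- j)))).
  by apply: le_mu2 => //; exact: measurableI.
rewrite mu2_box// lee_fin (_ : 4 * _ = (2 * 2 ^- j) * (2 * 2 ^- j)); last by ring.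
by rewrite ler_wpM2r ?mulr_ge0// ltW.
Qed.

Lemma potential_bound_ge0 a : 0 <= a -> 0 <= potential_bound a.
Proof. by move=> a0; rewrite addr_ge0// mulr_ge0// (lnD0 D1). Qed.

Lemma potential_le_mu A x : measurable (A : set T2) -> (mu2 A < +oo)%E ->
  (potential A x <= (potential_bound (fine (mu2 A)))%:E)%E.
Proof.
by move=> mA fA; apply: potential_le => //; rewrite fineK// ge0_fin_numE.
Qed.

Lemma potentialU A B x : measurable (A : set T2) -> measurable (B : set T2) ->
  (potential A x <= potential B x + potential (A `\` B) x)%E.
Proof.
move=> mA mB; have mAB : measurable (A `\` B : set T2) by exact: measurableD.
have mk (C : set T2) : measurable_fun C (fun y => (logker D x y)%:E).
  by apply/measurable_EFinP; apply: measurable_funTS; exact: measurable_logker.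
rewrite /potential -ge0_integral_setU//.
- apply: ge0_subset_integral => //; first exact: measurableU.
    by move=> y _; rewrite lee_fin logker_ge0.
  by move=> y Ay; have [|] := pselect (B y); [left|right].
- by move=> y _; rewrite lee_fin logker_ge0.
- by apply/disj_setPS => y [By [_]].
Qed.

(** Each variable in turn is moved from [A] to [B] at the price of [A] minus [B]. The inner variable
    costs [a * potential_bound d], the outer one [d * potential_bound b]. *)
Lemma self_energy_le A B (a b d : R) : measurable (A : set T2) -> measurable (B : set T2) ->
  mu2 A = a%:E -> mu2 B = b%:E -> mu2 (A `\` B) = d%:E ->
  (self_energy A <= self_energy B +
     (a * potential_bound d + d * potential_bound b)%:E)%E.
Proof.
move=> mA mB muA muB muD.
have mAB : measurable (A `\` B : set T2) by exact: measurableD.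
have a0 : 0 <= a by rewrite -lee_fin -muA.
have b0 : 0 <= b by rewrite -lee_fin -muB.
have d0 : 0 <= d by rewrite -lee_fin -muD.
have mV C (S : set T2) : measurable (C : set T2) -> measurable_fun S (potential C).
  by move=> mC; apply: measurable_funTS; exact: measurable_potential.
apply: (@le_trans _ _ (\int[mu2]_(x in A) (potential B x + (potential_bound d)%:E))%E).
  apply: ge0_le_integral => //.
  - by move=> x _; exact: potential_ge0.
  - exact: mV.
  - by apply: emeasurable_funD => //; exact: mV.
  - move=> x _; apply: le_trans (potentialU x mA mB) _.
    by apply: leeD => //; exact: potential_le.
have pb : (0 <= (potential_bound d)%:E)%E by rewrite lee_fin potential_bound_ge0.
rewrite (ge0_integralD mu2 mA (fun x _ => potential_ge0 B x) (mV B A mB)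
  (fun x _ => pb) (measurable_cst _)).
rewrite integral_cst// [X in (_ + _ * X)%E]muA -EFinM.
rewrite [a * _ + _]addrC EFinD addeA; apply: leeD; last by rewrite mulrC.
apply: (@le_trans _ _ (\int[mu2]_(x in B `|` (A `\` B)) potential B x)%E).
  apply: ge0_subset_integral => //; first exact: measurableU.
  - exact: mV.
  - by move=> x _; exact: potential_ge0.
  - by move=> x Ax; have [|] := pselect (B x); [left|right].
rewrite ge0_integral_setU//; last 3 first.
- exact: mV.
- by move=> x _; exact: potential_ge0.
- by apply/disj_setPS => y [By [_]].
apply: leeD => //.
apply: (@le_trans _ _ (\int[mu2]_(x in A `\` B) (potential_bound b)%:E)%E).
  apply: ge0_le_integral => //.
  - by move=> x _; exact: potential_ge0.
  - exact: mV.
  - by move=> x _; exact: potential_le.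
by rewrite integral_cst// [X in (_ * X)%E]muD -EFinM mulrC.
Qed.

Lemma self_energy_ge0 A : (0 <= self_energy A)%E.
Proof. by apply: integral_ge0 => x _; exact: potential_ge0. Qed.

Lemma self_energy_fin A : measurable (A : set T2) -> (mu2 A < +oo)%E ->
  (self_energy A < +oo)%E.
Proof.
move=> mA fA.
apply: (@le_lt_trans _ _ (\int[mu2]_(x in A) (potential_bound (fine (mu2 A)))%:E)%E).
  apply: ge0_le_integral => //.
  - by move=> x _; exact: potential_ge0.
  - by apply: measurable_funTS; exact: measurable_potential.
  - by move=> x _; exact: potential_le_mu.
rewrite integral_cst// lte_mul_pinfty// lee_fin potential_bound_ge0//.
exact: fine_ge0.
Qed.

Lemma self_energy_translate A v : measurable (A : set T2) ->
  self_energy (translate v @^-1` A) = self_energy A.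
Proof.
move=> mA.
have kT x y : logker D (translate v x) (translate v y) = logker D x y.
  by rewrite /logker /translate /= opprD addrACA subrr addr0.
have mP : measurable_fun A (potential A).
  by apply: measurable_funTS; exact: measurable_potential.
have mK x : measurable_fun A (fun y : T2 => (logker D x y)%:E).
  by apply/measurable_EFinP; apply: measurable_funTS; exact: measurable_logker.
have inv B (mB : measurable (B : set T2)) := mu2_translate v mB.
rewrite /self_energy -(integral_mu2_invariant (measurable_translate v) inv mA mP).
apply: eq_integral => x _.
rewrite /potential -(integral_mu2_invariant (measurable_translate v) inv mA (mK _)).
by apply: eq_integral => y _; rewrite kT.
Qed.

(** Splits the signed energy into a nonnegative part and a constant that depends on the area alone,
    so that signs cause no trouble in later comparisons. *)
Lemma log_energyE A (a : R) : measurable (A : set T2) -> mu2 A = a%:E ->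
  (forall x y, A x -> A y -> enorm (x - y) <= D) ->
  log_energy A = (self_energy A - (a ^+ 2 * ln D)%:E)%E.
Proof.
move=> mA muA AD.
have fA : (mu2 A < +oo)%E by rewrite muA ltry.
have inner x : A x -> (\int[@leb2 R]_(y in A) (ln (1 / enorm (x - y)))%:E =
    potential A x - (a * ln D)%:E)%E.
  move=> Ax.
  transitivity (\int[@leb2 R]_(y in A) ((logker D x y)%:E - (ln D)%:E))%E.
    apply: eq_integral => y /set_mem Ay.
    by rewrite logkerE//; [rewrite -EFinB addrK|exact: AD].
  have mk : measurable_fun A (fun y : T2 => (logker D x y)%:E).
    by apply/measurable_EFinP; apply: measurable_funTS; exact: measurable_logker.
  rewrite integral_leb2//; last by apply: emeasurable_funB.
  rewrite integralB//.
  - by rewrite integral_cst// [X in (_ - _ * X)%E]muA -EFinM mulrC.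
  - apply/integrableP; split => //.
    rewrite (eq_integral (fun y : T2 => (logker D x y)%:E)); last first.
      by move=> y _; rewrite gee0_abs// lee_fin logker_ge0.
    exact: le_lt_trans (potential_le_mu x mA fA) (ltry _).
  - apply: (@bounded_integrable _ A (fun=> ln D) `|ln D|) => //.
rewrite /log_energy.
transitivity (\int[@leb2 R]_(x in A) (potential A x - (a * ln D)%:E))%E.
  by apply: eq_integral => x /set_mem Ax; exact: inner.
have mV : measurable_fun A (potential A).
  by apply: measurable_funTS; exact: measurable_potential.
rewrite integral_leb2//; last by apply: emeasurable_funB.
rewrite integralB//.
- by rewrite integral_cst// [X in (_ - _ * X)%E]muA -EFinM mulrAC -expr2.
- apply/integrableP; split => //.
  rewrite (eq_integral (potential A : T2 -> \bar R)); last first.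
    by move=> y _; rewrite gee0_abs// potential_ge0.
  exact: self_energy_fin.
- by apply: (@bounded_integrable _ A (fun=> a * ln D) `|a * ln D|).
Qed.

End Potential.

Section NullModification.
Context {R : realType}.
Notation lam := (@lebesgue_measure R).
Notation T1 := (measurableTypeR R).
Notation T2 := (T1 * T1)%type.
Notation mu2 := (lam \x lam)%E.

Lemma leb2_measurable_fun (f : T2 -> \bar R) : measurable_fun [set: T2] f ->
  measurable_fun [set: leb2_type R] (f : leb2_type R -> \bar R).
Proof.
by move=> mf _ B mB; have := (leb2_borel (mf measurableT B mB)).1.
Qed.

Lemma integral_null_modification (F A : set (leb2_type R)) (f : leb2_type R -> \bar R) :
  measurable F -> measurable A -> @leb2 R (symd F A) = 0 ->
  measurable_fun [set: leb2_type R] f ->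
  (\int[@leb2 R]_(x in F) f x = \int[@leb2 R]_(x in A) f x)%E.
Proof.
move=> mF mA N0 mf.
have mN : measurable (symd F A) by apply: measurableU; exact: measurableD.
have FN : F `\` symd F A = A `\` symd F A.
  apply/seteqP; split => x [a b]; split => //; apply: contrapT => c; apply: b.
    by left.
  by right.
have H (h : leb2_type R -> \bar R) : measurable_fun setT h -> (forall x, (0 <= h x)%E) ->
    (\int[@leb2 R]_(x in F) h x = \int[@leb2 R]_(x in A) h x)%E.
  move=> mh h0.
  have m' (C : set (leb2_type R)) : measurable_fun C h by exact: measurable_funTS.
  rewrite (ge0_negligible_integral mN mF (m' F) (fun x _ => h0 x) N0).
  by rewrite FN -(ge0_negligible_integral mN mA (m' A) (fun x _ => h0 x) N0).
rewrite integralE [RHS]integralE; congr (_ - _)%E.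
  exact: (H _ (measurable_funepos mf) (funepos_ge0 f)).
exact: (H _ (measurable_funeneg mf) (funeneg_ge0 f)).
Qed.

(** Transfers the energy of a Lebesgue measurable set to a Borel representative, for which the
    potential theory is available. *)
Lemma log_energy_null_modification (F A : set (R * R)) : leb2_measurable F ->
  measurable (A : set T2) -> @leb2 R (symd F A) = 0 -> log_energy F = log_energy A.
Proof.
move=> mF mA N0.
have mA' := (leb2_borel mA).1.
have mk x : measurable_fun [set: T2] (fun y : T2 => (ln (1 / enorm (x - y)))%:E).
  apply/measurable_EFinP.
  by have := measurableT_comp (@measurable_log_kernel R) (pair1_measurable (x : T2)).
have inner x : (\int[@leb2 R]_(y in F) (ln (1 / enorm (x - y)))%:E =
    \int[@leb2 R]_(y in A) (ln (1 / enorm (x - y)))%:E)%E.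
  exact: (integral_null_modification mF mA' N0 (leb2_measurable_fun (mk x))).
rewrite /log_energy.
under eq_integral do rewrite inner.
apply: (integral_null_modification mF mA' N0).
have mg : measurable_fun [set: T2 * T2] (fun p : T2 * T2 => (ln (1 / enorm (p.1 - p.2)))%:E).
  by apply/measurable_EFinP; exact: measurable_log_kernel.
(* The inner integral is signed, so its dependence on [x] is shown to be Borel through Tonelli
   applied to the positive and negative parts of the kernel. *)
have H : measurable_fun [set: T2] (fun x : T2 =>
    \int[mu2]_(y in A) (fun p : T2 * T2 => (ln (1 / enorm (p.1 - p.2)))%:E)^\+ (x, y) -
    \int[mu2]_(y in A) (fun p : T2 * T2 => (ln (1 / enorm (p.1 - p.2)))%:E)^\- (x, y))%E.
  apply: emeasurable_funB; apply: measurable_section_integral => //.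
    exact: measurable_funepos.
  exact: measurable_funeneg.
have -> : (fun x : leb2_type R => (\int[@leb2 R]_(y in A) (ln (1 / enorm (x - y)))%:E)%E) =
    (fun x : T2 =>
    \int[mu2]_(y in A) (fun p : T2 * T2 => (ln (1 / enorm (p.1 - p.2)))%:E)^\+ (x, y) -
    \int[mu2]_(y in A) (fun p : T2 * T2 => (ln (1 / enorm (p.1 - p.2)))%:E)^\- (x, y))%E.
  apply/funext => x; rewrite integral_leb2//; last by apply: measurable_funTS; exact: mk.
  rewrite integralE; congr (_ - _)%E; apply: eq_integral => y _.
    by rewrite !funeposE.
  by rewrite !funenegE.
exact: leb2_measurable_fun H.
Qed.

End NullModification.

(** * Disks *)

Section SmoothFunctions.
Context {R : realType}.
Implicit Types f g : R -> R.

(** Finite order of differentiability, with derivatives taken one at a time: closure under products,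
    composition, inverses and square roots follows by induction on the order, and [smooth_fun] is
    the case of all orders. *)
Fixpoint Ck (n : nat) f : Prop :=
  if n is n'.+1 then (forall x, derivable f x 1) /\ Ck n' (derive1 f) else True.

Lemma Ck_smooth f : (forall n, Ck n f) -> smooth_fun f.
Proof.
move=> H n; elim: n f H => [|n IH] f H x.
  by rewrite derive1n0; exact: (H 1%N).1.
by rewrite derive1Sn; apply: IH => k; exact: (H k.+1).2.
Qed.

Lemma Ck_is_derive n f df : (forall x : R, is_derive x (1:R) f (df x)) -> Ck n df -> Ck n.+1 f.
Proof.
move=> H c; split; first by move=> x; have [] := H x.
rewrite (_ : (derive1 f) = df)//; apply/funext => x; rewrite derive1E.
by have [_ ->] := H x.
Qed.

Lemma CkW n f : Ck n.+1 f -> Ck n f.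
Proof. by elim: n f => [//|n IH] f [d c]; split => //; exact: IH. Qed.

Lemma Ck_derive n f : Ck n.+1 f -> forall x : R, is_derive x (1:R) f ((derive1 f) x).
Proof. by move=> [d _] x; rewrite derive1E; apply: DeriveDef. Qed.

Lemma Ck_cst n (c : R) : Ck n (fun=> c).
Proof.
elim: n c => [//|n IH] c.
by apply: (@Ck_is_derive _ _ (fun=> 0)) => // x; exact: is_derive_cst.
Qed.

Lemma Ck_id n : Ck n (fun x : R => x).
Proof.
case: n => [//|n]; by apply: (@Ck_is_derive _ _ (fun=> 1)); last exact: Ck_cst.
Qed.

Lemma CkD n f g : Ck n f -> Ck n g -> Ck n (fun x => f x + g x).
Proof.
elim: n f g => [//|n IH] f g Cf Cg.
apply: (@Ck_is_derive _ _ (fun x => (derive1 f) x + (derive1 g) x)).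
  by move=> x; exact: (is_deriveD (Ck_derive Cf x) (Ck_derive Cg x)).
by apply: IH; [exact: Cf.2|exact: Cg.2].
Qed.

Lemma CkM n f g : Ck n f -> Ck n g -> Ck n (fun x => f x * g x).
Proof.
elim: n f g => [//|n IH] f g Cf Cg.
apply: (@Ck_is_derive _ _ (fun x => f x * (derive1 g) x + g x * (derive1 f) x)).
  by move=> x; exact: (is_deriveM (Ck_derive Cf x) (Ck_derive Cg x)).
apply: CkD; apply: IH; [exact: CkW|exact: Cg.2|exact: CkW|exact: Cf.2].
Qed.

Lemma CkN n f : Ck n f -> Ck n (fun x => - f x).
Proof.
move=> Cf; rewrite (_ : (fun x => _) = (fun x => -1 * f x)).
  by apply: CkM => //; exact: Ck_cst.
by apply/funext => x; rewrite mulN1r.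
Qed.

Lemma Ck_comp n f g : Ck n f -> Ck n g -> Ck n (fun x => f (g x)).
Proof.
elim: n f g => [//|n IH] f g Cf Cg.
apply: (@Ck_is_derive n (fun x => f (g x)) (fun x => (derive1 f) (g x) * (derive1 g) x)).
  by move=> x; exact: (is_derive1_comp (Ck_derive Cf (g x)) (Ck_derive Cg x)).
by apply: CkM; [apply: IH; [exact: Cf.2|exact: CkW]|exact: Cg.2].
Qed.

Lemma CkV n f : (forall x, f x != 0) -> Ck n f -> Ck n (fun x => (f x)^-1).
Proof.
move=> f0; elim: n => [//|n IH] Cf.
apply: (@Ck_is_derive _ _ (fun x => - ((f x)^-1 * (f x)^-1) * (derive1 f) x)).
  move=> x; apply: (is_derive_eq (is_deriveV (f0 x) (Ck_derive Cf x))).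
  by rewrite /GRing.scale/= expr2 invfM.
apply: CkM; last exact: Cf.2.
by apply: CkN; apply: CkM; apply: IH; exact: CkW.
Qed.

Lemma Ck_sqrt n f : (forall x, 0 < f x) -> Ck n f -> Ck n (fun x => Num.sqrt (f x)).
Proof.
move=> f0; elim: n => [//|n IH] Cf.
apply: (@Ck_is_derive _ _ (fun x => (2 * Num.sqrt (f x))^-1 * (derive1 f) x)).
  by move=> x; exact: (is_derive1_comp (is_derive1_sqrt (f0 x)) (Ck_derive Cf x)).
apply: CkM; last exact: Cf.2.
apply: CkV; first by move=> x; rewrite mulf_neq0// gt_eqF// sqrtr_gt0.
by apply: CkM; [exact: Ck_cst|apply: IH; exact: CkW].
Qed.

(* The flat functions [t^-k exp(-1/t)] on [t > 0], extended by [0]. *)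
Definition flat (k : nat) (t : R) : R := if 0 < t then t^-1 ^+ k * expR (- t^-1) else 0.

(** The exponential of [z] is the power [m.+1] of that of [z / m.+1], which exceeds [z / m.+1]. *)
Lemma flat_bound m (z : R) : 0 < z -> z ^+ m.+1 * expR (- z) <= m.+1%:R ^+ m.+1.
Proof.
move=> z0; have m0 : 0 < m.+1%:R :> R by rewrite ltr0n.
rewrite expRN ler_pdivrMr ?expR_gt0//.
have -> : expR z = expR (z / m.+1%:R) ^+ m.+1.
  by rewrite -expRM_natl mulrC divfK// gt_eqF.
rewrite -exprMn; apply: lerXn2r; rewrite ?nnegrE ?mulr_ge0 ?expR_ge0// 1?ltW//.
rewrite mulrC -ltr_pdivrMr//; apply: lt_le_trans (expR_ge1Dx _).
by rewrite ltrDr.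
Qed.

Lemma flat_ge0 k t : 0 <= flat k t.
Proof.
rewrite /flat; case: ifPn => // t0.
by rewrite mulr_ge0 ?expR_ge0// exprn_ge0// invr_ge0 ltW.
Qed.

Lemma flat_gt0 k t : 0 < t -> 0 < flat k t.
Proof. by move=> t0; rewrite /flat t0 mulr_gt0 ?expR_gt0// exprn_gt0// invr_gt0. Qed.

Lemma flat_eq0 k t : t <= 0 -> flat k t = 0.
Proof. by move=> t0; rewrite /flat ltNge t0. Qed.

(** The powers of [t^-1] are carried along because they make the family closed under
    differentiation, whence all orders at once. *)
Lemma is_derive_flat k (t : R) :
  is_derive t 1 (flat k) (flat k.+2 t - k%:R * flat k.+1 t).
Proof.
case: (ltgtP 0 t) => t0.
- have t_neq0 : t != 0 by rewrite gt_eqF.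
  have E : {near t, (fun t => t^-1 ^+ k * expR (- t^-1)) =1 flat k}.
    have : \forall s \near t, 0 < s by exact: lt_nbhsr.
    by apply: filterS => s s0; rewrite /flat s0.
  apply: (near_eq_is_derive E).
  have dV : is_derive t 1 (fun t => t^-1) (- (t^-1 ^+ 2)).
    apply: (is_derive_eq (is_deriveV t_neq0 (is_derive_id t 1))).
    by rewrite /GRing.scale/= mulr1 exprVn.
  have dX : is_derive t 1 (fun t => t^-1 ^+ k) (k%:R * t^-1 ^+ k.-1 * (- (t^-1 ^+ 2))).
    have := is_deriveX k dV; rewrite exprfctE => H; apply: (is_derive_eq H).
    by rewrite /GRing.scale/= -mulr_natl.
  have dE : is_derive t 1 (fun t => expR (- t^-1)) (expR (- t^-1) * t^-1 ^+ 2).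
    have dN : is_derive t 1 (fun t : R => - t^-1) (t^-1 ^+ 2).
      by apply: (is_derive_eq (is_deriveN dV)); rewrite opprK.
    exact: (@is_derive1_comp R expR (fun t : R => - t^-1) t _ _ (is_derive_expR (- t^-1)) dN).
  apply: (is_derive_eq (is_deriveM dX dE)).
  rewrite /flat t0 /GRing.scale/=; case: k {E dX} => [|k] /=.
    by rewrite !expr0 expr1; ring.
  by rewrite !exprS; ring.
- have E : {near t, (fun=> 0) =1 flat k}.
    have : \forall s \near t, s < 0 by exact: lt_nbhsl.
    by apply: filterS => s s0; rewrite flat_eq0// ltW.
  apply: (near_eq_is_derive E).
  rewrite !flat_eq0 ?ltW// mulr0 subr0; exact: is_derive_cst.
(* At 0 the bound for exponent [k.+2] leaves a factor [h ^+ 2] to spare, so the derivative there is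
   0. *)
- apply: (@is_derive_quadratic _ _ _ _ (k.+2%:R ^+ k.+2)) => h.
  rewrite -t0 !(flat_eq0 _ (lexx _)) addr0 !(mulr0, mul0r, subr0).
  rewrite ger0_norm ?flat_ge0//; have [h0|h0] := leP h 0.
    by rewrite flat_eq0// mulr_ge0// ?sqr_ge0// exprn_ge0.
  have hi : 0 < h^-1 by rewrite invr_gt0.
  have := flat_bound k.+1 hi; rewrite /flat h0 => b.
  rewrite -ler_pdivrMr ?exprn_gt0//; apply: le_trans b.
  by rewrite mulrAC -exprVn -exprD addn2.
Qed.

Lemma Ck_flat n k : Ck n (flat k).
Proof.
elim: n k => [//|n IH] k.
apply: (@Ck_is_derive _ _ (fun t => flat k.+2 t - k%:R * flat k.+1 t)).
  exact: is_derive_flat.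
by apply: CkD => //; apply: CkN; apply: CkM => //; exact: Ck_cst.
Qed.

(** The usual smooth cutoff, equal to 1 for [t * t <= a] and to 0 for [b <= t * t]; when [a < b] the
    two terms of the denominator never vanish together. *)
Definition cutoff (a b t : R) : R :=
  flat 0 (b - t * t) / (flat 0 (b - t * t) + flat 0 (t * t - a)).

Variables (a b : R).
Hypothesis ab : a < b.

Lemma cutoff_den t : 0 < flat 0 (b - t * t) + flat 0 (t * t - a).
Proof.
have [h|h] := ltP (t * t) b.
  by rewrite ltr_pwDl// ?flat_ge0// flat_gt0// subr_gt0.
by rewrite ltr_wpDl// ?flat_ge0// flat_gt0// subr_gt0; exact: lt_le_trans h.
Qed.

Lemma Ck_cutoff n : Ck n (cutoff a b).
Proof.
have C2 : Ck n (fun t : R => t * t) by apply: CkM; exact: Ck_id.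
have Cb : Ck n (fun t => flat 0 (b - t * t)).
  by apply: (Ck_comp (Ck_flat n 0)); apply: CkD; [exact: Ck_cst|exact: CkN].
have Ca : Ck n (fun t => flat 0 (t * t - a)).
  by apply: (Ck_comp (Ck_flat n 0)); apply: CkD => //; exact: Ck_cst.
apply: CkM => //; apply: CkV; last exact: CkD.
by move=> t; rewrite gt_eqF// cutoff_den.
Qed.

Lemma cutoff1 t : t * t <= a -> cutoff a b t = 1.
Proof.
move=> h; rewrite /cutoff (flat_eq0 _ (_ : t * t - a <= 0)) ?subr_le0// addr0 divff//.
by rewrite gt_eqF// flat_gt0// subr_gt0; exact: le_lt_trans ab.
Qed.

Lemma cutoff_le t : 0 <= cutoff a b t <= 1 /\ (b <= t * t -> cutoff a b t = 0).
Proof.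
split.
  have d := cutoff_den t; apply/andP; split; rewrite /cutoff.
    by apply: divr_ge0; [exact: flat_ge0|exact: ltW].
  by rewrite ler_pdivrMr// mul1r lerDl flat_ge0.
by move=> h; rewrite /cutoff flat_eq0 ?mul0r// subr_le0.
Qed.

End SmoothFunctions.

Section Disk.
Context {R : realType}.
Notation lam := (@lebesgue_measure R).
Notation T1 := (measurableTypeR R).
Notation T2 := (T1 * T1)%type.
Notation mu2 := (lam \x lam)%E.

Definition disk (r : R) : set (R * R) := [set x | enorm x < r].

Lemma diskE r x : 0 < r -> disk r x <-> dotp x x < r ^+ 2.
Proof.
move=> r0; rewrite /disk /= /enorm -{1}(gtr0_norm r0) -sqrtr_sqr ltr_sqrt//.
by rewrite exprn_gt0.
Qed.

Lemma open_disk r : open (disk r).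
Proof.
rewrite (_ : disk r = enorm @^-1` [set z : R | z < r])//.
by apply: open_comp; [move=> x _; exact: continuous_enorm|exact: open_lt].
Qed.

Lemma path_connected_connected (A : set (R * R)) : path_connected R A -> connected A.
Proof.
move=> pA; have [->|/set0P[x Ax]] := eqVneq A set0; first exact: connected0.
have I01 : connected (@unit_itv R) by apply/connected_intervalP; exact: interval_is_interval.
rewrite (_ : A = \bigcup_(g in [set g : R -> R * R | is_path_in A g /\ g 0 = x]) (g @` unit_itv)).
  apply: bigcup_connected.
    exists x => g [_ g0]; exists 0; last exact: g0.
    by rewrite /unit_itv /= in_itv/= lexx ler01.
  by move=> g [[cg _] _]; exact: connected_continuous_connected.
apply/seteqP; split => y.
  move=> Ay; have [g [pg g0 g1]] := pA x y Ax Ay.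
  exists g; first by split.
  by exists 1; [rewrite /unit_itv /= in_itv/= lexx ler01|exact: g1].
by move=> [g [[_ gA] _] yg]; exact: gA.
Qed.

Lemma disk_convex r (x y : R * R) (s : R) : 0 < r -> disk r x -> disk r y -> 0 <= s <= 1 ->
  disk r ((1 - s) *: x + s *: y).
Proof.
move=> r0 /(diskE _ r0) hx /(diskE _ r0) hy /andP[s0 s1]; apply/(diskE _ r0).
(* Convexity of the squared norm as an exact identity, which takes the place of the triangle
   inequality for [enorm]. *)
have -> : dotp ((1 - s) *: x + s *: y) ((1 - s) *: x + s *: y) =
  (1 - s) * dotp x x + s * dotp y y - s * (1 - s) * dotp (x - y) (x - y).
  by rewrite /dotp /= /GRing.scale /=; ring.
have d0 : 0 <= s * (1 - s) * dotp (x - y) (x - y).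
  by rewrite mulr_ge0 ?mulr_ge0 ?subr_ge0// /dotp -!expr2 addr_ge0// sqr_ge0.
have [->|sp] := eqVneq s 1; first by rewrite subrr mul0r add0r mul1r mulr0 mul0r subr0.
have : (1 - s) * dotp x x < (1 - s) * r ^+ 2.
  by rewrite ltr_pM2l// subr_gt0 lt_neqAle sp.
have : s * dotp y y <= s * r ^+ 2 by rewrite ler_wpM2l// ltW.
lra.
Qed.

Lemma disk_path_connected r : 0 < r -> path_connected R (disk r).
Proof.
move=> r0 x y Bx By; exists (fun s => (1 - s) *: x + s *: y); split.
- split.
    apply: continuous_subspaceT => s; apply: cvgD; apply: cvgZr_tmp.
      by apply: cvgB; [exact: cvg_cst|exact: cvg_id].
    exact: cvg_id.
  by move=> _ [s + <-]; rewrite /unit_itv /= in_itv/=; exact: disk_convex.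
- by rewrite subr0 scale1r scale0r addr0.
- by rewrite subrr scale0r scale1r add0r.
Qed.

Lemma within_cvg (T U : topologicalType) (A : set T) (f : T -> U) :
  (forall p, A p -> f x @[x --> within A (nbhs p)] --> f p) -> {within A, continuous f}.
Proof.
move=> h; rewrite continuous_subspace_in => p; rewrite inE => Ap V hV.
by have := h p Ap V hV; rewrite (nbhs_subspace_in Ap).
Qed.

Lemma within_cvgP (T U : topologicalType) (A : set T) (f : T -> U) :
  {within A, continuous f} -> forall p, A p -> f x @[x --> within A (nbhs p)] --> f p.
Proof. move=> h p Ap V hV; have := h p V hV; rewrite /= /nbhs/=.
by rewrite -(nbhs_subspace_in Ap). Qed.

(** Straight-line contraction of the loop to its base point, inside the disk by convexity. The loop
    is continuous on the unit interval only, hence the limits along [within]. *)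
Lemma disk_simply_connected r : 0 < r -> simply_connected R (disk r).
Proof.
move=> r0; split; first exact: disk_path_connected.
move=> gam [cg gB] g01.
have B0 : disk r (gam 0).
  by apply: gB; exists 0 => //; rewrite /unit_itv /= in_itv/= lexx ler01.
exists (fun p => (1 - p.1) *: gam p.2 + p.1 *: gam 0); split.
- apply: within_cvg => -[s t] [/= hs ht].
  have cs : p.1 @[p --> within (unit_itv `*` unit_itv) (nbhs (s, t))] --> s.
    exact: (cvg_trans (cvg_app _ (@cvg_within _ _ _ _)) (@cvg_fst _ _ (nbhs s) (nbhs t) _)).
  have ct : gam p.2 @[p --> within (unit_itv `*` unit_itv) (nbhs (s, t))] --> gam t.
    apply: (@cvg_comp _ _ _ snd gam _ (within unit_itv (nbhs t)) _); last first.
      exact: within_cvgP cg _ ht.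
    move=> V; rewrite /within /= => hV.
    have : nbhs (s, t) [set p : R * R | unit_itv p.2 -> V p.2].
      exact: (@cvg_snd _ _ (nbhs s) (nbhs t) _ _ hV).
    by apply: filterS => p hp [_ /hp].
  have cb : (1 - p.1) @[p --> within (unit_itv `*` unit_itv) (nbhs (s, t))] --> 1 - s.
    by apply: cvgB => //; exact: cvg_cst.
  apply: cvgD; first exact: (cvgZ cb ct).
  by apply: (cvgZ cs); exact: cvg_cst.
- move=> _ [[s t] [/= hs ht] <-]; apply: disk_convex => //.
  by apply: gB; exists t.
- by move=> t _ /=; rewrite subr0 scale1r scale0r addr0.
- by move=> t _ /=; rewrite subrr scale0r scale1r add0r.
- by move=> s _ /=; rewrite -g01 -scalerDl subrK scale1r.
Qed.

(** At a boundary point [p], with inner normal [- p / r], the disk is locally the strict epigraph of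
    minus the square root of [r ^+ 2 - t ^+ 2], the lower half of the circle. *)
Lemma smooth_disk r : 0 < r -> smooth_set (disk r).
Proof.
move=> r0; split; first exact: open_disk.
move=> p [clp nip].
have pr : dotp p p = r ^+ 2.
  apply/eqP; rewrite eq_le; apply/andP; split.
    have h : enorm p <= r.
      have cl : closed [set x : R * R | enorm x <= r].
        rewrite (_ : [set x | _] = enorm @^-1` [set z : R | z <= r])//.
        by apply: closed_comp; [move=> x _; exact: continuous_enorm|exact: closed_le].
      have : closure (disk r) `<=` [set x : R * R | enorm x <= r].
        by rewrite [X in _ `<=` X](closure_id _).1//; apply: closure_subset => x /ltW.
      by move=> /(_ p clp).
    rewrite leNgt; apply/negP => h'; move: h.
    rewrite leNgt => /negP; apply; rewrite /enorm -{1}(gtr0_norm r0) -sqrtr_sqr ltr_sqrt//.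
    by apply: lt_trans h'; rewrite exprn_gt0.
  rewrite leNgt; apply/negP => /(diskE _ r0) h; apply: nip.
  by rewrite ((interior_id _).1 (@open_disk r)).
(* The ball of radius [r / 4] has tangential coordinates with square at most [a], where the cutoff
   is 1; beyond [b] it is 0, so at most [r ^+ 2 / 4] is ever subtracted from [r ^+ 2]. *)
pose a := r ^+ 2 / 16; pose b := r ^+ 2 / 4.
have r20 : 0 < r ^+ 2 by rewrite exprn_gt0.
have ab : a < b by rewrite /a /b; lra.
(* Coincides with r^2 - t^2 near 0 and stays positive, so that its square root is
   smooth on the whole line. *)
pose u t := r ^+ 2 - cutoff a b t * (t * t).
have u0 t : 0 < u t.
  rewrite /u; have [/andP[c0 c1] cb] := cutoff_le ab t.
  have [h|h] := leP b (t * t); first by rewrite cb// mul0r subr0.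
  have : cutoff a b t * (t * t) <= 1 * (t * t) by rewrite ler_wpM2r// -expr2 sqr_ge0.
  by rewrite /b in h; lra.
pose nu : R * R := (- p.1 / r, - p.2 / r).
have nu1 : dotp nu nu = 1.
  rewrite -[RHS](divff (lt0r_neq0 r20)) -{1}pr /dotp /=; field; exact: lt0r_neq0.
exists (r / 4), nu, (fun t => - Num.sqrt (u t)); split.
- by rewrite divr_gt0.
- by rewrite /enorm nu1 sqrtr1.
- apply: Ck_smooth => n; apply: CkN; apply: Ck_sqrt => //.
  apply: CkD; first exact: Ck_cst.
  by apply: CkN; apply: CkM; [exact: Ck_cutoff|apply: CkM; exact: Ck_id].
move=> x xp.
have lagrange (z : R * R) : dotp z (nu.2, - nu.1) ^+ 2 + dotp z nu ^+ 2 = dotp z z.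
  by rewrite -[RHS]mulr1 -nu1 /dotp /=; ring.
pose d : R * R := x - p.
have dd : dotp d d < a.
  have r40 : 0 < r / 4 by rewrite divr_gt0.
  have : disk (r / 4) d by exact: xp.
  by move=> /(diskE _ r40); rewrite /a expr_div_n; lra.
pose s := dotp x (nu.2, - nu.1); pose w := dotp x nu.
have sd : s = dotp d (nu.2, - nu.1).
  by rewrite /s /d /dotp /= ; field; exact: lt0r_neq0.
have wd : w = - r + dotp d nu.
  have -> : - r = dotp p nu.
    rewrite (_ : dotp p nu = - (dotp p p / r)); last by rewrite /dotp /=; ring.
    by rewrite pr expr2 mulfK// gt_eqF.
  by rewrite /w /d /dotp /=; ring.
have ld := lagrange d; rewrite -sd in ld.
have lx := lagrange x; rewrite -/s -/w in lx.
have sa : s * s <= a by rewrite -expr2; have := sqr_ge0 (dotp d nu); lra.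
(* Near [p] the normal coordinate stays negative, which selects the lower branch of the circle when
   the inequality of squares is undone. *)
have w0 : w < 0.
  have h : dotp d nu ^+ 2 < r ^+ 2.
    by have := sqr_ge0 s; rewrite /a in dd; lra.
  have : `|dotp d nu| < r by rewrite -ltr_sqr ?nnegrE ?(ltW r0)// -normrX ger0_norm// sqr_ge0.
  by rewrite ltr_norml wd => /andP[]; lra.
rewrite -/s -/w.
have us : u s = r ^+ 2 - s ^+ 2 by rewrite /u cutoff1// mul1r expr2.
apply: (iff_trans (diskE _ r0)); rewrite -lx.
have -> : (- Num.sqrt (u s) < w) = (- w < Num.sqrt (u s)) by rewrite ltrNl.
have -> : (- w < Num.sqrt (u s)) = (w ^+ 2 < u s).
  by rewrite -{1}(ger0_norm (_ : 0 <= - w)) ?oppr_ge0 ?ltW// normrN -sqrtr_sqr ltr_sqrt.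
by rewrite us ltrBrDl.
Qed.

(** The constant is the area of the unit disk, positive and finite by comparison with squares; the
    general radius follows by scaling. *)
Lemma mu2_disk_pos : exists2 c : R, 0 < c & forall r, 0 < r -> mu2 (disk r) = (c * r ^+ 2)%:E.
Proof.
have m1 r : measurable (disk r : set T2) by apply: open_measurable2; exact: open_disk.
have lo : (1%:E <= mu2 (disk 1))%E.
  have := @mu2_box R 0 2^-1; rewrite invr_gt0 ltr0n => /(_ isT) h.
  apply: (@le_trans _ _ (mu2 (open_square 0 2^-1))); first by rewrite h lee_fin; lra.
  apply: le_mu2 => //; first exact: measurable_box.
  move=> x [/=]; rewrite !sub0r !normrN => h1 h2.
  apply: le_lt_trans (enorm_le x) _; lra.
have hi : (mu2 (disk 1) < +oo)%E.
  apply: (@le_lt_trans _ _ (mu2 (open_square 0 1))); last by rewrite mu2_box// ltry.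
  apply: le_mu2 => //; first exact: measurable_box.
  move=> x hx; have [h1 h2] := enorm_ge x.
  by split; rewrite /= sub0r normrN; [exact: le_lt_trans h1 hx|exact: le_lt_trans h2 hx].
pose c := fine (mu2 (disk 1)).
have cE : mu2 (disk 1) = c%:E by rewrite fineK// ge0_fin_numE.
exists c; first by move: lo; rewrite cE lee_fin; lra.
move=> r r0; have ri0 : 0 < r^-1 by rewrite invr_gt0.
have := mu2_scale ri0 (m1 1); rewrite cE invrK -EFinM mulrC => <-.
congr (mu2 _); apply/seteqP; split => x.
  move/(diskE _ r0) => h; apply/(diskE _ ltr01).
  rewrite (_ : dotp _ _ = dotp x x / r ^+ 2); last first.
    by rewrite /dotp /= /GRing.scale/=; field; exact: lt0r_neq0.
  by rewrite ltr_pdivrMr ?exprn_gt0// expr1n mul1r.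
move/(diskE _ ltr01) => h; apply/(diskE _ r0); move: h.
rewrite (_ : dotp _ _ = dotp x x / r ^+ 2); last first.
  by rewrite /dotp /= /GRing.scale/=; field; exact: lt0r_neq0.
by rewrite ltr_pdivrMr ?exprn_gt0// expr1n mul1r.
Qed.

End Disk.

(** * Upper bound for the perimeter of a disk *)

Section DiskPerimeter.
Context {R : realType}.
Notation lam := (@lebesgue_measure R).
Notation T1 := (measurableTypeR R).
Notation T2 := (T1 * T1)%type.
Notation mu2 := (lam \x lam)%E.

Lemma continuous_bounded_disk (g : R * R -> R) (r : R) : continuous g ->
  exists M, forall x, disk r x -> `|g x| <= M.
Proof.
move=> cg.
have cB : compact (`[- r, r]%classic `*` `[- r, r]%classic : set (R * R)).
  by apply: compact_setX; exact: segment_compact.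
have : compact (g @` (`[- r, r]%classic `*` `[- r, r]%classic)).
  by apply: continuous_compact => //; exact: continuous_subspaceT.
move=> /compact_bounded[M [_ /(_ (M + 1))]]; rewrite ltrDl ltr01 => /(_ isT) MS.
exists (M + 1) => x hx; apply: MS; exists x => //.
have [h1 h2] := enorm_ge x; split; rewrite /= in_itv/= -ler_norml ltW//.
  exact: le_lt_trans h1 hx.
exact: le_lt_trans h2 hx.
Qed.

Variables (f : R * R -> R) (r : R).
Hypotheses (Cf : C1_fun f) (f1 : forall x, `|f x| <= 1) (r0 : 0 < r).

Lemma mu2_disk_fin : (mu2 (disk r) < +oo)%E.
Proof. by have [c _ ->] := @mu2_disk_pos R; rewrite ?ltry. Qed.

Lemma measurable_disk : measurable (disk r : set T2).
Proof. by apply: open_measurable2; exact: open_disk. Qed.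

Lemma disk_D2_integrable : mu2.-integrable (disk r) (EFin \o 'D_e2 f).
Proof.
have [_ _ c2] := Cf; have [M hM] := continuous_bounded_disk r c2.
apply: (@bounded_integrable R (disk r) ('D_e2 f) M) => //.
- exact: measurable_disk.
- exact: mu2_disk_fin.
- by apply: measurable_funTS; exact: continuous_measurable2.
Qed.

Let g : T2 -> \bar R := (EFin \o 'D_e2 f) \_ (disk r).

(** On a vertical chord the derivative integrates to the difference of [f] at the two ends, at most
    2 because [f] is bounded by 1. *)
Lemma disk_slice (x : R) :
  (fubini_F lam g x <= if (- r <= x <= r)%R then 2%:E else 0)%E.
Proof.
rewrite /fubini_F.
have [h|h] := ltP (x ^+ 2) (r ^+ 2); last first.
  rewrite (_ : (\int[_]_y _)%E = 0%E); first by case: ifP => // _; rewrite lee_fin.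
  apply: integral0_eq => y _; rewrite /g patchE memNset//.
  by move=> /(diskE _ r0); rewrite /dotp/= -!expr2 => H; have := sqr_ge0 y; lra.
have -> : (- r <= x <= r) = true.
  by rewrite -ler_norml -ler_sqr ?nnegrE ?(ltW r0)// -normrX ger0_norm ?sqr_ge0// ltW.
pose s := Num.sqrt (r ^+ 2 - x ^+ 2).
have s0 : 0 < s by rewrite sqrtr_gt0 subr_gt0.
have ss : s ^+ 2 = r ^+ 2 - x ^+ 2 by rewrite sqr_sqrtr// subr_ge0 ltW.
have [df c1 c2] := Cf.
pose F (y : R) := f (x, y).
have dF (y : R) : derivable F y 1 /\ 'D_1 F y = 'D_e2 f (x, y).
  have [H1 H2] := derive_e2E f (x, y).
  by split; [exact: (H1.1 (df (x, y)).2)|rewrite H2].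
have cg : continuous (fun y : R => 'D_e2 f (x, y)).
  move=> y; apply: (@continuous_comp _ _ _ (fun y : R => (x, y)) ('D_e2 f)); last exact: c2.
  move=> U [[A B] [/= hA hB] sAB]; apply: filterS hB => z Bz; apply: sAB; split => //.
  exact: nbhs_singleton hA.
have cF : continuous F.
  by move=> y; apply/differentiable_continuous/derivable1_diffP; exact: (dF y).1.
rewrite (_ : (fun y : R => g (x, y)) = (EFin \o (fun y : R => 'D_e2 f (x, y))) \_ `]- s, s[%classic); last first.
  apply/funext => y; rewrite /g !patchE.
  suff -> : ((x, y) \in disk r) = (y \in `]- s, s[%classic) by [].
  apply/idP/idP; rewrite !inE /= in_itv/= -ltr_norml -ltr_sqr ?nnegrE ?(ltW s0)// -normrX ger0_norm ?sqr_ge0// ss.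
    by move=> /(diskE _ r0); rewrite /dotp/= -!expr2; lra.
  by move=> H; apply/(diskE _ r0); rewrite /dotp/= -!expr2; lra.
rewrite -integral_mkcond.
have mg : measurable_fun (`]- s, s[%classic : set T1) (EFin \o (fun y : R => 'D_e2 f (x, y))).
  by apply/measurable_EFinP; apply: measurable_funTS; exact: continuous_measurable_fun.
rewrite -(@integral_itv_bndoo R (- s) s _ true false mg).
rewrite (@continuous_FTC2 R (fun y => 'D_e2 f (x, y)) F (- s) s).
- rewrite -EFinB lee_fin /F.
  by have := f1 (x, s); have := f1 (x, - s); rewrite !ler_norml => /andP[? ?] /andP[? ?]; lra.
- lra.
- exact: continuous_subspaceT.
- split.
  + by move=> y _; exact: (dF y).1.
  + by apply: cvg_at_right_filter; exact: cF.
  + by apply: cvg_at_left_filter; exact: cF.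
- by move=> y _; rewrite derive1E (dF y).2.
Qed.

Lemma disk_D2_le : (\int[mu2]_(x in disk r) ('D_e2 f x)%:E <= (4 * r)%:E)%E.
Proof.
have ig : mu2.-integrable [set: T2] g.
  by apply/(@integrable_mkcond _ T2 R mu2 (disk r) (EFin \o 'D_e2 f) measurable_disk);
    exact: disk_D2_integrable.
rewrite (@integral_mkcond _ T2 R mu2 (disk r)) -/g -integral12_prod_meas1//.
pose h (x : T1) : \bar R := (2 * \1_(`[- r, r]%classic) x)%:E.
have hE (x : T1) : h x = (if (- r <= x <= r)%R then 2%:E else 0)%E.
  rewrite /h indicE mem_setE /= in_itv/=.
  by case: ifP => _; rewrite ?mulr1 ?mulr0.
have hi : (\int[lam]_x h x = (4 * r)%:E)%E.
  rewrite /h; under eq_integral do rewrite EFinM.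
  have li : lam (`[- r, r]%classic : set R) = (2 * r)%:E.
    have rr : - r < r by rewrite -subr_gt0 opprK addr_gt0.
    by rewrite lebesgue_measure_itv/= lte_fin rr -EFinB opprK mulr_natl mulr2n.
  rewrite ge0_integralZl//.
  - rewrite integral_indic// setIT [X in (_ * X)%E]li -EFinM; congr EFin.
    by rewrite mulrA; congr (_ * _); rewrite -natrM.
  - by apply/measurable_EFinP; exact: measurable_indic.
have mh : measurable_fun setT h.
  by apply/measurable_EFinP; apply: measurable_funM => //.
rewrite -hi; apply: le_integral => //.
- exact: integrable_fubini_F.
- apply/integrableP; split => //.
  rewrite (eq_integral h); first by rewrite hi ltry.
  by move=> x _; rewrite hE; case: ifP => _; rewrite ?abse0//= ger0_norm.
- by move=> x _; rewrite hE; exact: disk_slice.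
Qed.

End DiskPerimeter.

Section Competitor.
Context {R : realType}.
Notation lam := (@lebesgue_measure R).
Notation T1 := (measurableTypeR R).
Notation T2 := (T1 * T1)%type.
Notation mu2 := (lam \x lam)%E.

Lemma disk_swap (r : R) : @diagswap R @^-1` disk r = disk r.
Proof. by apply/seteqP; split => x /=; rewrite /disk /= enorm_swap. Qed.

(** Each component of the field contributes at most [4 * r]: chords worth at most 2, over a range of
    length [2 * r]. The horizontal component becomes vertical by exchanging coordinates. *)
Lemma perimeter_disk (r : R) : 0 < r -> (perimeter (disk r) <= (8 * r)%:E)%E.
Proof.
move=> r0; have mD := @measurable_disk R r; apply: perimeter_le => // phi [[C1 C2] _ b].
have f1 x : `|(fst \o phi) x| <= 1 by apply: le_trans (b x); exact: (enorm_ge _).1.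
have f2 x : `|(snd \o phi) x| <= 1 by apply: le_trans (b x); exact: (enorm_ge _).2.
have Cs := C1_fun_swap C1.
have fs x : `|((fst \o phi) \o diagswap) x| <= 1 by exact: f1.
have sw : EFin \o 'D_e2 ((fst \o phi) \o diagswap) = (EFin \o 'D_e1 (fst \o phi)) \o @diagswap R.
  by apply/funext => x /=; rewrite (derive_swap2 _ _).2.
have [_ c1 _] := C1; have [M hM] := continuous_bounded_disk r c1.
have i1 : mu2.-integrable (disk r) (EFin \o 'D_e1 (fst \o phi)).
  apply: (@bounded_integrable R (disk r) ('D_e1 (fst \o phi)) M) => //.
  - exact: mu2_disk_fin.
  - apply: measurable_funTS; exact: (continuous_measurable2 c1).
have l1 : (\int[mu2]_(x in disk r) ('D_e1 (fst \o phi) x)%:E <= (4 * r)%:E)%E.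
  have := disk_D2_le Cs fs r0.
  have := @integral_mu2_invariant R (@diagswap R) (disk r) (EFin \o 'D_e1 (fst \o phi))
    (@measurable_diagswap R) (@mu2_swap R) mD (measurable_int mu2 i1).
  rewrite disk_swap => E; rewrite -E.
  by congr (_ <= _)%E; apply: eq_integral => x _; rewrite -[LHS]/((EFin \o 'D_e2 ((fst \o phi) \o diagswap)) x) sw.
have i2 := disk_D2_integrable C2 r0.
have -> : (\int[mu2]_(x in disk r) (divergence phi x)%:E =
    \int[mu2]_(x in disk r) ('D_e1 (fst \o phi) x)%:E +
    \int[mu2]_(x in disk r) ('D_e2 (snd \o phi) x)%:E)%E.
  rewrite -(@integralD _ T2 R mu2 (disk r) mD _ _ i1 i2).
  by apply: eq_integral => x _; rewrite -EFinD.
apply: le_trans (leeD l1 (disk_D2_le C2 f2 r0)) _.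
by rewrite -EFinD lee_fin; lra.
Qed.

Lemma disk_of_area (m : R) : 0 < m -> exists2 r, 0 < r & mu2 (disk r) = m%:E.
Proof.
move=> m0; have [c c0 hc] := @mu2_disk_pos R.
exists (Num.sqrt (m / c)); first by rewrite sqrtr_gt0 divr_gt0.
rewrite hc ?sqrtr_gt0 ?divr_gt0// sqr_sqrtr ?divr_ge0 ?ltW//.
by congr EFin; field; rewrite gt_eqF.
Qed.

End Competitor.

(** * Relaxation and minimizers *)

Section Translations.
Context {R : realType}.
Implicit Types (A E : set (R * R)) (v : R * R).

Lemma within_continuous_comp (S T U : topologicalType) (D : set S) (f : S -> T) (g : T -> U) :
  {within D, continuous f} -> continuous g -> {within D, continuous (g \o f)}.
Proof.
move=> cf cg; apply: within_cvg => p Dp.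
apply: (@cvg_comp _ _ _ f g (within D (nbhs p)) (nbhs (f p)) (nbhs (g (f p)))); last exact: cg.
exact: (within_cvgP cf Dp).
Qed.

Lemma translateK v : cancel (translate v) (translate (- v)).
Proof. by move=> x; rewrite /translate addrK. Qed.

Lemma translateNK v : cancel (translate (- v)) (translate v).
Proof. by move=> x; rewrite /translate subrK. Qed.

Lemma connected_translate A v : connected A -> connected (translate v @^-1` A).
Proof.
move=> cA; rewrite (_ : _ @^-1` _ = translate (- v) @` A).
  apply: connected_continuous_connected => //.
  by apply: continuous_subspaceT; exact: continuous_translate.
apply/seteqP; split => x /=; first by move=> Ax; exists (translate v x) => //; exact: translateK.
by move=> [y Ay <-]; rewrite translateNK.
Qed.

Lemma is_path_in_translate A v (gam : R -> R * R) : is_path_in A gam ->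
  is_path_in (translate v @^-1` A) (translate (- v) \o gam).
Proof.
move=> [cg gA]; split; first by apply: within_continuous_comp => //; exact: continuous_translate.
by move=> _ [t It <-] /=; rewrite translateNK; apply: gA; exists t.
Qed.

Lemma simply_connected_translate A v : simply_connected R A ->
  simply_connected R (translate v @^-1` A).
Proof.
move=> [pA sA]; split.
  move=> x y Ax Ay; have [gam [pg g0 g1]] := pA _ _ Ax Ay.
  exists (translate (- v) \o gam); split; first exact: is_path_in_translate.
    by rewrite /= g0 translateK.
  by rewrite /= g1 translateK.
move=> gam pg g01.
have pg' : is_path_in A (translate v \o gam).
  have := is_path_in_translate (- v) pg; rewrite opprK; congr is_path_in.
  by apply/seteqP; split => x /=; rewrite translateNK.
have [H [cH HA H0 H1 Hs]] := sA _ pg' (congr1 (translate v) g01).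
exists (translate (- v) \o H); split.
- by apply: within_continuous_comp => //; exact: continuous_translate.
- by move=> _ [t It <-] /=; rewrite translateNK; apply: HA; exists t.
- by move=> t It; rewrite /= H0//= translateK.
- by move=> t It; rewrite /= H1//= translateK.
- by move=> s Is; have [h1 h2] := Hs s Is; rewrite /= h1 h2 /= translateK.
Qed.

Lemma smooth_Ck (g : R -> R) n : smooth_fun g -> Ck n g.
Proof.
move=> Sg; rewrite -[g]derive1n0; elim: n 0%N => [//|n IH] k; split; first exact: Sg.
by rewrite -derive1nS; exact: IH.
Qed.

Lemma smooth_set_translate E v : smooth_set E -> smooth_set (translate v @^-1` E).
Proof.
move=> [oE bE]; have oT : open (translate v @^-1` E).
  by apply: open_comp => // x _; exact: continuous_translate.
split => // p [clp nip].
have [] := bE (translate v p).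
  split.
    move=> B hB; have [x [xE xB]] := clp _ (continuous_translate hB).
    by exists (translate v x).
  move=> /interior_subset ip; apply: nip; rewrite ((interior_id _).1 oT); exact: ip.
move=> r [nu [g [r0 nu1 Sg H]]].
(* In the frame of [nu] the translation shifts the argument of the graph by the tangential
   coordinate of [v] and its height by the normal one. *)
exists r, nu, (fun t => g (t + dotp v (nu.2, - nu.1)) + (- dotp v nu)); split => //.
  apply: Ck_smooth => n; apply: CkD; last exact: Ck_cst.
  by apply: Ck_comp; [exact: smooth_Ck|apply: CkD; [exact: Ck_id|exact: Ck_cst]].
move=> x xp.
have dD w : dotp (x + v) w = dotp x w + dotp v w by rewrite /dotp /=; ring.
have := H (translate v x); rewrite /translate !dD => H'.
apply: (iff_trans (H' _)); last by rewrite ltrBlDr.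
have e : x + v - (p + v) = x - p by rewrite opprD addrACA subrr addr0.
by rewrite /eball /= e.
Qed.

End Translations.

Section Limits.
Context {R : realType}.
Notation lam := (@lebesgue_measure R).
Notation T1 := (measurableTypeR R).
Notation T2 := (T1 * T1)%type.
Notation mu2 := (lam \x lam)%E.

Lemma limn_einf_lt (u : nat -> \bar R) (c : \bar R) (N : nat) : (limn_einf u < c)%E ->
  exists2 n, (N <= n)%N & (u n < c)%E.
Proof.
move=> h; have : (einfs u N < c)%E.
  apply: le_lt_trans h; rewrite limn_einf_lim (cvg_lim _ (@cvg_einfs_sup R u))//.
  by apply: ereal_sup_ubound; exists N.
by move=> /ereal_inf_lt[_ [n Nn <-] hn]; exists n.
Qed.

Lemma limn_einf_le (u v : nat -> \bar R) (l : \bar R) : (forall n, (u n <= v n)%E) ->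
  v @ \oo --> l -> (limn_einf u <= l)%E.
Proof.
move=> uv vl; rewrite limn_einf_lim -(cvg_lim _ vl)//.
apply: lee_lim; [exact: is_cvg_einfs|by apply/cvg_ex; exists l|].
apply: nearW => n; apply: le_trans (uv n).
by apply: ereal_inf_lbound; exists n => /=.
Qed.

Lemma limn_einf_ge0 (u : nat -> \bar R) : (forall n, (0 <= u n)%E) -> (0 <= limn_einf u)%E.
Proof.
move=> u0; rewrite leNgt; apply/negP => /(limn_einf_lt 0)[n _].
by rewrite ltNge u0.
Qed.

Lemma measure_symd_trans d (T : measurableType d) (mu : {measure set T -> \bar R}) (A B C : set T) :
  measurable A -> measurable B -> measurable C ->
  (mu (symd A C) <= mu (symd A B) + mu (symd B C))%E.
Proof.
move=> mA mB mC.
have mS X Y : measurable X -> measurable Y -> measurable (symd X Y : set T).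
  by move=> mX mY; apply: measurableU; exact: measurableD.
apply: (@le_trans _ _ (mu (symd A B `|` symd B C))); last by apply: measureU2; exact: mS.
by apply: le_measure; rewrite ?inE; [exact: mS|apply: measurableU; exact: mS|exact: symd_trans].
Qed.

Lemma measure_le_symd d (T : measurableType d) (mu : {measure set T -> \bar R}) (A B : set T) :
  measurable A -> measurable B -> (mu A <= mu B + mu (symd A B))%E.
Proof.
move=> mA mB.
have mS : measurable (symd A B : set T) by apply: measurableU; exact: measurableD.
apply: (@le_trans _ _ (mu (B `|` symd A B))); last exact: measureU2.
apply: le_measure; rewrite ?inE//; first exact: measurableU.
by move=> x Ax; have [Bx|Bx] := pselect (B x); [left|right; left].
Qed.

Lemma open_leb2 (A : set (R * R)) : open A -> leb2_measurable A.
Proof. by move=> oA; exact: (leb2_borel (open_measurable2 oA)).1. Qed.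

Lemma L1_cvgP (G : nat -> set (R * R)) (E : set (R * R)) : (forall n, open (G n)) ->
  leb2_measurable E -> L1_cvg G E <-> (fun n => @leb2 R (symd (G n) E)) @ \oo --> 0%E.
Proof.
move=> oG mE; rewrite /L1_cvg.
suff -> : (fun n => \int[@leb2 R]_x (`|\1_(G n) x - \1_E x|)%:E)%E = (fun n => @leb2 R (symd (G n) E)) by [].
apply/funext => n; have mG := open_leb2 (oG n).
have mS : measurable (symd (G n) E : set (leb2_type R)) by apply: measurableU; exact: measurableD.
have := integral_indic (@leb2 R) measurableT mS; rewrite setIT => <-.
apply: eq_integral => x _; congr EFin; rewrite !indicE.
have [Gx|Gx] := boolP (x \in G n); have [Ex|Ex] := boolP (x \in E);
  rewrite ?(subr0, sub0r, subrr, normr0, normrN, normr1).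
- by rewrite memNset// => -[] [] ; move: Gx Ex; rewrite !inE.
- by rewrite mem_set//; left; move: Gx Ex; rewrite !inE notin_setE.
- by rewrite mem_set//; right; move: Gx Ex; rewrite !inE notin_setE.
- by rewrite memNset// => -[] []; move: Gx Ex; rewrite !notin_setE.
Qed.

End Limits.

Section Relaxation.
Context {R : realType}.
Notation lam := (@lebesgue_measure R).
Notation T1 := (measurableTypeR R).
Notation T2 := (T1 * T1)%type.
Notation mu2 := (lam \x lam)%E.

Lemma div_pow2_small (c e : R) : 0 <= c -> 0 < e -> exists n : nat, c / 2 ^+ n <= e.
Proof.
move=> c0 e0; have h0 : 0 <= c / e by rewrite divr_ge0// ltW.
have h := archi_boundP h0; exists (Num.Def.archi_bound (c / e)).
rewrite ler_pdivrMr ?exprn_gt0// mulrC -ler_pdivrMr//; apply: (le_trans (ltW h)).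
by rewrite -natrX ler_nat ltnW// ltn_expl.
Qed.

Lemma leb2_symd_trans (A B C : set (R * R)) : leb2_measurable A -> leb2_measurable B ->
  leb2_measurable C ->
  (@leb2 R (symd A C) <= @leb2 R (symd A B) + @leb2 R (symd B C))%E.
Proof. exact: measure_symd_trans. Qed.

Lemma leb2_le_symd (A B : set (R * R)) : leb2_measurable A -> leb2_measurable B ->
  (@leb2 R A <= @leb2 R B + @leb2 R (symd A B))%E.
Proof. exact: measure_le_symd. Qed.

Definition cube (c : R * R) (L : R) : set (R * R) :=
  [set x | c.1 <= x.1 < c.1 + L /\ c.2 <= x.2 < c.2 + L].

Lemma cube_dist c L x y : cube c L x -> cube c L y -> enorm (x - y) <= 2 * L.
Proof.
move=> [/andP[a1 a2] /andP[a3 a4]] [/andP[b1 b2] /andP[b3 b4]].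
apply: le_trans (enorm_le _) _.
have h1 : `|(x - y).1| <= L by rewrite /= ler_norml; apply/andP; split; lra.
have h2 : `|(x - y).2| <= L by rewrite /= ler_norml; apply/andP; split; lra.
lra.
Qed.

Lemma connected_widths (G : set (R * R)) (P : R) (x y : R * R) : open G ->
  (mu2 G < +oo)%E -> connected G -> (perimeter G <= P%:E)%E -> G x -> G y ->
  `|x.1 - y.1| <= 6 * P /\ `|x.2 - y.2| <= 6 * P.
Proof.
move=> oG fG cG pG Gx Gy; have mG := open_measurable2 oG.
split.
  have := le_trans (connected_width oG fG cG Gx Gy) pG.
  by rewrite lee_fin ler_pdivrMr// mulrC.
pose G' := @diagswap R @^-1` G.
have oG' : open G' by apply: open_comp => // z _; exact: continuous_swap.
have fG' : (mu2 G' < +oo)%E by rewrite mu2_swap.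
have cG' : connected G'.
  rewrite (_ : G' = @diagswap R @` G).
    apply: connected_continuous_connected => //.
    by apply: continuous_subspaceT; exact: continuous_swap.
  apply/seteqP; split => [z Gz|z [w Gw <-]]; last by rewrite /G'; case: w Gw.
  by exists (diagswap z) => //; case: z Gz.
have := connected_width oG' fG' (x := diagswap x) (y := diagswap y) cG'.
have sw w : G w -> G' (diagswap w) by case: w.
rewrite {1 2}/G' perimeter_swap// => h.
have : ((`|x.2 - y.2| / 6)%:E <= perimeter G)%E by exact: h (sw _ Gx) (sw _ Gy).
by move=> /le_trans /(_ pG); rewrite lee_fin ler_pdivrMr// mulrC.
Qed.

Variable Q : set (R * R) -> Prop.
Hypothesis QC : forall A, Q A -> connected A.
Hypothesis QT : forall A v, Q A -> Q (translate v @^-1` A).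
Notation Per := (relaxed_perimeter Q).

Lemma relaxed_perimeter_ge0 E : (0 <= Per E)%E.
Proof.
apply: le_ereal_inf_tmp => _ [G [_ HG] <-]; apply: limn_einf_ge0 => n.
by apply: perimeter_ge0; apply: open_measurable2; exact: (HG n).2.1.
Qed.

Lemma relaxed_perimeter_le (G : nat -> set (R * R)) E (u : nat -> \bar R) l :
  leb2_measurable E -> (forall n, Q (G n) /\ smooth_set (G n)) ->
  (fun n => @leb2 R (symd (G n) E)) @ \oo --> 0%E ->
  (forall n, (perimeter (G n) <= u n)%E) -> u @ \oo --> l -> (Per E <= l)%E.
Proof.
move=> mE HG GE Gu ul; apply: ge_ereal_inf.
exists (limn_einf (fun n => perimeter (G n))); last exact: limn_einf_le ul.
exists G => //; split => //; apply/L1_cvgP => // n; exact: (HG n).2.1.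
Qed.

Lemma relaxed_approx E (p e : R) : leb2_measurable E -> Per E = p%:E -> 0 < e ->
  exists G, [/\ Q G, smooth_set G, (perimeter G <= (p + e)%:E)%E &
    (@leb2 R (symd G E) <= e%:E)%E].
Proof.
move=> mE pE e0.
have : (Per E < (p + e)%:E)%E by rewrite pE lte_fin ltrDl.
move=> /ereal_inf_lt[_ [G [LG HG] <-] hlt].
have oG n : open (G n) := (HG n).2.1.
have h0 := (L1_cvgP oG mE).1 LG.
have [N _ HN] : \forall n \near \oo, (@leb2 R (symd (G n) E) < e%:E)%E.
  apply: (h0 [set y | (y < e%:E)%E]); apply: open_nbhs_nbhs; split.
    exact: open_ereal_lt_ereal.
  by rewrite /= lte_fin.
have [n Nn hn] := limn_einf_lt N hlt.
have [QG SG] := HG n.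
by exists (G n); split => //; [exact: ltW|apply: ltW; exact: HN].
Qed.

(* The connected approximants of a set of finite relaxed perimeter meet each other
   and have bounded width, so up to a null set they confine it to a cube. *)
Lemma relaxed_representative E (m p : R) : 0 < m -> leb2_measurable E ->
  @leb2 R E = m%:E -> Per E = p%:E ->
  exists (A : set (R * R)) (c : R * R), [/\ measurable (A : set T2),
    @leb2 R (symd E A) = 0%E, A `<=` cube c (25 * (p + 1)) &
    forall e, 0 < e -> exists G, [/\ Q G, smooth_set G, (perimeter G <= (p + e)%:E)%E,
      (mu2 (symd G A) <= e%:E)%E & G `<=` cube c (25 * (p + 1))]].
Proof.
move=> m0 mE Em pE.
have p0 : 0 <= p by rewrite -lee_fin -pE relaxed_perimeter_ge0.
(* Disjoint approximants would have area at most [2 * d], while each has area at least [m - d];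
   [d <= m / 8] excludes this. The bound [d <= 1] keeps the perimeters below [p + 1]. *)
pose d := Num.min 1 (m / 8).
have d0 : 0 < d by rewrite lt_min ltr01 divr_gt0.
have d1 : d <= 1 by rewrite ge_min lexx.
have dm : d <= m / 8 by rewrite ge_min lexx orbT.
have dn0 n : 0 < d / 2 ^+ n by rewrite divr_gt0// exprn_gt0.
have dnd n : d / 2 ^+ n <= d.
  rewrite ler_pdivrMr ?exprn_gt0//; apply: ler_peMr; first exact: ltW.
  by rewrite exprn_ege1// ler1n.
have [G HG] := choice (fun n => relaxed_approx mE pE (dn0 n)).
have oG n : open (G n) by have [_ []] := HG n.
have mG n := open_measurable2 (oG n).
have mG' n := open_leb2 (oG n).
have GB n : @leb2 R (G n) = mu2 (G n) := (leb2_borel (mG n)).2.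
have GE n : (@leb2 R (symd (G n) E) <= (d / 2 ^+ n)%:E)%E by have [] := HG n.
have pG n : (perimeter (G n) <= (p + 1)%:E)%E.
  have [_ _ h _] := HG n; apply: le_trans h _; rewrite lee_fin lerD2l.
  exact: le_trans (dnd n) d1.
have mS i j : measurable (symd (G i) (G j) : set T2) by exact: measurable_symd.
have GG i j : (mu2 (symd (G i) (G j)) <= (d / 2 ^+ i + d / 2 ^+ j)%:E)%E.
  rewrite -(leb2_borel (mS i j)).2.
  apply: le_trans (leb2_symd_trans (mG' i) mE (mG' j)) _.
  by rewrite EFinD; apply: leeD; [exact: GE|rewrite symdC; exact: GE].
have Gm n : (m%:E <= mu2 (G n) + d%:E)%E.
  rewrite -Em -GB; apply: le_trans (leb2_le_symd mE (mG' n)) _.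
  apply: leeD2l; rewrite symdC; apply: le_trans (GE n) _.
  by rewrite lee_fin.
have fG n : (mu2 (G n) < +oo)%E.
  rewrite -GB; apply: le_lt_trans (leb2_le_symd (mG' n) mE) _.
  by rewrite Em; apply: lte_add_pinfty; [exact: ltry|exact: le_lt_trans (GE n) (ltry _)].
have meet i j : exists x, G i x /\ G j x.
  apply: contrapT => /forallNP h.
  have : (mu2 (G i) <= (d + d)%:E)%E.
    apply: (@le_trans _ _ (mu2 (symd (G i) (G j)))).
      by apply: le_mu2 => // x Gx; left; split => // Gjx; exact: (h x).
    by apply: le_trans (GG i j) _; rewrite lee_fin lerD.
  move=> /(leeD2r d%:E) /(le_trans (Gm i)); rewrite -EFinD lee_fin; lra.
have wid n x y : G n x -> G n y -> `|x.1 - y.1| <= 6 * (p + 1) /\ `|x.2 - y.2| <= 6 * (p + 1).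
  by move=> Gx Gy; apply: (@connected_widths (G n)) => //; apply: QC; have [] := HG n.
have [z [G0z _]] := meet 0%N 0%N.
(* A point of [G n] is reached from [z] in two stages of width at most [6 * (p + 1)], one inside
   [G 0] and one inside [G n]. The resulting range has length [24 * (p + 1)]; the side
   [25 * (p + 1)] accounts for the half-open cube. *)
pose c : R * R := (z.1 - 12 * (p + 1), z.2 - 12 * (p + 1)).
have Gc n : G n `<=` cube c (25 * (p + 1)).
  move=> x Gx; have [w [G0w Gw]] := meet 0%N n.
  have [h1 h2] := wid _ _ _ Gx Gw; have [k1 k2] := wid _ _ _ G0w G0z.
  move: h1 h2 k1 k2; rewrite !ler_norml => /andP[? ?] /andP[? ?] /andP[? ?] /andP[? ?].
  by split; apply/andP; rewrite /c /=; split; lra.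
have GG1 i : (mu2 (symd (G i) (G i.+1)) <= (2 * d / 2 ^+ i)%:E)%E.
  apply: le_trans (GG i i.+1) _; rewrite lee_fin.
  have : d / 2 ^+ i.+1 <= d / 2 ^+ i.
    by rewrite ler_pM2l// lef_pV2 ?posrE ?exprn_gt0// ler_eXn2l ?ltr1n.
  lra.
have dd0 : 0 <= 2 * d by rewrite mulr_ge0// ltW.
have /= [mA GA] := cauchy_symd_limit dd0 mG GG1.
(* The upper limit of the approximants is Borel and inherits their cube; it agrees with [E] up to a
   null set because both are limits of [G]. *)
set A := \bigcap_n _ in mA GA.
have mA' := (leb2_borel mA).1.
exists A, c; split => //.
- apply/eqP; rewrite eq_le measure_ge0 andbT; apply/lee_addgt0Pr => e e0.
  have h5 : 0 <= 5 * d by rewrite mulr_ge0// ltW.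
  have [n hn] := div_pow2_small h5 e0.
  apply: le_trans (leb2_symd_trans mE (mG' n) mA') _.
  rewrite add0e (leb2_borel (measurable_symd (mG n) mA)).2.
  apply: (@le_trans _ _ ((d / 2 ^+ n)%:E + (2 * (2 * d) / 2 ^+ n)%:E)%E).
    by apply: leeD; [rewrite symdC; exact: GE|exact: GA].
  by rewrite -EFinD lee_fin; lra.
- by move=> x /(_ 0%N I)[i _ Gx]; exact: Gc Gx.
- move=> e e0.
  have h4 : 0 <= 2 * (2 * d) by rewrite mulr_ge0.
  have [n hn] := div_pow2_small h4 e0.
  have [QG SG hp _] := HG n.
  exists (G n); split => //.
    by apply: le_trans hp _; rewrite lee_fin lerD2l; have := dn0 n; lra.
  by apply: le_trans (GA n) _; rewrite lee_fin.
Qed.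

Lemma null_symd_measure E A (m : R) : leb2_measurable E -> measurable (A : set T2) ->
  @leb2 R E = m%:E -> @leb2 R (symd E A) = 0%E -> mu2 A = m%:E.
Proof.
move=> mE mA Em N0; have [mA' AB] := leb2_borel mA.
rewrite -AB -Em; apply/eqP; rewrite eq_le; apply/andP; split.
  have N0' : @leb2 R (symd A E) = 0%E by rewrite symdC.
  by have := leb2_le_symd mA' mE; rewrite N0' adde0.
by have := leb2_le_symd mE mA'; rewrite N0 adde0.
Qed.

Lemma log_energy_cube A c (L m : R) : 1 <= 2 * L -> measurable (A : set T2) ->
  mu2 A = m%:E -> A `<=` cube c L ->
  log_energy A = (fine (self_energy (2 * L) A) - m ^+ 2 * ln (2 * L))%:E /\
  0 <= fine (self_energy (2 * L) A).
Proof.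
move=> L1 mA Am Ac; split; last exact/fine_ge0/self_energy_ge0.
rewrite (log_energyE L1 mA Am); last by move=> x y /Ac hx /Ac hy; exact: cube_dist hx hy.
rewrite EFinB fineK// ge0_fin_numE ?self_energy_ge0//.
by apply: self_energy_fin => //; rewrite Am ltry.
Qed.

Lemma energyE (l p w : R) E : Per E = p%:E -> log_energy E = w%:E ->
  energy Per l E = (p + l * w)%:E.
Proof. by move=> pE wE; rewrite /energy pE wE. Qed.

Lemma energy_ge E (m l p : R) : 0 < m -> 0 < l -> leb2_measurable E ->
  @leb2 R E = m%:E -> Per E = p%:E ->
  ((p - l * (m ^+ 2 * ln (50 * (p + 1))))%:E <= energy Per l E)%E.
Proof.
move=> m0 l0 mE Em pE.
have p0 : 0 <= p by rewrite -lee_fin -pE relaxed_perimeter_ge0.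
have [A [c [mA N0 Ac _]]] := relaxed_representative m0 mE Em pE.
have Am := null_symd_measure mE mA Em N0.
have L1 : 1 <= 2 * (25 * (p + 1)) by lra.
have [lA sA] := log_energy_cube L1 mA Am Ac.
rewrite (energyE l pE (etrans (log_energy_null_modification mE mA N0) lA)) lee_fin lerD2l.
have -> : 2 * (25 * (p + 1)) = 50 * (p + 1) by ring.
by rewrite -mulrN ler_pM2l// lerDr; move: sA; congr (0 <= fine (self_energy _ A)); ring.
Qed.

(** Solves [p - q * ln (50 * (p + 1)) <= K] for [p], where [q = l * m ^+ 2]. By
    [ln z <= z / k + ln k] with [k = 100 * q + 1], the logarithm costs at most
    [(p + 1) / 2 + q * ln k], and half of [p] survives. *)
Definition perimeter_bound (m l K : R) : R :=
  1 + 2 * (l * m ^+ 2 * ln (100 * (l * m ^+ 2) + 1) + K).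

Lemma perimeter_boundP (m l K p : R) : 0 < l -> 0 <= p ->
  p - l * (m ^+ 2 * ln (50 * (p + 1))) <= K -> p <= perimeter_bound m l K.
Proof.
move=> l0 p0; pose q := l * m ^+ 2; pose k := 100 * q + 1.
have q0 : 0 <= q by rewrite mulr_ge0 ?sqr_ge0// ltW.
have k0 : 0 < k by rewrite /k; lra.
have z0 : 0 < 50 * (p + 1) by lra.
have h : ln (50 * (p + 1)) <= 50 * (p + 1) / k + ln k.
  have zk : 0 < 50 * (p + 1) / k by rewrite divr_gt0.
  rewrite -{1}(divfK (lt0r_neq0 k0) (50 * (p + 1))) lnM ?posrE// lerD2r.
  exact/ltW/ln_sublinear.
have h2 : q * (50 * (p + 1) / k) <= (p + 1) / 2.
  rewrite mulrA ler_pdivrMr// /k.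
  have : 0 <= p + 1 by lra.
  nra.
have h3 := ler_wpM2l q0 h.
rewrite /perimeter_bound -/q -/k mulrA -/q; lra.
Qed.

Lemma energy_coercive E (m l K : R) : 0 < m -> 0 < l -> leb2_measurable E ->
  @leb2 R E = m%:E -> (energy Per l E <= K%:E)%E ->
  exists p, [/\ 0 <= p, p <= perimeter_bound m l K & Per E = p%:E].
Proof.
move=> m0 l0 mE Em hK.
have Efin : Per E != +oo%E.
  by apply/eqP => h; move: hK; rewrite /energy h eqxx leye_eq.
have P0 := relaxed_perimeter_ge0 E.
have pE : Per E = (fine (Per E))%:E by rewrite fineK// ge0_fin_numE// ltey.
have p0 : 0 <= fine (Per E) by exact: fine_ge0.
exists (fine (Per E)); split => //; apply: perimeter_boundP => //.
by rewrite -lee_fin; apply: le_trans (energy_ge m0 l0 mE Em pE) hK.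
Qed.

(** Two sets stand in for [E]: the smooth [G], to which compactness applies and which later
    approximates the limit, and the Borel [B], which keeps the exact area and energy. The common
    bound [K] fixes one cube for a whole minimizing sequence, whereas [K0] varies along it. *)
Lemma normalized_approx E (m l K0 K e : R) : 0 < m -> 0 < l -> leb2_measurable E ->
  @leb2 R E = m%:E -> (energy Per l E <= K0%:E)%E -> K0 <= K -> 0 < e ->
  let L := 25 * (perimeter_bound m l K + 1) in
  exists (p : R) (G B : set (R * R)),
    [/\ Q G /\ smooth_set G, G `<=` cube 0 L, (perimeter G <= (p + e)%:E)%E /\
        p <= perimeter_bound m l K,
        measurable (B : set T2) /\ mu2 B = m%:E /\ (mu2 (symd G B) <= e%:E)%E &
        p + l * (fine (self_energy (2 * L) B) - m ^+ 2 * ln (2 * L)) <= K0].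
Proof.
move=> m0 l0 mE Em hK K0K e0 L.
have hK' : (energy Per l E <= K%:E)%E by apply: le_trans hK _; rewrite lee_fin.
have [p [p0 pP pE]] := energy_coercive m0 l0 mE Em hK'.
have [A [c [mA N0 Ac HA]]] := relaxed_representative m0 mE Em pE.
have Am := null_symd_measure mE mA Em N0.
have [G [QG SG pG GA Gc]] := HA e e0.
have mG := open_measurable2 SG.1.
have L1 : 1 <= 2 * L by rewrite /L; lra.
have cL S : S `<=` cube c (25 * (p + 1)) -> S `<=` cube c L.
  by move=> h x /h[/andP[a b] /andP[a' b']]; split; apply/andP; split=> //;
    [apply: lt_le_trans b _|apply: lt_le_trans b' _]; rewrite lerD2l /L; lra.
have [lA _] := log_energy_cube L1 mA Am (cL _ Ac).
have trc S : S `<=` cube c L -> translate c @^-1` S `<=` cube 0 L.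
  move=> h x /h; rewrite /cube /translate /= => -[/andP[a b] /andP[a' b']].
  by split; apply/andP; split; lra.
exists p, (translate c @^-1` G), (translate c @^-1` A); split.
- by split; [exact: QT|exact: smooth_set_translate].
- by apply: trc; exact: cL.
- by rewrite perimeter_translate.
- split; first exact: measurable_preimage_translate.
  split; first by rewrite mu2_translate.
  rewrite (_ : symd _ _ = translate c @^-1` symd G A)//.
  by rewrite mu2_translate//; exact: measurable_symd.
- rewrite self_energy_translate// -lee_fin.
  by rewrite -(energyE l pE (etrans (log_energy_null_modification mE mA N0) lA)).
Qed.

(** Every essential point has a point of the representative [A] at distance less than 1, as
    otherwise the part of [E] in the unit ball around it would lie in a null set. The term 2 pays
    for the two unit distances, the factor 2 for the two coordinates. *)
Lemma minimizer_ess_diam E (m l K : R) : 0 < m -> 0 < l -> leb2_measurable E ->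
  @leb2 R E = m%:E -> (energy Per l E <= K%:E)%E ->
  (ess_diam E <= (2 * (25 * (perimeter_bound m l K + 1) + 2))%:E)%E.
Proof.
move=> m0 l0 mE Em hK.
have [p [p0 pP pE]] := energy_coercive m0 l0 mE Em hK.
have [A [c [mA N0 Ac _]]] := relaxed_representative m0 mE Em pE.
have [mA' _] := leb2_borel mA.
have near_cube x : ess_point E x -> exists a, cube c (25 * (p + 1)) a /\ enorm (a - x) < 1.
  move=> /(_ 1 ltr01) h; apply: contrapT => /forallNP H; move: h.
  have ob : open (eball x 1).
    rewrite (_ : eball x 1 = translate (- x) @^-1` disk 1)//.
    by apply: open_comp; [move=> z _; exact: continuous_translate|exact: open_disk].
  rewrite ltNge => /negP; apply; rewrite -N0; apply: le_measure; rewrite ?inE.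
  - by apply: measurableI => //; exact: open_leb2.
  - by apply: measurableU; exact: measurableD.
  - move=> z [Ez bz]; left; split => // Az; apply: (H z); split => //; exact: Ac.
apply: ge_ereal_sup => _ [x [y [/near_cube[a [ca ax]] /near_cube[b [cb bx]] ->]]].
rewrite lee_fin; apply: le_trans (enorm_le _) _.
have [a1 a2] := enorm_ge (a - x); have [b1 b2] := enorm_ge (b - y).
have := le_lt_trans a1 ax; have := le_lt_trans a2 ax.
have := le_lt_trans b1 bx; have := le_lt_trans b2 bx.
rewrite /= !ltr_norml => /andP[? ?] /andP[? ?] /andP[? ?] /andP[? ?].
move: ca cb => [/andP[? ?] /andP[? ?]] [/andP[? ?] /andP[? ?]].
have h1 : `|x.1 - y.1| <= 25 * (p + 1) + 2 by rewrite ler_norml; apply/andP; split; lra.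
have h2 : `|x.2 - y.2| <= 25 * (p + 1) + 2 by rewrite ler_norml; apply/andP; split; lra.
lra.
Qed.

End Relaxation.

(** * Existence of minimizers *)

Section Existence.
Context {R : realType}.
Notation lam := (@lebesgue_measure R).
Notation T1 := (measurableTypeR R).
Notation T2 := (T1 * T1)%type.
Notation mu2 := (lam \x lam)%E.

Lemma mu2_le_symd (A B : set (R * R)) : measurable (A : set T2) -> measurable (B : set T2) ->
  (mu2 A <= mu2 B + mu2 (symd A B))%E.
Proof. exact: measure_le_symd. Qed.

Lemma potential_bound_le (D a b : R) : 1 <= D -> a <= b ->
  potential_bound D a <= potential_bound D b.
Proof.
move=> D1 ab; rewrite /potential_bound lerD//.
  by rewrite ler_pM2l// ler_wsqrtr.
by rewrite ler_wpM2r// lnD0.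
Qed.

Lemma self_energy_symd (D m e : R) (A B : set (R * R)) : 1 <= D ->
  measurable (A : set T2) -> measurable (B : set T2) -> mu2 A = m%:E -> mu2 B = m%:E ->
  (mu2 (symd A B) <= e%:E)%E ->
  fine (self_energy D A) <= fine (self_energy D B) +
    (m * potential_bound D e + e * potential_bound D m).
Proof.
move=> D1 mA mB Am Bm ABe.
have mAB : measurable (A `\` B : set T2) by exact: measurableD.
have le : (mu2 (A `\` B) <= e%:E)%E.
  apply: le_trans ABe; apply: le_mu2 => //; first exact: measurable_symd.
  by move=> x; left.
have fAB : mu2 (A `\` B) = (fine (mu2 (A `\` B)))%:E.
  by rewrite fineK// ge0_fin_numE ?measure_ge0//; exact: le_lt_trans le (ltry _).
have m0 : 0 <= m by rewrite -lee_fin -Am measure_ge0.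
have de : fine (mu2 (A `\` B)) <= e by rewrite -lee_fin -fAB.
have fin S : measurable (S : set T2) -> mu2 S = m%:E ->
    self_energy D S = (fine (self_energy D S))%:E.
  move=> mS Sm; rewrite fineK// ge0_fin_numE ?self_energy_ge0//.
  by apply: self_energy_fin => //; rewrite Sm ltry.
have := self_energy_le D1 mA mB Am Bm fAB.
rewrite (fin _ mA Am) (fin _ mB Bm) -EFinD lee_fin => /le_trans; apply.
rewrite lerD2l lerD//; first by rewrite ler_wpM2l// potential_bound_le.
by rewrite ler_wpM2r// potential_bound_ge0.
Qed.

(** Converts near-minimality of [B] into a bound for the perimeter of the approximant: [t2] enters
    once through the infimum and once through the relaxation. *)
Lemma energy_gap (p i t1 t2 l se sb z e : R) : 0 <= l -> se <= sb + e ->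
  p + l * (sb - z) <= i + t2 -> t2 <= t1 -> p + t2 <= i - l * (se - z) + (2 * t1 + l * e).
Proof.
move=> l0 /(ler_wpM2l l0); rewrite !(mulrDr l, mulrN l).
by move: (l * se) (l * sb) (l * z) (l * e) => a1 a2 a3 a4; lra.
Qed.

Let t (k : nat) : R := k.+1%:R^-1.

Let t_gt0 k : 0 < t k. Proof. by rewrite invr_gt0. Qed.

Let t_le j k : (j <= k)%N -> t k <= t j.
Proof. by move=> jk; rewrite lef_pV2 ?posrE// ler_nat. Qed.

Let t_le1 k : t k <= 1. Proof. by rewrite invf_le1// ler1n. Qed.

Let t_pow k : (2 ^+ k)^-1 <= t k.
Proof. by rewrite lef_pV2 ?posrE ?exprn_gt0// -natrX ler_nat ltn_expl. Qed.

Let t_cvg0 : t @ \oo --> 0. Proof. exact: cvg_harmonic. Qed.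

Let cvg_EFin_real (u : nat -> R) (l : R) : u @ \oo --> l ->
  (fun k => (u k)%:E) @ \oo --> l%:E.
Proof. by move=> ul; apply/fine_cvgP; split => //; exact: nearW. Qed.

Variable Q : set (R * R) -> Prop.
Hypothesis QC : forall A, Q A -> connected A.
Hypothesis QT : forall A v, Q A -> Q (translate v @^-1` A).
Notation Per := (relaxed_perimeter Q).
Variables (m l : R).
Hypotheses (m0 : 0 < m) (l0 : 0 < l).

(** Below the threshold [K] coercivity bounds the perimeter, and with it the diameter and the
    logarithm; above the threshold, [K] itself is the bound. *)
Lemma energy_bounded_below (K : R) : exists c : R, forall F, leb2_measurable F ->
  @leb2 R F = m%:E -> (c%:E <= energy Per l F)%E.
Proof.
pose P := perimeter_bound m l K.
pose b := l * (m ^+ 2 * `|ln (50 * (P + 1))|).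
have b0 : 0 <= b by rewrite !mulr_ge0 ?sqr_ge0// ltW.
exists (- `|K| - b) => F mF Fm.
have [h|/ltW h] := leP K%:E (energy Per l F).
  apply: le_trans h; rewrite lee_fin; have := ler_norm (- K); rewrite normrN; lra.
have [p [p0 pP pE]] := energy_coercive QC m0 l0 mF Fm h.
apply: le_trans (energy_ge QC m0 l0 mF Fm pE); rewrite lee_fin.
have : l * (m ^+ 2 * ln (50 * (p + 1))) <= b.
  rewrite ler_pM2l// ler_wpM2l ?sqr_ge0//; apply: le_trans (ler_norm _).
  by rewrite ler_ln ?posrE /P; lra.
have := normr_ge0 K; lra.
Qed.

(** The numbers [p k] are not assumed to converge: each is bounded by nearly minimal energy minus
    interaction, and the interaction of [B] converges to that of the limit. The relaxed perimeter of
    the limit is thus at most the infimum minus its own interaction. *)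
Lemma minimizing_limit (i : R) (G B : nat -> set (R * R)) (p : nat -> R) (P : R) :
  let L := 25 * (P + 1) in
  (forall k, Q (G k) /\ smooth_set (G k)) -> (forall k, G k `<=` cube 0 L) ->
  (forall k, (perimeter (G k) <= (p k + t k)%:E)%E /\ p k <= P) ->
  (forall k, measurable (B k : set T2) /\ mu2 (B k) = m%:E /\
     (mu2 (symd (G k) (B k)) <= (t k)%:E)%E) ->
  (forall k, p k + l * (fine (self_energy (2 * L) (B k)) - m ^+ 2 * ln (2 * L)) <= i + t k) ->
  exists E, [/\ leb2_measurable E, @leb2 R E = m%:E & (energy Per l E <= i%:E)%E].
Proof.
move=> L QG GL pG HB HE.
(* Since [t 1] is 1/2, nonnegativity of the perimeter of [G 1] gives [0 <= P + 1/2]; index 0, where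
   [t 0 = 1], would leave no strict inequality. *)
have P1 : 0 < P + 1.
  have [h1 h2] := pG 1%N.
  have := le_trans (perimeter_ge0 (open_measurable2 (QG 1%N).2.1)) h1.
  rewrite lee_fin /t => h3.
  suff : 2^-1 < 1 :> R by lra.
  by rewrite invf_lt1// ltr1n.
have P0 : 0 <= P + 1 by exact: ltW.
have L0 : 0 < L by rewrite mulr_gt0.
have oG k : open (G k) := (QG k).2.1.
have GL' k x : G k x -> 0 <= x.1 < L /\ 0 <= x.2 < L.
  by move=> /GL; rewrite /cube /= !add0r.
have pG1 k : (perimeter (G k) <= (P + 1)%:E)%E.
  have [h1 h2] := pG k; apply: le_trans h1 _; rewrite lee_fin; have := t_le1 k; lra.
have [E [s [mE EL sk hs]]] := finite_perimeter_compact L0 P0 oG GL' pG1.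
have mG k := open_measurable2 (oG k).
have GE k : (mu2 (symd (G (s k)) E) <= (4 * t k)%:E)%E.
  by apply: le_trans (hs k) _; rewrite lee_fin ler_pM2l.
have EB k : (mu2 (symd E (B (s k))) <= (5 * t k)%:E)%E.
  have [mB [_ hB]] := HB (s k).
  apply: le_trans (mu2_symd_trans mE (mG (s k)) mB) _.
  apply: (@le_trans _ _ ((4 * t k)%:E + (t (s k))%:E)%E).
    by apply: leeD; [rewrite symdC; exact: GE|exact: hB].
  by rewrite -EFinD lee_fin; have := t_le (sk k); lra.
have small e : 0 < e -> exists k, 5 * t k <= e.
  move=> e0; have h0 : 0 <= 5 / e by rewrite divr_ge0// ltW.
  exists (Num.Def.archi_bound (5 / e)); rewrite /t ler_pdivrMr// mulrC -ler_pdivrMr//.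
  by apply: (le_trans (ltW (archi_boundP h0))); rewrite ler_nat.
have Em : mu2 E = m%:E.
  apply/eqP; rewrite eq_le; apply/andP; split; apply/lee_addgt0Pr => e e0;
    have [k hk] := small e e0; have [mB [Bm _]] := HB (s k).
    apply: le_trans (mu2_le_symd mE mB) _; rewrite Bm; apply: leeD2l.
    by apply: le_trans (EB k) _; rewrite lee_fin.
  rewrite -Bm; apply: le_trans (mu2_le_symd mB mE) _; apply: leeD2l.
  by rewrite symdC; apply: le_trans (EB k) _; rewrite lee_fin.
have [mE' EE] := leb2_borel mE.
have D1 : 1 <= 2 * L.
  have [h1 h2] := pG 1%N.
  have := le_trans (perimeter_ge0 (open_measurable2 (QG 1%N).2.1)) h1.
  rewrite lee_fin /t => h3.
  suff : 2^-1 <= 2^-1 :> R by rewrite /L; lra.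
  by [].
have Ec : E `<=` cube 0 L by move=> x /EL; rewrite /cube /= !add0r.
have [lE _] := log_energy_cube D1 mE Em Ec.
pose w := fine (self_energy (2 * L) E) - m ^+ 2 * ln (2 * L).
(* The total error at stage [k], for sets that differ by area at most [5 * t k]; it vanishes in the
   limit because the potential bound does so at area 0. *)
pose v k := 2 * t k + l * (m * potential_bound (2 * L) (5 * t k) +
  5 * t k * potential_bound (2 * L) m).
have v0 : v @ \oo --> 0.
  have t5 : (fun k => 5 * t k) @ \oo --> 0.
    by rewrite -[0](mulr0 5); apply: cvgM => //; exact: cvg_cst.
  have ts : (fun k => Num.sqrt (5 * t k)) @ \oo --> 0.
    by rewrite -[0]sqrtr0; apply: continuous_cvg t5; exact: sqrt_continuous.
  have -> : 0 = 2 * 0 + l * (m * (4 * 0 + 0 * ln (2 * L)) + 0 * potential_bound (2 * L) m) :> R.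
    by rewrite !(mulr0, mul0r, addr0).
  apply: cvgD; first by apply: cvgM => //; exact: cvg_cst.
  apply: cvgM; first exact: cvg_cst.
  apply: cvgD; last by apply: cvgM => //; exact: cvg_cst.
  apply: cvgM; first exact: cvg_cst.
  by apply: cvgD; apply: cvgM => //; exact: cvg_cst.
have PerE : (Per E <= (i - l * w)%:E)%E.
  apply: (@relaxed_perimeter_le _ _ (G \o s) E (fun k => (i - l * w + v k)%:E)) => //.
  - by move=> k; exact: QG.
  - apply: (@squeeze_cvge _ _ _ _ (fun=> 0%E) _ (fun k => (4 * t k)%:E)).
    + apply: nearW => k; rewrite measure_ge0 /=.
      by rewrite (leb2_borel (measurable_symd (mG (s k)) mE)).2; exact: GE.
    + exact: cvg_cst.
    + apply: cvg_EFin_real; rewrite -[0](mulr0 4); apply: cvgM => //; exact: cvg_cst.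
  - move=> k; have [h1 _] := pG (s k); apply: le_trans h1 _; rewrite lee_fin.
    have [mB [Bm _]] := HB (s k).
    exact: (energy_gap (ltW l0) (self_energy_symd D1 mE mB Em Bm (EB k)) (HE (s k)) (t_le (sk k))).
  - by apply: cvg_EFin_real; rewrite -[X in _ --> X]addr0; apply: cvgD => //; exact: cvg_cst.
exists E; split => //; first by rewrite EE.
have Per0 := relaxed_perimeter_ge0 Q E.
have fP : Per E = (fine (Per E))%:E.
  by rewrite fineK// ge0_fin_numE//; exact: le_lt_trans PerE (ltry _).
rewrite (energyE l fP lE) lee_fin -/w.
by move: PerE; rewrite fP lee_fin; lra.
Qed.

Lemma minimizer_exists F0 : leb2_measurable F0 -> @leb2 R F0 = m%:E ->
  (energy Per l F0 < +oo)%E -> exists E, is_minimizer Per m l E.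
Proof.
move=> mF0 F0m hF0.
pose S := [set energy Per l F | F in [set F | leb2_measurable F /\ @leb2 R F = m%:E]].
have [c hc] := energy_bounded_below 0.
have hl : (c%:E <= ereal_inf S)%E.
  by apply: le_ereal_inf_tmp => _ [F [mF Fm] <-]; exact: hc.
have hu : (ereal_inf S < +oo)%E.
  by apply: le_lt_trans hF0; apply: ereal_inf_lbound; exists F0.
have [i iE] : exists i : R, ereal_inf S = i%:E.
  by move: hl hu; case: (ereal_inf S) => [r _ _|//|//]; exists r.
pose P := perimeter_bound m l (i + 1); pose L := 25 * (P + 1).
have H k : exists q : R * set (R * R) * set (R * R),
    [/\ Q q.1.2 /\ smooth_set q.1.2, q.1.2 `<=` cube 0 L,
        (perimeter q.1.2 <= (q.1.1 + t k)%:E)%E /\ q.1.1 <= P,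
        measurable (q.2 : set T2) /\ mu2 q.2 = m%:E /\ (mu2 (symd q.1.2 q.2) <= (t k)%:E)%E &
        q.1.1 + l * (fine (self_energy (2 * L) q.2) - m ^+ 2 * ln (2 * L)) <= i + t k].
  have Sfin : ereal_inf S \is a fin_num by rewrite iE.
  have [_ [F [mF Fm] <-] h] := lb_ereal_inf_adherent (t_gt0 k) Sfin.
  have hF : (energy Per l F <= (i + t k)%:E)%E by rewrite EFinD -iE ltW.
  have it : i + t k <= i + 1 by rewrite lerD2l.
  have [p [G [B HH]]] := normalized_approx QC QT m0 l0 mF Fm hF it (t_gt0 k).
  by exists (p, G, B).
have [q Hq] := choice H.
have [|||||E [mE Em hE]] := @minimizing_limit i (fun k => (q k).1.2) (fun k => (q k).2)
    (fun k => (q k).1.1) P.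
- by move=> k; have [] := Hq k.
- by move=> k; have [] := Hq k.
- by move=> k; have [] := Hq k.
- by move=> k; have [] := Hq k.
- by move=> k; have [] := Hq k.
exists E; split; [exact: mE|exact: Em|move=> F mF Fm].
apply: (le_trans hE); rewrite -iE; apply: ereal_inf_lbound.
by exists F; [split|].
Qed.

End Existence.

Section DiskEnergy.
Context {R : realType}.
Notation lam := (@lebesgue_measure R).
Notation mu2 := (lam \x lam)%E.

(** The competitor and its energy bound are fixed before the class [Q], so the same [K] serves both
    minimization problems. *)
Lemma disk_energy (m l : R) : 0 < m -> 0 < l -> exists (F : set (R * R)) (K : R),
  [/\ leb2_measurable F, @leb2 R F = m%:E &
    forall Q : set (R * R) -> Prop, (forall r, 0 < r -> Q (disk r)) ->
      (energy (relaxed_perimeter Q) l F <= K%:E)%E].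
Proof.
move=> m0 l0; have [r r0 hr] := disk_of_area m0.
have mD := @measurable_disk R r; have [mD' DE] := leb2_borel mD.
have D1 : 1 <= 2 * (2 * r + 1) by lra.
have Dc : disk r `<=` cube (- r, - r) (2 * r + 1).
  move=> x hx; have [h1 h2] := enorm_ge x.
  have := le_lt_trans h1 hx; have := le_lt_trans h2 hx.
  by rewrite !ltr_norml => /andP[? ?] /andP[? ?]; split; rewrite /=; apply/andP; split; lra.
have [lD _] := log_energy_cube D1 mD hr Dc.
set w := (X in X%:E) in lD.
exists (disk r), (8 * r + l * w); split => //; first by rewrite DE.
move=> Q HQ.
have P8 : (relaxed_perimeter Q (disk r) <= (8 * r)%:E)%E.
  apply: (@relaxed_perimeter_le _ _ (fun=> disk r) _ (fun=> (8 * r)%:E)) => //.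
  - by move=> _; split; [exact: HQ|exact: smooth_disk].
  - rewrite (_ : (fun _ => _) = (fun=> 0%E)); first exact: cvg_cst.
    by apply/funext => _; rewrite /symd setDv setU0 measure0.
  - by move=> _; exact: perimeter_disk.
  - exact: cvg_cst.
have P0 := relaxed_perimeter_ge0 Q (disk r).
have fP : relaxed_perimeter Q (disk r) = (fine (relaxed_perimeter Q (disk r)))%:E.
  by rewrite fineK// ge0_fin_numE//; exact: le_lt_trans P8 (ltry _).
by rewrite (energyE l fP lD) lee_fin lerD2r -lee_fin -fP.
Qed.

End DiskEnergy.

Theorem theorem3p4 (R : realType) (m lambda : R) (hm : 0 < m)
    (hlambda : 0 < lambda) :
  (exists E : set (R * R), is_minimizer connected_perimeter m lambda E) /\
  (exists E : set (R * R),
      is_minimizer simply_connected_perimeter m lambda E) /\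
  (exists2 C : R, 0 < C &
     forall E : set (R * R),
       is_minimizer connected_perimeter m lambda E \/
       is_minimizer simply_connected_perimeter m lambda E ->
       (ess_diam E < C%:E)%E).
Proof.
have [F [K [mF Fm FK]]] := disk_energy hm hlambda.
have FC : (energy connected_perimeter lambda F <= K%:E)%E.
  by apply: FK => r r0; apply: path_connected_connected; exact: disk_path_connected.
have FS : (energy simply_connected_perimeter lambda F <= K%:E)%E.
  by apply: FK => r r0; exact: disk_simply_connected.
have QC (A : set (R * R)) : simply_connected R A -> connected A.
  by move=> [pA _]; exact: path_connected_connected.
split; [|split].
- apply: (minimizer_exists _ (@connected_translate R) hm hlambda mF Fm) => //.
  exact: le_lt_trans FC (ltry _).
- apply: (minimizer_exists QC (@simply_connected_translate R) hm hlambda mF Fm) => //.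
  exact: le_lt_trans FS (ltry _).
pose C := 2 * (25 * (perimeter_bound m lambda K + 1) + 2).
(* The absolute value gives positivity, the added 1 the strict inequality. *)
exists (`|C| + 1); first by rewrite ltr_wpDl.
move=> E HE; apply: (@le_lt_trans _ _ C%:E); last first.
  by rewrite lte_fin; have := ler_norm C; lra.
case: HE => -[mE Em hE].
  exact: (minimizer_ess_diam (fun A h => h) hm hlambda mE Em (le_trans (hE F mF Fm) FC)).
exact: (minimizer_ess_diam QC hm hlambda mE Em (le_trans (hE F mF Fm) FS)).
Qed.
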